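(* Let $0<d<\pi/2$, and let $\psi_2(\zeta)=\mathrm{e}^{\zeta}$ and $\psi_3(\zeta)=\operatorname{arcsinh}(\mathrm{e}^{\zeta})$. The following holds for $i=2$ and for $i=3$. Let $f$ be analytic in $\psi_i(\mathscr{D}_d)$ and assume that there exist positive constants $K,\alpha,\beta$ such that $|f(z)|\le K|E_i(z;\alpha,\beta)|$ for all $z\in\psi_i(\mathscr{D}_d)$. Let $\mu=\min\{\alpha,\beta\}$. For a positive integer $n$ let $h=\sqrt{\pi d/(\mu n)}$, and let $M,N$ be defined by $M=n,\ N=\lceil\alpha n/\beta\rceil$ if $\mu=\alpha$, and $N=n,\ M=\lceil\beta n/\alpha\rceil$ if $\mu=\beta$. Then $$\sup_{t\in(0,\infty)}\left|f(t)-\sum_{k=-M}^{N}f(\psi_i(kh))\,S(k,h)(\psi_i^{-1}(t))\right|\le C_i\sqrt{n}\,\mathrm{e}^{-\sqrt{\pi d\mu n}},$$ where $$C_2=\frac{2K}{\sqrt{\pi d\mu}}\left\{\frac{2}{\sqrt{\pi d\mu}\,(1-\mathrm{e}^{-2\sqrt{\pi d\mu}})\{\cos d\}^{(\alpha+\beta)/2}}+1\right\},$$ $$C_3=\frac{2K}{\sqrt{\pi d\mu}}\left\{\frac{2^{1+(\alpha+\beta)/2}}{\sqrt{\pi d\mu}\,(1-\mathrm{e}^{-2\sqrt{\pi d\mu}})\{\cos(d/2)\}^{\alpha+\beta}}+1\right\}.$$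
   Context: For $d>0$: $\mathscr{D}_d=\{\zeta\in\mathbb{C}:|\operatorname{Im}\zeta|<d\}$; $\psi(\mathscr{D}_d)$ is the image of $\mathscr{D}_d$ under $\psi$. The Sinc function is $S(k,h)(x)=\frac{\sin[\pi(x/h-k)]}{\pi(x/h-k)}$ (with value $1$ at $x=kh$). $E_2(z;\alpha,\beta)=\frac{z^{\alpha}}{(1+z^2)^{(\alpha+\beta)/2}}$ and $E_3(z;\alpha,\beta)=\left(\frac{z}{1+z}\right)^{\alpha}\mathrm{e}^{-\beta z}$; for real exponents $|w^{a}|=|w|^{a}$, so $|E_2(z;\alpha,\beta)|=|z|^\alpha/|1+z^2|^{(\alpha+\beta)/2}$ and $|E_3(z;\alpha,\beta)|=\left|\frac{z}{1+z}\right|^{\alpha}|\mathrm{e}^{-\beta z}|$. $\operatorname{arcsinh}$ is the principal branch, $\operatorname{arcsinh}(w)=\log(w+\sqrt{1+w^2})$. $\psi_i^{-1}$ is the inverse of $\psi_i:\mathbb{R}\to(0,\infty)$. *)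

(* Defs.v *)
From Stdlib Require Import Reals ZArith ClassicalEpsilon.
From Coquelicot Require Import Coquelicot.

Open Scope R_scope.

Definition Cexp (z : C) : C :=
  (exp (Re z) * cos (Im z), exp (Re z) * sin (Im z)).

(** Values in (-PI, PI]; the value at 0 is junk. *)
Definition Carg (z : C) : R :=
  if Rle_dec 0 (Im z) then acos (Re z / Cmod z) else - acos (Re z / Cmod z).

(** Principal branch, cut along the negative real axis; the value at 0 is junk. *)
Definition Clog (z : C) : C := (ln (Cmod z), Carg z).

(** Real power of a complex number, with 0^a = 0: only exponents a > 0 are used. *)
Definition Cpowr (z : C) (a : R) : C :=
  if Ceq_dec z (RtoC 0) then RtoC 0
  else Cexp (RtoC a * Clog z)%C.

Definition Csqrt (z : C) : C := Cpowr z (1 / 2).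

Definition Carcsinh (w : C) : C := Clog (w + Csqrt (1 + w * w))%C.

Definition strip (d : R) (z : C) : Prop := Rabs (Im z) < d.

Definition image (g : C -> C) (A : C -> Prop) (z : C) : Prop :=
  exists w : C, A w /\ g w = z.

(** Complex differentiability at every point. The derivative is taken in C, so
    on an open set [D] this depends only on the values of [f] in [D]. *)
Definition analytic_in (D : C -> Prop) (f : C -> C) : Prop :=
  forall z : C, D z -> @ex_derive C_AbsRing C_NormedModule f z.

Inductive case_index : Set := two | three.

Definition psi (i : case_index) (zeta : C) : C :=
  match i with
  | two => Cexp zeta
  | three => Carcsinh (Cexp zeta)
  end.

(** For [t > 0], the real [x] such that [psi i x = t]: the inverse of the
    restriction of [psi i] to a map from R onto (0, +oo). *)
Definition psi_inv (i : case_index) (t : R) : R :=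
  epsilon (inhabits 0) (fun x : R => psi i (RtoC x) = RtoC t).

Definition E (i : case_index) (z : C) (alpha beta : R) : C :=
  match i with
  | two => (Cpowr z alpha / Cpowr (1 + z * z) ((alpha + beta) / 2))%C
  | three => (Cpowr (z / (1 + z)) alpha * Cexp (- (RtoC beta * z)))%C
  end.

Definition error_const (i : case_index) (K d alpha beta : R) : R :=
  let r := sqrt (PI * d * Rmin alpha beta) in
  match i with
  | two =>
      2 * K / r *
      (2 / (r * (1 - exp (- (2 * r))) * Rpower (cos d) ((alpha + beta) / 2)) + 1)
  | three =>
      2 * K / r *
      (Rpower 2 (1 + (alpha + beta) / 2)
         / (r * (1 - exp (- (2 * r))) * Rpower (cos (d / 2)) (alpha + beta)) + 1)
  end.

Definition sinc (k : Z) (h x : R) : R :=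
  if Req_EM_T x (IZR k * h) then 1
  else sin (PI * (x / h - IZR k)) / (PI * (x / h - IZR k)).

Definition sumZ (M N : nat) (g : Z -> C) : C :=
  sum_n (fun j : nat => g (Z.of_nat j - Z.of_nat M)%Z) (M + N).

Definition sinc_approx (i : case_index) (f : C -> C) (h : R) (M N : nat) (t : R) : C :=
  sumZ M N (fun k : Z =>
    (f (psi i (RtoC (IZR k * h))) * RtoC (sinc k h (psi_inv i t)))%C).

(* Main.v *)
(** Put F = f o psi. For real x off the nodes kh, the function
    F(z) / ((z - x) sin(pi z / h)) has simple poles at x and at the nodes; by the
    residue theorem on the rectangle |Re z| <= (L + 1/2) h, |Im z| <= y < d, the
    error F(x) - sum_(|k| <= L) F(kh) S(k,h)(x) is sin(pi x / h) / (2 pi i) times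
    its boundary integral. The denominator is at least y sinh(pi y / h) on the
    horizontal sides and at least 1 on the vertical ones, and F decays like
    exp(alpha Re z) at -oo and exp(-beta Re z) at +oo; letting L -> oo and y -> d
    bounds the error of the full cardinal series. Truncating to -M <= k <= N adds
    two geometric tails, and the choice of h balances the two errors. *)
Require Import Defs.
From Stdlib Require Import Reals ZArith Lra Lia Psatz ClassicalEpsilon.
From Coquelicot Require Import Coquelicot.

Open Scope R_scope.

(** * Continuity and differentiability in the complex plane *)

(** [f] is controlled only inside the open strip, so no contour touches |Im z| = d; each y < d
    bounds the error of the finite sum, and only the resulting numbers are sent to d. The infinite
    cardinal series is never formed: the truncated sum is compared with the sums over |k| <= L, up
    to an arbitrary eps for large L. The contours are rectangles and the poles simple, so Goursat's
    theorem and one explicit integral of 1 / (z - p) over a square suffice; a pole is isolated by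
    cutting rectangles, not by deforming paths. The braces in C_i hold two terms because F is
    bounded with two constants. On the strip, |E_i(psi_i(z))| picks up a factor from the conformal
    map (a cosine, a power of 2), which enters the contour integral. On the real axis the same bound
    holds with constant 1, and only this enters the tails; it gives the summand 1. The factor 1 -
    exp(-2 sqrt(pi d mu)) comes from 1 / sinh(pi d / h), taken at n = 1, its worst case. *)

Definition Cnear (z : C) (P : C -> Prop) : Prop :=
  exists delta, 0 < delta /\ forall w, Cmod (w - z) < delta -> P w.

Lemma Cnear_and z P Q : Cnear z P -> Cnear z Q -> Cnear z (fun w => P w /\ Q w).
Proof.
intros [d1 [Hd1 H1]] [d2 [Hd2 H2]].
exists (Rmin d1 d2); split; [now apply Rmin_pos|].
intros w Hw; split.
- apply H1; eapply Rlt_le_trans; [apply Hw|apply Rmin_l].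
- apply H2; eapply Rlt_le_trans; [apply Hw|apply Rmin_r].
Qed.

Lemma Cnear_mono z (P Q : C -> Prop) :
  (forall w, P w -> Q w) -> Cnear z P -> Cnear z Q.
Proof. intros HPQ [d [Hd H]]; exists d; split; auto. Qed.

Lemma Cmod_minus_diag z : Cmod (z - z) = 0.
Proof. replace (z - z)%C with (RtoC 0) by ring; apply Cmod_0. Qed.

Lemma Cmod_minus_sym z w : Cmod (z - w) = Cmod (w - z).
Proof. rewrite <- Cmod_opp; f_equal; ring. Qed.

Lemma Cnear_self z P : Cnear z P -> P z.
Proof. intros [d [Hd H]]; apply H; now rewrite Cmod_minus_diag. Qed.

(** Neighbourhoods and limits are phrased through [Cmod], in which the algebraic estimates are
    natural; [Ccont_iff_continuous] passes to the topology used by the integrals. *)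
Definition Ccont (f : C -> C) (z : C) : Prop :=
  forall eps, 0 < eps -> Cnear z (fun w => Cmod (f w - f z) < eps).

Lemma Ccont_const c z : Ccont (fun _ => c) z.
Proof.
intros eps He; exists 1; split; [lra|]; intros w _; now rewrite Cmod_minus_diag.
Qed.

Lemma Ccont_id z : Ccont (fun w => w) z.
Proof. intros eps He; now exists eps. Qed.

Lemma Ccont_ext_near f g z :
  Cnear z (fun w => f w = g w) -> Ccont f z -> Ccont g z.
Proof.
intros Heq Hf eps He.
pose proof (Cnear_self _ _ Heq) as Hz; simpl in Hz.
generalize (Cnear_and _ _ _ Heq (Hf eps He)); apply Cnear_mono.
intros w [H1 H2]; now rewrite <- H1, <- Hz.
Qed.

Lemma Ccont_plus f g z :
  Ccont f z -> Ccont g z -> Ccont (fun w => f w + g w)%C z.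
Proof.
intros Hf Hg eps He.
assert (He2 : 0 < eps / 2) by lra.
apply (Cnear_mono z (fun w => Cmod (f w - f z) < eps / 2 /\ Cmod (g w - g z) < eps / 2)).
- intros w [H1 H2].
  replace (f w + g w - (f z + g z))%C with ((f w - f z) + (g w - g z))%C by ring.
  eapply Rle_lt_trans; [apply Cmod_triangle|lra].
- apply Cnear_and; auto.
Qed.

Lemma Ccont_mult f g z :
  Ccont f z -> Ccont g z -> Ccont (fun w => f w * g w)%C z.
Proof.
intros Hf Hg eps He.
pose proof (Cmod_ge_0 (f z)) as Pf. pose proof (Cmod_ge_0 (g z)) as Pg.
set (e := Rmin 1 (eps / (Cmod (f z) + Cmod (g z) + 2))).
assert (Hc : 0 < eps / (Cmod (f z) + Cmod (g z) + 2)) by (apply Rdiv_lt_0_compat; lra).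
assert (He0 : 0 < e) by (apply Rmin_pos; lra).
assert (He1 : e <= 1) by apply Rmin_l.
assert (He2 : e * (Cmod (f z) + Cmod (g z) + 2) <= eps).
{ apply Rle_trans with (eps / (Cmod (f z) + Cmod (g z) + 2) * (Cmod (f z) + Cmod (g z) + 2)).
  - apply Rmult_le_compat_r; [lra|apply Rmin_r].
  - right; field; lra. }
apply (Cnear_mono z (fun w => Cmod (f w - f z) < e /\ Cmod (g w - g z) < e)).
2: apply Cnear_and; auto.
intros w [H1 H2].
replace (f w * g w - f z * g z)%C
  with ((f w - f z) * (g w - g z) + ((f w - f z) * g z + f z * (g w - g z)))%C by ring.
eapply Rle_lt_trans; [apply Cmod_triangle|].
eapply Rle_lt_trans; [apply Rplus_le_compat_l, Cmod_triangle|].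
rewrite !Cmod_mult.
pose proof (Cmod_ge_0 (f w - f z)). pose proof (Cmod_ge_0 (g w - g z)).
nra.
Qed.

Lemma Ccont_neq_0 (f : C -> C) z : Ccont f z -> f z <> 0 -> Cnear z (fun w => f w <> 0).
Proof.
intros Hf Hz.
apply (Cnear_mono z (fun w => Cmod (f w - f z) < Cmod (f z))).
- intros w H H0; rewrite H0 in H.
  replace (0 - f z)%C with (- f z)%C in H by ring.
  rewrite Cmod_opp in H; lra.
- apply Hf; now apply Cmod_gt_0.
Qed.

Lemma Ccont_inv f z : Ccont f z -> f z <> 0 -> Ccont (fun w => / f w)%C z.
Proof.
intros Hf Hz eps He.
assert (Hm : 0 < Cmod (f z)) by now apply Cmod_gt_0.
apply (Cnear_mono z (fun w => Cmod (f w - f z) < Cmod (f z) / 2 /\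
    Cmod (f w - f z) < eps * (Cmod (f z) * Cmod (f z) / 2))).
2: { apply Cnear_and; apply Hf; [lra|]. apply Rmult_lt_0_compat; [lra|]; nra. }
intros w [H1 H2].
assert (Hw : Cmod (f z) / 2 < Cmod (f w)).
{ pose proof (Cmod_triangle (f w) (- (f w - f z))) as H.
  replace (f w + - (f w - f z))%C with (f z) in H by ring.
  rewrite Cmod_opp in H; lra. }
assert (Hw0 : f w <> 0) by (apply Cmod_gt_0; lra).
replace (/ f w - / f z)%C with (- (f w - f z) / (f w * f z))%C by (field; auto).
rewrite Cmod_div by now apply Cmult_neq_0.
rewrite Cmod_opp, Cmod_mult.
apply Rlt_div_l; [apply Rmult_lt_0_compat; lra|].
eapply Rlt_le_trans; [apply H2|].
apply Rmult_le_compat_l; nra.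
Qed.

Lemma Ccont_comp f g z : Ccont g z -> Ccont f (g z) -> Ccont (fun w => f (g w)) z.
Proof.
intros Hg Hf eps He.
destruct (Hf eps He) as [d [Hd H]].
apply (Cnear_mono z (fun w => Cmod (g w - g z) < d)); auto.
Qed.

Lemma Cnear_comp g z P : Ccont g z -> Cnear (g z) P -> Cnear z (fun w => P (g w)).
Proof.
intros Hg [d [Hd H]].
apply (Cnear_mono z (fun w => Cmod (g w - g z) < d)); auto.
Qed.

(* Caratheodory's form of complex differentiability. *)
Definition Cdiff (f : C -> C) (z l : C) : Prop :=
  exists phi, Ccont phi z /\ phi z = l /\
    Cnear z (fun w => f w = f z + phi w * (w - z))%C.

Lemma Cdiff_cont f z l : Cdiff f z l -> Ccont f z.
Proof.
intros [phi [Hc [_ Hn]]].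
apply (Ccont_ext_near (fun w => f z + phi w * (w + - z))%C).
- revert Hn; apply Cnear_mono; intros w Hw; symmetry; exact Hw.
- apply Ccont_plus; [apply Ccont_const|].
  apply Ccont_mult; auto.
  apply Ccont_plus; [apply Ccont_id|apply Ccont_const].
Qed.

Lemma Cdiff_const c z : Cdiff (fun _ => c) z 0.
Proof.
exists (fun _ => 0%C); split; [apply Ccont_const|split; auto].
exists 1; split; [lra|]; intros; ring.
Qed.

Lemma Cdiff_id z : Cdiff (fun w => w) z 1.
Proof.
exists (fun _ => 1%C); split; [apply Ccont_const|split; auto].
exists 1; split; [lra|]; intros; ring.
Qed.

Lemma Cdiff_plus f g z l m :
  Cdiff f z l -> Cdiff g z m -> Cdiff (fun w => f w + g w)%C z (l + m).
Proof.
intros [p [Hp [Hp1 Hp2]]] [q [Hq [Hq1 Hq2]]].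
exists (fun w => p w + q w)%C; split; [now apply Ccont_plus|split].
- now rewrite Hp1, Hq1.
- generalize (Cnear_and _ _ _ Hp2 Hq2); apply Cnear_mono.
  intros w [-> ->]; ring.
Qed.

Lemma Cdiff_mult f g z l m :
  Cdiff f z l -> Cdiff g z m -> Cdiff (fun w => f w * g w)%C z (l * g z + f z * m).
Proof.
intros Hf Hg; pose proof (Cdiff_cont _ _ _ Hg) as Hgc.
destruct Hf as [p [Hp [Hp1 Hp2]]]; destruct Hg as [q [Hq [Hq1 Hq2]]].
exists (fun w => p w * g w + f z * q w)%C; split; [|split].
- apply Ccont_plus; apply Ccont_mult; auto using Ccont_const.
- now rewrite Hp1, Hq1.
- generalize (Cnear_and _ _ _ Hp2 Hq2); apply Cnear_mono.
  intros w [-> Hw]; rewrite Hw; ring.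
Qed.

Lemma Cdiff_ext_near f g z l :
  Cnear z (fun w => f w = g w) -> Cdiff f z l -> Cdiff g z l.
Proof.
intros H [p [Hp [Hp1 Hp2]]]; exists p; split; [auto|split; [auto|]].
pose proof (Cnear_self _ _ H) as Hz; simpl in Hz.
generalize (Cnear_and _ _ _ H Hp2); apply Cnear_mono.
intros w [H1 H2]; now rewrite <- H1, <- Hz.
Qed.

Lemma Cdiff_ext f g z l : (forall w, f w = g w) -> Cdiff f z l -> Cdiff g z l.
Proof. intros H; apply Cdiff_ext_near; exists 1; split; [lra|auto]. Qed.

Lemma Cdiff_scal c f z l : Cdiff f z l -> Cdiff (fun w => c * f w)%C z (c * l).
Proof.
intros H; replace (c * l)%C with (0 * f z + c * l)%C by ring.
apply (Cdiff_mult (fun _ => c)); auto using Cdiff_const.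
Qed.

Lemma Cdiff_inv (f : C -> C) z l :
  Cdiff f z l -> f z <> 0 -> Cdiff (fun w => / f w)%C z (- l / (f z * f z)).
Proof.
intros Hf Hz; pose proof (Cdiff_cont _ _ _ Hf) as Hfc.
destruct Hf as [p [Hp [Hp1 Hp2]]].
exists (fun w => ((-1) * p w) * / (f w * f z))%C; split; [|split].
- apply Ccont_mult.
  + apply Ccont_mult; auto using Ccont_const.
  + apply Ccont_inv; [apply Ccont_mult; auto using Ccont_const|now apply Cmult_neq_0].
- rewrite Hp1; field; auto.
- generalize (Cnear_and _ _ _ Hp2 (Ccont_neq_0 _ _ Hfc Hz)); apply Cnear_mono.
  intros w [Hw Hw0].
  replace ((-1) * p w * / (f w * f z) * (w - z))%C
    with ((-1) * (p w * (w - z)) * / (f w * f z))%C by (field; auto).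
  replace (p w * (w - z))%C with (f w - f z)%C by (rewrite Hw; ring).
  field; auto.
Qed.

Lemma Cdiff_comp f g z l m :
  Cdiff g z m -> Cdiff f (g z) l -> Cdiff (fun w => f (g w)) z (l * m).
Proof.
intros Hg Hf; pose proof (Cdiff_cont _ _ _ Hg) as Hgc.
destruct Hf as [p [Hp [Hp1 Hp2]]]; destruct Hg as [q [Hq [Hq1 Hq2]]].
exists (fun w => p (g w) * q w)%C; split; [|split].
- apply Ccont_mult; auto; now apply Ccont_comp.
- now rewrite Hp1, Hq1.
- generalize (Cnear_and _ _ _ Hq2 (Cnear_comp _ _ _ Hgc Hp2)); apply Cnear_mono.
  intros w [Hw Hw2]; simpl in *; rewrite Hw2.
  replace (g w - g z)%C with (q w * (w - z))%C by (rewrite Hw; ring). ring.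
Qed.

(** The slope is the difference quotient, completed by [l] at [z]; this serves functions known only
    through first-order estimates. *)
Lemma Cdiff_of_eps f z l :
  (forall eps, 0 < eps ->
    Cnear z (fun w => Cmod (f w - f z - l * (w - z)) <= eps * Cmod (w - z))) ->
  Cdiff f z l.
Proof.
intros H.
exists (fun w => if Ceq_dec w z then l else (f w - f z) / (w - z))%C.
split; [|split].
- intros eps He.
  assert (He2 : 0 < eps / 2) by lra.
  generalize (H _ He2); apply Cnear_mono; intros w Hw.
  destruct (Ceq_dec z z) as [_|n]; [|now elim n].
  destruct (Ceq_dec w z) as [->|Hn]; [now rewrite Cmod_minus_diag|].
  assert (Hn' : (w - z)%C <> 0) by now apply Cminus_eq_contra.
  replace ((f w - f z) / (w - z) - l)%C
    with ((f w - f z - l * (w - z)) / (w - z))%C by (field; auto).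
  rewrite Cmod_div by auto.
  assert (0 < Cmod (w - z)) by now apply Cmod_gt_0.
  apply Rle_lt_trans with (eps / 2); [|lra].
  now apply Rle_div_l.
- destruct (Ceq_dec z z) as [_|n]; [auto|now elim n].
- exists 1; split; [lra|]; intros w _.
  destruct (Ceq_dec w z) as [->|Hn]; [ring|].
  field; now apply Cminus_eq_contra.
Qed.

(** Converts the analyticity hypothesis on [f]. The neighbourhoods of [C_AbsRing] are discs for
    [Cmod], so radii carry over unchanged. *)
Lemma Cdiff_of_is_derive f z l :
  @is_derive C_AbsRing C_NormedModule f z l -> Cdiff f z l.
Proof.
intros [_ Hd].
apply Cdiff_of_eps; intros eps He.
assert (Hz : is_filter_lim (locally (T := AbsRing_UniformSpace C_AbsRing) z) z) by now intros P HP.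
specialize (Hd z Hz (mkposreal eps He)).
destruct Hd as [d Hd].
exists d; split; [apply cond_pos|].
intros w Hw.
specialize (Hd w Hw).
change (Cmod ((f w + - f z) + - ((w + - z) * l))%C <= eps * Cmod (w + - z)%C) in Hd.
replace (f w - f z - l * (w - z))%C with (f w + - f z + - ((w + - z) * l))%C by ring.
exact Hd.
Qed.

(** * The complex exponential *)

Lemma Cexp_plus z w : Cexp (z + w) = (Cexp z * Cexp w)%C.
Proof.
destruct z as [a b], w as [c e]; unfold Cexp, Cmult, Re, Im; simpl.
rewrite exp_plus, cos_plus, sin_plus; f_equal; ring.
Qed.

Lemma Cmod_Cexp z : Cmod (Cexp z) = exp (Re z).
Proof.
unfold Cmod, Cexp; simpl.
match goal with |- sqrt ?x = _ => replace x with ((exp (Re z))²) end.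
- apply sqrt_Rsqr, Rlt_le, exp_pos.
- pose proof (sin2_cos2 (Im z)) as H; unfold Rsqr in *.
  replace (exp (Re z) * exp (Re z)) with
    (exp (Re z) * exp (Re z) * (sin (Im z) * sin (Im z) + cos (Im z) * cos (Im z)))
    by (rewrite H; ring). ring.
Qed.

Lemma Cexp_neq_0 z : Cexp z <> 0.
Proof. apply Cmod_gt_0; rewrite Cmod_Cexp; apply exp_pos. Qed.

Lemma Cexp_0 : Cexp 0 = 1.
Proof. unfold Cexp; simpl; rewrite exp_0, cos_0, sin_0; unfold RtoC; f_equal; ring. Qed.

Lemma Cexp_opp z : (Cexp (- z) = / Cexp z)%C.
Proof.
assert (H : (Cexp (- z) * Cexp z = 1)%C).
{ rewrite <- Cexp_plus; replace (- z + z)%C with (RtoC 0) by ring; apply Cexp_0. }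
replace (Cexp (-z)) with (Cexp (- z) * Cexp z * / Cexp z)%C
  by (field; apply Cexp_neq_0).
rewrite H; ring.
Qed.

Lemma Rabs_Re_le z : Rabs (Re z) <= Cmod z.
Proof. eapply Rle_trans; [apply Rmax_l|apply Rmax_Cmod]. Qed.

Lemma Rabs_Im_le z : Rabs (Im z) <= Cmod z.
Proof. eapply Rle_trans; [apply Rmax_r|apply Rmax_Cmod]. Qed.

Lemma Cmod_le_Rabs_plus z : Cmod z <= Rabs (Re z) + Rabs (Im z).
Proof.
destruct z as [a b]; simpl.
replace (a, b) with (RtoC a + Ci * RtoC b)%C
  by (unfold RtoC, Ci, Cplus, Cmult; simpl; f_equal; ring).
eapply Rle_trans; [apply Cmod_triangle|].
rewrite Cmod_mult, Cmod_Ci, !Cmod_R; simpl; lra.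
Qed.

Lemma linear_approx_0 f l eps :
  derivable_pt_lim f 0 l -> 0 < eps ->
  exists d, 0 < d /\ forall x, Rabs x < d -> Rabs (f x - f 0 - l * x) <= eps * Rabs x.
Proof.
intros Hf He; destruct (Hf eps He) as [d Hd].
exists d; split; [apply cond_pos|]; intros x Hx.
destruct (Req_dec x 0) as [->|Hn].
- replace (f 0 - f 0 - l * 0) with 0 by ring; rewrite Rabs_R0; lra.
- specialize (Hd x Hn Hx); rewrite Rplus_0_l in Hd.
  replace (f x - f 0 - l * x) with (((f x - f 0) / x - l) * x) by (field; auto).
  rewrite Rabs_mult; apply Rmult_le_compat_r; [apply Rabs_pos|lra].
Qed.

Lemma Cdiff_Cexp_0 : Cdiff Cexp 0 1.
Proof.
apply Cdiff_of_eps; intros eps He.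
(* The real part will cost 4 e |w| and the imaginary part 5 e |w|. *)
set (e := eps / 10).
assert (He' : 0 < e) by (unfold e; lra).
destruct (linear_approx_0 exp 1 e) as [d1 [Hd1 H1]]; auto.
{ generalize (derivable_pt_lim_exp 0); now rewrite exp_0. }
destruct (linear_approx_0 sin 1 e) as [d2 [Hd2 H2]]; auto.
{ generalize (derivable_pt_lim_sin 0); now rewrite cos_0. }
destruct (linear_approx_0 cos 0 e) as [d3 [Hd3 H3]]; auto.
{ generalize (derivable_pt_lim_cos 0); now rewrite sin_0, Ropp_0. }
(* Tolerance 1 gives |exp a - 1| <= 2 |a|, hence both exp a <= 3 and, since d <= e, |exp a - 1| <= 2
   e. *)
destruct (linear_approx_0 exp 1 1) as [d4 [Hd4 H4]]; auto; [|lra|].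
{ generalize (derivable_pt_lim_exp 0); now rewrite exp_0. }
set (d := Rmin (Rmin (Rmin d1 d2) (Rmin d3 d4)) (Rmin 1 e)).
exists d; split; [unfold d; repeat apply Rmin_pos; lra|].
intros w; replace (w - 0)%C with w by ring.
rewrite Cexp_0; intros Hw.
assert (Hds : d <= d1 /\ d <= d2 /\ d <= d3 /\ d <= d4 /\ d <= 1 /\ d <= e).
{ unfold d, Rmin; repeat destruct Rle_dec; lra. }
pose proof (Rabs_Re_le w) as Ha; pose proof (Rabs_Im_le w) as Hb.
destruct w as [a b]; simpl in Ha, Hb.
rewrite exp_0 in *; rewrite sin_0 in *; rewrite cos_0 in *.
set (m := Cmod (a, b)) in *.
specialize (H1 a ltac:(lra)); specialize (H4 a ltac:(lra)).
specialize (H2 b ltac:(lra)); specialize (H3 b ltac:(lra)).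
eapply Rle_trans; [apply Cmod_le_Rabs_plus|].
unfold Cexp; simpl.
set (A := exp a) in *; set (S := sin b) in *; set (Cc := cos b) in *.
assert (HA : A <= 3).
{ pose proof (Rle_abs (A - 1 - 1 * a)); pose proof (Rle_abs a); nra. }
assert (HA0 : 0 < A) by apply exp_pos.
assert (HA1 : Rabs (A - 1) <= 2 * e).
{ replace (A - 1) with ((A - 1 - 1 * a) + a) by ring.
  eapply Rle_trans; [apply Rabs_triang|].
  pose proof (Rabs_pos a); nra. }
(* Regrouped so that each summand contains the error of a first-order expansion at 0 or a product of
   two small factors. *)
replace (A * Cc + - (1) + - (1 * a - 0 * b)) with (A * (Cc - 1 - 0 * b) + (A - 1 - 1 * a)) by ring.
replace (A * S + - 0 + - (1 * b + 0 * a)) with (A * (S - 0 - 1 * b) + (A - 1) * b) by ring.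
assert (E1 : Rabs (A * (Cc - 1 - 0 * b) + (A - 1 - 1 * a)) <= 4 * e * m).
{ eapply Rle_trans; [apply Rabs_triang|]. rewrite Rabs_mult, (Rabs_pos_eq A) by lra.
  pose proof (Rabs_pos (Cc - 1 - 0 * b)); pose proof (Rabs_pos a); pose proof (Rabs_pos b).
  assert (A * Rabs (Cc - 1 - 0 * b) <= 3 * (e * m)).
  { apply Rmult_le_compat; try lra; nra. }
  nra. }
assert (E2 : Rabs (A * (S - 0 - 1 * b) + (A - 1) * b) <= 5 * e * m).
{ eapply Rle_trans; [apply Rabs_triang|]. rewrite !Rabs_mult, (Rabs_pos_eq A) by lra.
  pose proof (Rabs_pos (S - 0 - 1 * b)); pose proof (Rabs_pos a); pose proof (Rabs_pos b).
  assert (A * Rabs (S - 0 - 1 * b) <= 3 * (e * m)).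
  { apply Rmult_le_compat; try lra; nra. }
  assert (Rabs (A - 1) * Rabs b <= 2 * e * m).
  { apply Rmult_le_compat; try lra; apply Rabs_pos. }
  nra. }
replace (eps * m) with (10 * e * m) by (unfold e; field).
assert (0 <= m) by apply Cmod_ge_0.
nra.
Qed.

Lemma Cdiff_Cexp z : Cdiff Cexp z (Cexp z).
Proof.
destruct Cdiff_Cexp_0 as [p [Hp [Hp1 [d [Hd Hn]]]]].
exists (fun w => Cexp z * p (w + - z))%C; split; [|split].
- apply Ccont_mult; [apply Ccont_const|].
  apply (Ccont_comp p (fun w => w + - z)%C).
  + apply Ccont_plus; [apply Ccont_id|apply Ccont_const].
  + replace (z + - z)%C with (RtoC 0) by ring; exact Hp.
- replace (z + - z)%C with (RtoC 0) by ring; rewrite Hp1; ring.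
- exists d; split; auto; intros w Hw.
  specialize (Hn (w - z)%C).
  replace (w - z - 0)%C with (w - z)%C in Hn by ring.
  specialize (Hn Hw).
  replace w with (z + (w - z))%C at 1 by ring.
  rewrite Cexp_plus, Hn, Cexp_0; unfold Cminus; ring.
Qed.

(** * Logarithm and square root on the slit plane *)

(** The domain on which the principal branch is holomorphic: the plane cut along (-oo, 0]. *)
Definition slit (z : C) : Prop := 0 < Re z \/ Im z <> 0.

Lemma Cmod_sqr z : Cmod z * Cmod z = Re z * Re z + Im z * Im z.
Proof.
unfold Cmod; rewrite sqrt_sqrt; [unfold Re, Im; ring|].
unfold Re, Im; nra.
Qed.

Lemma slit_pos z : slit z -> 0 < Re z + Cmod z.
Proof.
intros H; pose proof (Cmod_sqr z); pose proof (Cmod_ge_0 z).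
destruct H as [H|H]; [lra|].
assert (0 < Im z * Im z) by (destruct (Rdichotomy _ _ H); nra).
nra.
Qed.

Lemma slit_neq_0 (z : C) : slit z -> z <> 0.
Proof. intros H H0; rewrite H0 in H; destruct H; simpl in *; lra. Qed.

Lemma Re_div_Cmod_bound (z : C) : z <> 0 -> -1 <= Re z / Cmod z <= 1.
Proof.
intros H; assert (Hm : 0 < Cmod z) by now apply Cmod_gt_0.
pose proof (Rabs_Re_le z) as Ha.
pose proof (Rle_abs (Re z)); pose proof (Rle_abs (- Re z)).
rewrite Rabs_Ropp in *.
split; [apply -> (Rle_div_r (-1) (Re z) (Cmod z))|apply Rle_div_l]; lra.
Qed.

Lemma Cexp_Clog (z : C) : z <> 0 -> Cexp (Clog z) = z.
Proof.
intros H; assert (Hm : 0 < Cmod z) by now apply Cmod_gt_0.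
pose proof (Re_div_Cmod_bound z H) as Hb.
pose proof (Cmod_sqr z) as Hs.
assert (Hsq : 1 - (Re z / Cmod z)² = (Im z / Cmod z)²).
{ unfold Rsqr.
  replace (1 - Re z / Cmod z * (Re z / Cmod z))
    with ((Cmod z * Cmod z - Re z * Re z) / (Cmod z * Cmod z)) by (field; lra).
  rewrite Hs at 1; field; lra. }
unfold Cexp, Clog; simpl; rewrite exp_ln by auto.
unfold Carg; destruct (Rle_dec 0 (Im z)) as [Hi|Hi].
- rewrite cos_acos, sin_acos, Hsq by lra.
  rewrite sqrt_Rsqr.
  + transitivity (Re z, Im z); [f_equal; field; lra|now destruct z].
  + apply Rmult_le_pos; [lra|]; apply Rlt_le, Rinv_0_lt_compat; lra.
- rewrite cos_neg, sin_neg, cos_acos, sin_acos, Hsq by lra.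
  rewrite Rsqr_neg, sqrt_Rsqr.
  + transitivity (Re z, Im z); [f_equal; field; lra|now destruct z].
  + unfold Rdiv; rewrite Ropp_mult_distr_l; apply Rmult_le_pos; [lra|].
    apply Rlt_le, Rinv_0_lt_compat; lra.
Qed.

Lemma cos_2_atan q : cos (2 * atan q) = (1 - q * q) / (1 + q * q).
Proof.
rewrite cos_2a_cos, cos_atan.
assert (0 < 1 + q * q) by nra.
assert (H1 : sqrt (1 + q²) * sqrt (1 + q²) = 1 + q * q).
{ unfold Rsqr; apply sqrt_sqrt; lra. }
assert (0 < sqrt (1 + q²)) by (apply sqrt_lt_R0; unfold Rsqr; lra).
replace (2 * (1 / sqrt (1 + q²)) * (1 / sqrt (1 + q²)) - 1)
  with (2 / (sqrt (1 + q²) * sqrt (1 + q²)) - 1) by (field; lra).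
rewrite H1; field; lra.
Qed.

(** The half-angle formula tan(theta / 2) = y / (x + |z|). One expression covers both [acos]
    branches of [Carg], which makes continuity across the positive real axis evident. *)
Lemma Carg_slit z : slit z -> Carg z = 2 * atan (Im z / (Re z + Cmod z)).
Proof.
intros H; pose proof (slit_pos z H) as Hp.
assert (Hm : 0 < Cmod z) by (apply Cmod_gt_0; now apply slit_neq_0).
set (q := Im z / (Re z + Cmod z)).
assert (Hq : (1 - q * q) / (1 + q * q) = Re z / Cmod z).
{ pose proof (Cmod_sqr z) as Hs.
  assert (Hqq : q * q = (Cmod z - Re z) / (Re z + Cmod z)).
  { unfold q.
    replace (Im z / (Re z + Cmod z) * (Im z / (Re z + Cmod z)))
      with (Im z * Im z / ((Re z + Cmod z) * (Re z + Cmod z))) by (field; lra).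
    replace (Im z * Im z) with ((Cmod z - Re z) * (Re z + Cmod z)) by lra.
    field; lra. }
  rewrite Hqq; field; lra. }
pose proof (atan_bound q) as Hb.
unfold Carg; destruct (Rle_dec 0 (Im z)) as [Hi|Hi].
- rewrite <- Hq, <- cos_2_atan; apply acos_cos.
  assert (0 <= q) by (apply Rmult_le_pos; [auto|apply Rlt_le, Rinv_0_lt_compat; lra]).
  assert (0 <= atan q).
  { destruct (Req_dec q 0) as [->|]; [rewrite atan_0; lra|].
    rewrite <- atan_0; apply Rlt_le, atan_increasing; lra. }
  lra.
- rewrite <- Hq, <- cos_2_atan, <- cos_neg.
  assert (Hq0 : q < 0).
  { unfold q, Rdiv; assert (0 < / (Re z + Cmod z)) by (apply Rinv_0_lt_compat; lra); nra. }
  assert (atan q < 0) by (rewrite <- atan_0; now apply atan_increasing).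
  rewrite acos_cos by lra; ring.
Qed.

Lemma Carg_slit_bound z : slit z -> - PI < Carg z < PI.
Proof.
intros H; rewrite Carg_slit by auto.
pose proof (atan_bound (Im z / (Re z + Cmod z))); lra.
Qed.

(** In the right half-plane the half-angle tangent has modulus below 1. *)
Lemma Carg_right_bound z : 0 < Re z -> - (PI / 2) < Carg z < PI / 2.
Proof.
intros H.
assert (Hz : slit z) by now left.
pose proof (slit_pos z Hz) as Hp.
rewrite Carg_slit by auto.
assert (Hq : Rabs (Im z / (Re z + Cmod z)) < 1).
{ unfold Rdiv; rewrite Rabs_mult, (Rabs_pos_eq (/ _)).
  - apply Rlt_div_l; [auto|]. pose proof (Rabs_Im_le z); lra.
  - apply Rlt_le, Rinv_0_lt_compat; lra. }
apply Rabs_def2 in Hq.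
pose proof (atan_increasing _ _ (proj1 Hq)) as H1.
pose proof (atan_increasing _ _ (proj2 Hq)) as H2.
rewrite atan_opp, atan_1 in H2; rewrite atan_1 in H1; lra.
Qed.

(** The two norms on C differ by at most the factor [sqrt 2]; bounding it by 2 lets halved radii
    absorb it. *)
Lemma sqrt_2_le_2 : sqrt 2 <= 2.
Proof. rewrite <- (sqrt_Rsqr 2) at 2 by lra; apply sqrt_le_1; unfold Rsqr; lra. Qed.

(* Coquelicot's uniform structure on C is the product one (sup norm), not the one of [Cmod]. *)
Lemma Ccont_iff_continuous f z :
  Ccont f z <-> @continuous C_UniformSpace C_UniformSpace f z.
Proof.
split.
- intros H; apply (proj2 (filterlim_locally f (f z))); intros eps.
  destruct (H eps (cond_pos eps)) as [d [Hd Hn]].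
  assert (Hd2 : 0 < d / 2) by lra.
  exists (mkposreal _ Hd2); intros w Hw.
  apply C_NormedModule_mixin_compat1, Hn.
  pose proof (C_NormedModule_mixin_compat2 z w (mkposreal _ Hd2) Hw) as Hw'.
  change (Cmod (w - z) < sqrt 2 * (d / 2)) in Hw'.
  pose proof sqrt_2_le_2.
  nra.
- intros H eps He.
  assert (He2 : 0 < eps / 2) by lra.
  destruct (proj1 (filterlim_locally f (f z)) H (mkposreal _ He2)) as [d Hd].
  exists d; split; [apply cond_pos|]; intros w Hw.
  pose proof (C_NormedModule_mixin_compat2 _ _ (mkposreal _ He2)
    (Hd w (C_NormedModule_mixin_compat1 z w d Hw))) as Hw'.
  change (Cmod (f w - f z) < sqrt 2 * (eps / 2)) in Hw'.
  pose proof sqrt_2_le_2.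
  nra.
Qed.

Lemma continuous_Re z : @continuous C_UniformSpace R_UniformSpace Re z.
Proof. apply continuous_fst. Qed.

Lemma continuous_Im z : @continuous C_UniformSpace R_UniformSpace Im z.
Proof. apply continuous_snd. Qed.

Lemma Rabs_Cmod_minus_le z w : Rabs (Cmod w - Cmod z) <= Cmod (w - z).
Proof.
pose proof (Cmod_triangle (w - z) z) as T1.
pose proof (Cmod_triangle (z - w) w) as T2.
replace (w - z + z)%C with w in T1 by ring.
replace (z - w + w)%C with z in T2 by ring.
rewrite (Cmod_minus_sym z w) in T2.
apply Rabs_le; lra.
Qed.

Lemma continuous_Cmod z : @continuous C_UniformSpace R_UniformSpace Cmod z.
Proof.
apply (proj2 (filterlim_locally Cmod (Cmod z))); intros eps.
assert (He2 : 0 < eps / 2) by (destruct eps; simpl; lra).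
exists (mkposreal _ He2); intros w Hw.
pose proof (C_NormedModule_mixin_compat2 z w (mkposreal _ He2) Hw) as Hw'.
change (Cmod (w - z) < sqrt 2 * (eps / 2)) in Hw'.
change (Rabs (Cmod w - Cmod z) < eps).
pose proof (Rabs_Cmod_minus_le z w); pose proof sqrt_2_le_2.
destruct eps as [eps He]; simpl in *; nra.
Qed.

Lemma continuous_pair (u v : C -> R) z :
  @continuous C_UniformSpace R_UniformSpace u z ->
  @continuous C_UniformSpace R_UniformSpace v z ->
  @continuous C_UniformSpace C_UniformSpace (fun w => (u w, v w)) z.
Proof.
intros Hu Hv.
apply (proj2 (filterlim_locally (U := C_UniformSpace) _ _)); intros eps.
generalize (filter_and _ _ (proj1 (filterlim_locally u (u z)) Hu eps)
                      (proj1 (filterlim_locally v (v z)) Hv eps)).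
apply filter_imp; intros w [H1 H2]; now split.
Qed.

Lemma slit_near z : slit z -> Cnear z slit.
Proof.
intros [H|H].
- exists (Re z); split; auto; intros w Hw; left.
  pose proof (Rabs_Re_le (w - z)) as Hr.
  change (Re (w - z)) with (Re w - Re z) in Hr.
  pose proof (Rle_abs (-(Re w - Re z))); rewrite Rabs_Ropp in *; lra.
- exists (Rabs (Im z)); split; [now apply Rabs_pos_lt|]; intros w Hw; right.
  intros H0.
  pose proof (Rabs_Im_le (w - z)) as Hr.
  change (Im (w - z)) with (Im w - Im z) in Hr.
  rewrite H0 in Hr; replace (0 - Im z) with (- Im z) in Hr by ring.
  rewrite Rabs_Ropp in Hr; lra.
Qed.

Lemma Ccont_Clog z : slit z -> Ccont Clog z.
Proof.
intros H; pose proof (slit_pos z H) as Hp.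
assert (Hm : 0 < Cmod z) by (apply Cmod_gt_0; now apply slit_neq_0).
apply (Ccont_ext_near (fun w => (ln (Cmod w), 2 * atan (Im w / (Re w + Cmod w))))).
- generalize (slit_near z H); apply Cnear_mono; intros w Hw.
  unfold Clog; now rewrite Carg_slit.
- apply Ccont_iff_continuous, continuous_pair.
  + apply (continuous_comp (V := R_UniformSpace) Cmod ln); [apply continuous_Cmod|].
    now apply continuous_ln.
  + apply (continuous_mult (K := R_AbsRing) (fun _ => 2)); [apply continuous_const|].
    apply (continuous_comp (V := R_UniformSpace) _ atan).
    2: apply continuity_pt_filterlim, derivable_continuous_pt, derivable_pt_atan.
    apply (continuous_mult (K := R_AbsRing)); [apply continuous_Im|].
    apply (continuous_comp (V := R_UniformSpace) _ Rinv).
    * apply (continuous_plus (V := R_NormedModule)); [apply continuous_Re|apply continuous_Cmod].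
    * apply continuous_Rinv; lra.
Qed.

(** Inverse function rule in Caratheodory's form: a slope of [Cexp] at [Clog z], composed with
    [Clog] and inverted, is a slope of [Clog]. Only continuity of [Clog] must be known
    beforehand. *)
Lemma Cdiff_Clog z : slit z -> Cdiff Clog z (/ z).
Proof.
intros H; pose proof (Ccont_Clog z H) as Hc.
pose proof (slit_neq_0 z H) as Hz.
destruct (Cdiff_Cexp (Clog z)) as [p [Hp [Hp1 Hp2]]].
rewrite Cexp_Clog in Hp1 by auto.
assert (Hpc : Ccont (fun w => p (Clog w)) z) by now apply Ccont_comp.
assert (Hp0 : p (Clog z) <> 0) by now rewrite Hp1.
exists (fun w => / p (Clog w))%C; split; [|split].
- now apply (Ccont_inv (fun w => p (Clog w))).
- now rewrite Hp1.
- generalize (Cnear_and _ _ _ (slit_near z H) (Cnear_and _ _ _ (Cnear_comp _ _ _ Hc Hp2)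
     (Ccont_neq_0 (fun w => p (Clog w)) z Hpc Hp0))); apply Cnear_mono.
  intros w [Hw [H1 H2]].
  rewrite !Cexp_Clog in H1 by (auto; now apply slit_neq_0).
  assert (E : (w - z = p (Clog w) * (Clog w - Clog z))%C) by (rewrite H1 at 1; ring).
  rewrite E; field; auto.
Qed.

Lemma Csqrt_neq_0_def (z : C) : z <> 0 -> Csqrt z = Cexp (RtoC (1 / 2) * Clog z)%C.
Proof. intros H; unfold Csqrt, Cpowr; destruct (Ceq_dec z 0); tauto. Qed.

Lemma Csqrt_sqr (z : C) : z <> 0 -> (Csqrt z * Csqrt z)%C = z.
Proof.
intros H; rewrite Csqrt_neq_0_def by auto; rewrite <- Cexp_plus.
rewrite <- (Cexp_Clog z) at 3 by auto; f_equal.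
replace (RtoC (1/2)) with (/ 2)%C by (rewrite <- RtoC_inv by lra; f_equal; lra).
field.
Qed.

(** Halving an argument in (-PI, PI) moves it to (-PI/2, PI/2), where the cosine is positive. *)
Lemma Re_Csqrt_pos z : slit z -> 0 < Re (Csqrt z).
Proof.
intros H; rewrite Csqrt_neq_0_def by now apply slit_neq_0.
pose proof (Carg_slit_bound z H).
unfold Cexp; simpl; apply Rmult_lt_0_compat; [apply exp_pos|].
apply cos_gt_0; lra.
Qed.

Lemma Cdiff_Csqrt z : slit z -> exists l, Cdiff Csqrt z l.
Proof.
intros H.
eexists; apply (Cdiff_ext_near (fun w => Cexp (RtoC (1/2) * Clog w)%C)).
- generalize (slit_near z H); apply Cnear_mono; intros w Hw.
  now rewrite Csqrt_neq_0_def by now apply slit_neq_0.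
- apply (Cdiff_comp Cexp (fun w => RtoC (1/2) * Clog w)%C); [|apply Cdiff_Cexp].
  now apply Cdiff_scal, Cdiff_Clog.
Qed.

(** * The complex sine *)

Definition Csin (z : C) : C := ((Cexp (Ci * z) - Cexp (- (Ci * z))) / (2 * Ci))%C.
Definition Ccos (z : C) : C := ((Cexp (Ci * z) + Cexp (- (Ci * z))) / 2)%C.

Lemma Cdiff_Csin z : Cdiff Csin z (Ccos z).
Proof.
pose proof (Cdiff_scal Ci _ z _ (Cdiff_id z)) as H1.
pose proof (Cdiff_scal (-1) _ z _ H1) as H2.
pose proof (Cdiff_comp Cexp _ z _ _ H1 (Cdiff_Cexp _)) as E1.
pose proof (Cdiff_comp Cexp _ z _ _ H2 (Cdiff_Cexp _)) as E2.
pose proof (Cdiff_scal (-1) _ z _ E2) as E3.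
pose proof (Cdiff_scal (/ (2 * Ci)) _ z _ (Cdiff_plus _ _ z _ _ E1 E3)) as H; simpl in H.
replace (Ccos z) with (/ (2 * Ci) * (Cexp (Ci * z) * (Ci * 1) + -1 *
  (Cexp (-1 * (Ci * z)) * (-1 * (Ci * 1)))))%C.
- revert H; apply Cdiff_ext; intros w; unfold Csin.
  replace (-1 * (Ci * w))%C with (- (Ci * w))%C by ring.
  field; apply Ci_nz.
- unfold Ccos; replace (-1 * (Ci * z))%C with (- (Ci * z))%C by ring.
  field; apply Ci_nz.
Qed.

Lemma Csin_RtoC x : Csin (RtoC x) = RtoC (sin x).
Proof.
unfold Csin.
replace (Cexp (Ci * x) - Cexp (- (Ci * x)))%C with (2 * Ci * RtoC (sin x))%C.
- field; apply Ci_nz.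
- unfold Cexp, Cminus, Cplus, Copp, Cmult, Ci, RtoC; simpl.
  replace (- (0 * x - 1 * 0)) with 0 by ring; replace (0 * x - 1 * 0) with 0 by ring.
  replace (- (0 * 0 + 1 * x)) with (- x) by ring; replace (0 * 0 + 1 * x) with x by ring.
  rewrite exp_0, cos_neg, sin_neg; f_equal; ring.
Qed.

Lemma Ccos_RtoC x : Ccos (RtoC x) = RtoC (cos x).
Proof.
unfold Ccos.
replace (Cexp (Ci * x) + Cexp (- (Ci * x)))%C with (2 * RtoC (cos x))%C.
- field.
- unfold Cexp, Cminus, Cplus, Copp, Cmult, Ci, RtoC; simpl.
  replace (- (0 * x - 1 * 0)) with 0 by ring; replace (0 * x - 1 * 0) with 0 by ring.
  replace (- (0 * 0 + 1 * x)) with (- x) by ring; replace (0 * 0 + 1 * x) with x by ring.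
  rewrite exp_0, cos_neg, sin_neg; f_equal; ring.
Qed.

Lemma Csin_pair a b : Csin (a, b) = ((sin a * cosh b)%R, (cos a * sinh b)%R).
Proof.
unfold Csin.
set (u := ((sin a * cosh b)%R, (cos a * sinh b)%R) : C).
replace (Cexp (Ci * (a, b)) - Cexp (- (Ci * (a, b))))%C with (2 * Ci * u)%C.
- field; apply Ci_nz.
- unfold u, Cexp, Cminus, Cplus, Copp, Cmult, Ci, RtoC, sinh, cosh; simpl.
  replace (- (0 * a - 1 * b)) with b by ring; replace (0 * a - 1 * b) with (- b) by ring.
  replace (- (0 * b + 1 * a)) with (- a) by ring; replace (0 * b + 1 * a) with a by ring.
  rewrite cos_neg, sin_neg; f_equal; field.
Qed.

(** This identity gives the zeros of the sine and both lower bounds on the contour: dropping one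
    square leaves |sinh b|, dropping the other |sin a|. *)
Lemma Cmod_sqr_Csin a b : Cmod (Csin (a, b)) * Cmod (Csin (a, b)) =
  sin a * sin a + sinh b * sinh b.
Proof.
rewrite Cmod_sqr, Csin_pair; simpl.
pose proof (sin2_cos2 a) as H1; unfold Rsqr in H1.
assert (H2 : cosh b * cosh b = 1 + sinh b * sinh b).
{ unfold cosh, sinh. pose proof (exp_plus b (- b)) as H.
  rewrite Rplus_opp_r, exp_0 in H; nra. }
replace (sin a * cosh b * (sin a * cosh b)) with (sin a * sin a * (cosh b * cosh b)) by ring.
rewrite H2.
replace (cos a * sinh b * (cos a * sinh b)) with (cos a * cos a * (sinh b * sinh b)) by ring.
replace (cos a * cos a) with (1 - sin a * sin a) by lra; ring.
Qed.

(** * Contour integrals along rectangles *)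

Definition in_rect (a b c d : R) (z : C) : Prop := a <= Re z <= b /\ c <= Im z <= d.

(** Continuity will be required here only, so that poles may lie inside. *)
Definition on_boundary (a b c d : R) (z : C) : Prop :=
  in_rect a b c d z /\ (Re z = a \/ Re z = b \/ Im z = c \/ Im z = d).

Definition hint (f : C -> C) (y a b : R) : C :=
  RInt (V := C_R_CompleteNormedModule) (fun t => f (t, y)) a b.

Definition vint (f : C -> C) (x c d : R) : C :=
  RInt (V := C_R_CompleteNormedModule) (fun t => f (x, t)) c d.

(** Counterclockwise, with dz = i dt on the vertical sides. *)
Definition oint (f : C -> C) (a b c d : R) : C :=
  (hint f c a b - hint f d a b + Ci * (vint f b c d - vint f a c d))%C.

Lemma ex_hint f y a b : a <= b ->
  (forall t, a <= t <= b -> Ccont f (t, y)) ->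
  ex_RInt (V := C_R_CompleteNormedModule) (fun t => f (t, y)) a b.
Proof.
intros Hab H; apply (ex_RInt_continuous (V := C_R_CompleteNormedModule)).
rewrite Rmin_left, Rmax_right by auto; intros t Ht.
apply (continuous_comp (U := R_UniformSpace) (V := C_UniformSpace) (W := C_UniformSpace)
  (fun t => (t, y) : C) f).
- apply (continuous_comp_2 (U := R_UniformSpace) (V := R_UniformSpace) (W := R_UniformSpace)
    (X := C_UniformSpace) (fun t => t) (fun _ => y) (fun u v => (u, v) : C)).
  + apply continuous_id.
  + apply continuous_const.
  + apply (continuous_ext (fun p : prod_UniformSpace R_UniformSpace R_UniformSpace => p : C_UniformSpace)).
    * now intros [u v].
    * apply (continuous_id (U := C_UniformSpace)).
- now apply Ccont_iff_continuous, H.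
Qed.

Lemma ex_vint f x c d : c <= d ->
  (forall t, c <= t <= d -> Ccont f (x, t)) ->
  ex_RInt (V := C_R_CompleteNormedModule) (fun t => f (x, t)) c d.
Proof.
intros Hcd H; apply (ex_RInt_continuous (V := C_R_CompleteNormedModule)).
rewrite Rmin_left, Rmax_right by auto; intros t Ht.
apply (continuous_comp (U := R_UniformSpace) (V := C_UniformSpace) (W := C_UniformSpace)
  (fun t => (x, t) : C) f).
- apply (continuous_comp_2 (U := R_UniformSpace) (V := R_UniformSpace) (W := R_UniformSpace)
    (X := C_UniformSpace) (fun _ => x) (fun t => t) (fun u v => (u, v) : C)).
  + apply continuous_const.
  + apply continuous_id.
  + apply (continuous_ext (fun p : prod_UniformSpace R_UniformSpace R_UniformSpace => p : C_UniformSpace)).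
    * now intros [u v].
    * apply (continuous_id (U := C_UniformSpace)).
- now apply Ccont_iff_continuous, H.
Qed.

Lemma hint_Chasles f y a m b : a <= m <= b ->
  (forall t, a <= t <= b -> Ccont f (t, y)) ->
  hint f y a b = (hint f y a m + hint f y m b)%C.
Proof.
intros Hm H; symmetry; unfold hint.
apply (RInt_Chasles (V := C_R_CompleteNormedModule)); apply ex_hint; try lra;
  intros; apply H; lra.
Qed.

Lemma vint_Chasles f x c m d : c <= m <= d ->
  (forall t, c <= t <= d -> Ccont f (x, t)) ->
  vint f x c d = (vint f x c m + vint f x m d)%C.
Proof.
intros Hm H; symmetry; unfold vint.
apply (RInt_Chasles (V := C_R_CompleteNormedModule)); apply ex_vint; try lra;
  intros; apply H; lra.
Qed.

(** The integral over the cut cancels as a formal term, whatever its value; continuity is used on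
    the two divided sides. *)
Lemma oint_split_h f a m b c d : a <= m <= b -> c <= d ->
  (forall z, on_boundary a b c d z -> Ccont f z) ->
  oint f a b c d = (oint f a m c d + oint f m b c d)%C.
Proof.
intros Hm Hcd H; unfold oint.
rewrite (hint_Chasles f c a m b), (hint_Chasles f d a m b); try tauto.
- ring.
- intros t Ht; apply H; split; [split; simpl; lra|simpl; lra].
- intros t Ht; apply H; split; [split; simpl; lra|simpl; lra].
Qed.

Lemma oint_split_v f a b c m d : a <= b -> c <= m <= d ->
  (forall z, on_boundary a b c d z -> Ccont f z) ->
  oint f a b c d = (oint f a b c m + oint f a b m d)%C.
Proof.
intros Hab Hm H; unfold oint.
rewrite (vint_Chasles f a c m d), (vint_Chasles f b c m d); try tauto.
- ring.
- intros t Ht; apply H; split; [split; simpl; lra|simpl; lra].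
- intros t Ht; apply H; split; [split; simpl; lra|simpl; lra].
Qed.

Lemma oint_plus f g a b c d : a <= b -> c <= d ->
  (forall z, on_boundary a b c d z -> Ccont f z) ->
  (forall z, on_boundary a b c d z -> Ccont g z) ->
  oint (fun z => f z + g z)%C a b c d = (oint f a b c d + oint g a b c d)%C.
Proof.
intros Hab Hcd Hf Hg; unfold oint.
assert (HH : forall y, y = c \/ y = d ->
  hint (fun z => f z + g z)%C y a b = (hint f y a b + hint g y a b)%C).
{ intros y Hy; unfold hint.
  apply (RInt_plus (V := C_R_CompleteNormedModule)); apply ex_hint; auto;
  intros t Ht; [apply Hf|apply Hg]; (split; [split; simpl; lra|simpl; lra]). }
assert (VV : forall x, x = a \/ x = b ->
  vint (fun z => f z + g z)%C x c d = (vint f x c d + vint g x c d)%C).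
{ intros y Hy; unfold vint.
  apply (RInt_plus (V := C_R_CompleteNormedModule)); apply ex_vint; auto;
  intros t Ht; [apply Hf|apply Hg]; (split; [split; simpl; lra|simpl; lra]). }
rewrite !HH, !VV by auto; ring.
Qed.

Lemma oint_ext f g a b c d : a <= b -> c <= d ->
  (forall z, on_boundary a b c d z -> f z = g z) ->
  oint f a b c d = oint g a b c d.
Proof.
intros Hab Hcd H; unfold oint.
assert (HH : forall y, y = c \/ y = d -> hint f y a b = hint g y a b).
{ intros y Hy; unfold hint; apply (RInt_ext (V := C_R_CompleteNormedModule)).
  rewrite Rmin_left, Rmax_right by auto; intros t Ht; apply H; split; [split; simpl; lra|simpl; lra]. }
assert (VV : forall x, x = a \/ x = b -> vint f x c d = vint g x c d).
{ intros x Hx; unfold vint; apply (RInt_ext (V := C_R_CompleteNormedModule)).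
  rewrite Rmin_left, Rmax_right by auto; intros t Ht; apply H; split; [split; simpl; lra|simpl; lra]. }
now rewrite !HH, !VV by auto.
Qed.

Lemma Cmod_hint_le_const f y a b M : a <= b ->
  (forall t, a <= t <= b -> Ccont f (t, y)) ->
  (forall t, a <= t <= b -> Cmod (f (t, y)) <= M) ->
  Cmod (hint f y a b) <= (b - a) * M.
Proof.
intros Hab Hc HM.
rewrite Cmod_norm.
apply (norm_RInt_le_const (V := C_R_NormedModule) (fun t => f (t, y)) a b); auto.
{ intros t Ht; change (norm (V := C_R_NormedModule) (f (t, y))) with
    (norm (V := prod_NormedModule R_AbsRing R_NormedModule R_NormedModule) (f (t, y)));
  rewrite <- Cmod_norm; auto. }
apply (RInt_correct (V := C_R_CompleteNormedModule)), ex_hint; auto.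
Qed.

Lemma Cmod_vint_le_const f x c d M : c <= d ->
  (forall t, c <= t <= d -> Ccont f (x, t)) ->
  (forall t, c <= t <= d -> Cmod (f (x, t)) <= M) ->
  Cmod (vint f x c d) <= (d - c) * M.
Proof.
intros Hab Hc HM.
rewrite Cmod_norm.
apply (norm_RInt_le_const (V := C_R_NormedModule) (fun t => f (x, t)) c d); auto.
{ intros t Ht; change (norm (V := C_R_NormedModule) (f (x, t))) with
    (norm (V := prod_NormedModule R_AbsRing R_NormedModule R_NormedModule) (f (x, t)));
  rewrite <- Cmod_norm; auto. }
apply (RInt_correct (V := C_R_CompleteNormedModule)), ex_vint; auto.
Qed.

Lemma Cmod_hint_le_RInt f y a b g : a <= b ->
  (forall t, a <= t <= b -> Ccont f (t, y)) ->
  (forall t, a <= t <= b -> Cmod (f (t, y)) <= g t) ->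
  ex_RInt g a b ->
  Cmod (hint f y a b) <= RInt g a b.
Proof.
intros Hab Hc HM Hg.
rewrite Cmod_norm.
apply (norm_RInt_le (V := C_R_NormedModule) (fun t => f (t, y)) g a b); auto.
- intros t Ht; change (norm (V := C_R_NormedModule) (f (t, y))) with
    (norm (V := prod_NormedModule R_AbsRing R_NormedModule R_NormedModule) (f (t, y)));
  rewrite <- Cmod_norm; auto.
- apply (RInt_correct (V := C_R_CompleteNormedModule)), ex_hint; auto.
- now apply (RInt_correct (V := R_CompleteNormedModule)).
Qed.

Lemma Cmod_oint_le_triangle f a b c d :
  Cmod (oint f a b c d) <=
  Cmod (hint f c a b) + Cmod (hint f d a b) + Cmod (vint f a c d) + Cmod (vint f b c d).
Proof.
unfold oint.
eapply Rle_trans; [apply Cmod_triangle|].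
rewrite Cmod_mult, Cmod_Ci.
pose proof (Cmod_triangle (hint f c a b) (- hint f d a b)) as H1.
pose proof (Cmod_triangle (vint f b c d) (- vint f a c d)) as H2.
rewrite Cmod_opp in H1, H2; unfold Cminus; lra.
Qed.

Lemma Cmod_oint_le f a b c d M : a <= b -> c <= d ->
  (forall z, on_boundary a b c d z -> Ccont f z) ->
  (forall z, on_boundary a b c d z -> Cmod (f z) <= M) ->
  Cmod (oint f a b c d) <= 2 * ((b - a) + (d - c)) * M.
Proof.
intros Hab Hcd Hc HM.
eapply Rle_trans; [apply Cmod_oint_le_triangle|].
assert (HH : forall y, y = c \/ y = d -> Cmod (hint f y a b) <= (b - a) * M).
{ intros y Hy; apply Cmod_hint_le_const; auto; intros t Ht; [apply Hc|apply HM];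
  (split; [split; simpl; lra|simpl; lra]). }
assert (VV : forall x, x = a \/ x = b -> Cmod (vint f x c d) <= (d - c) * M).
{ intros x Hx; apply Cmod_vint_le_const; auto; intros t Ht; [apply Hc|apply HM];
  (split; [split; simpl; lra|simpl; lra]). }
pose proof (HH c (or_introl eq_refl)). pose proof (HH d (or_intror eq_refl)).
pose proof (VV a (or_introl eq_refl)). pose proof (VV b (or_intror eq_refl)).
lra.
Qed.

Lemma is_RInt_affine (u v : C) (g : R -> C) a b :
  (forall t, g t = (u + RtoC t * v)%C) ->
  is_RInt (V := C_R_CompleteNormedModule) g a b
   (RtoC (b - a) * u + RtoC ((b * b - a * a) / 2) * v)%C.
Proof.
intros Hg.
apply (is_RInt_ext (fun t => u + RtoC t * v)%C); [intros; now rewrite Hg|].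
replace (RtoC (b - a) * u + RtoC ((b * b - a * a) / 2) * v)%C
  with (minus (G := C_R_CompleteNormedModule)
     (plus (scal b u) (scal (b * b / 2) v)) (plus (scal a u) (scal (a * a / 2) v))).
2: { rewrite !scal_R_Cmult.
  change (RtoC b * u + RtoC (b * b / 2) * v + - (RtoC a * u + RtoC (a * a / 2) * v) =
     RtoC (b - a) * u + RtoC ((b * b - a * a) / 2) * v)%C.
  unfold Rdiv; rewrite !RtoC_mult, !RtoC_minus, !RtoC_mult; ring. }
apply (is_RInt_derive (V := C_R_CompleteNormedModule)
  (fun t => plus (scal t u) (scal (t * t / 2) v))).
- intros t _.
  replace (u + RtoC t * v)%C with (plus (G := C_R_CompleteNormedModule) (scal 1 u) (scal t v)).
  2: { rewrite !scal_R_Cmult. change (1 * u + t * v = u + t * v)%C. ring. }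
  apply (is_derive_plus (V := C_R_NormedModule)).
  + apply (is_derive_scal_l (V := C_R_NormedModule) (fun t => t)). apply (is_derive_id (K := R_AbsRing)).
  + apply (is_derive_scal_l (V := C_R_NormedModule) (fun t => t * t / 2)).
    auto_derive; [auto|field].
- intros t _.
  apply (continuous_plus (V := C_R_NormedModule)); [apply continuous_const|].
  apply (continuous_ext (fun t => scal (V := C_R_NormedModule) t v)).
  + intros s; now rewrite scal_R_Cmult.
  + apply (continuous_scal_l (V := C_R_NormedModule) (fun t => t)); apply continuous_id.
Qed.

(** * Cauchy's theorem *)

(** In Goursat's argument this removes the first-order part of [f] at a point. *)
Lemma oint_affine (u v : C) a b c d : oint (fun z => u + v * z)%C a b c d = 0.
Proof.
assert (HH : forall y, hint (fun z => u + v * z)%C y a b =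
  (RtoC (b - a) * (u + v * (Ci * y)) + RtoC ((b * b - a * a) / 2) * v)%C).
{ intros y; apply (is_RInt_unique (V := C_R_CompleteNormedModule)), is_RInt_affine.
  intros t; replace (t, y) with (RtoC t + Ci * RtoC y)%C; [ring|].
  unfold RtoC, Ci, Cplus, Cmult; simpl; f_equal; ring. }
assert (VV : forall x, vint (fun z => u + v * z)%C x c d =
  (RtoC (d - c) * (u + v * x) + RtoC ((d * d - c * c) / 2) * (v * Ci))%C).
{ intros x; apply (is_RInt_unique (V := C_R_CompleteNormedModule)), is_RInt_affine.
  intros t; replace (x, t) with (RtoC x + Ci * RtoC t)%C; [ring|].
  unfold RtoC, Ci, Cplus, Cmult; simpl; f_equal; ring. }
unfold oint; rewrite !HH, !VV, !RtoC_minus; ring.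
Qed.

Lemma nested_intervals (a b : nat -> R) :
  (forall n, a n <= a (S n)) -> (forall n, b (S n) <= b n) -> (forall n, a n <= b n) ->
  exists p, forall n, a n <= p <= b n.
Proof.
intros Ha Hb Hab.
assert (Ha' : forall n m, (n <= m)%nat -> a n <= a m).
{ intros n m H; induction H; [lra|]. specialize (Ha m); lra. }
assert (Hb' : forall n m, (n <= m)%nat -> b m <= b n).
{ intros n m H; induction H; [lra|]. specialize (Hb m); lra. }
assert (Hx : forall n m, a n <= b m).
{ intros n m; destruct (Nat.le_ge_cases n m) as [H|H].
  - specialize (Ha' _ _ H); specialize (Hab m); lra.
  - specialize (Hb' _ _ H); specialize (Hab n); lra. }
destruct (completeness (fun x => exists n, x = a n)) as [p [Hp1 Hp2]].
- exists (b O); intros x [n ->]; apply Hx.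
- exists (a O); now exists O.
- exists p; intros n; split.
  + apply Hp1; now exists n.
  + apply Hp2; intros x [m ->]; apply Hx.
Qed.

(** A compactness principle: a property inherited from the four quarters and true of small
    rectangles around each point is true of the whole. The equation between side lengths restricts
    the local hypothesis to rectangles similar to the first one. Quartering preserves the shape, and
    a fixed shape keeps (width + height)^2 comparable with the area. *)
Lemma bisection_2d (P : R -> R -> R -> R -> Prop) a0 b0 c0 d0 :
  a0 <= b0 -> c0 <= d0 ->
  (forall a b c d, a0 <= a -> a <= b -> b <= b0 -> c0 <= c -> c <= d -> d <= d0 ->
    P a ((a + b) / 2) c ((c + d) / 2) -> P ((a + b) / 2) b c ((c + d) / 2) ->
    P a ((a + b) / 2) ((c + d) / 2) d -> P ((a + b) / 2) b ((c + d) / 2) d ->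
    P a b c d) ->
  (forall p, in_rect a0 b0 c0 d0 p -> exists delta, 0 < delta /\
    forall a b c d, a0 <= a -> b <= b0 -> c0 <= c -> d <= d0 -> in_rect a b c d p ->
    b - a < delta -> d - c < delta -> (b - a) * (d0 - c0) = (d - c) * (b0 - a0) ->
    P a b c d) ->
  P a0 b0 c0 d0.
Proof.
intros Hab0 Hcd0 Hsplit Hloc; apply NNPP; intros HnP.
pose (fa (q : R * R * R * R) := fst (fst (fst q))).
pose (fb (q : R * R * R * R) := snd (fst (fst q))).
pose (fc (q : R * R * R * R) := snd (fst q)).
pose (fd (q : R * R * R * R) := snd q).
(* Subrectangles, coded as (a, b, c, d), on which [P] fails. Each has a failing quarter, and a
   sequence of such quarters shrinks to a point that contradicts [Hloc]. *)
pose (bad q := a0 <= fa q /\ fa q <= fb q /\ fb q <= b0 /\ c0 <= fc q /\ fc q <= fd q /\ fd q <= d0 /\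
  ~ P (fa q) (fb q) (fc q) (fd q)).
pose (rel q q' := fa q <= fa q' /\ fb q' <= fb q /\ fc q <= fc q' /\ fd q' <= fd q /\
  fb q' - fa q' = (fb q - fa q) / 2 /\ fd q' - fc q' = (fd q - fc q) / 2).
assert (Hstep : forall q, bad q -> exists q', bad q' /\ rel q q').
{ intros q (H1 & H2 & H3 & H4 & H5 & H6 & H7).
  set (m := (fa q + fb q) / 2); set (k := (fc q + fd q) / 2).
  assert (Hm : m = (fa q + fb q) / 2) by auto. assert (Hk : k = (fc q + fd q) / 2) by auto.
  apply NNPP; intros Hno; apply H7; apply Hsplit; auto; fold m k; apply NNPP; intros Hq; apply Hno.
  - exists (fa q, m, fc q, k); unfold bad, rel, fa, fb, fc, fd in *; simpl in *; repeat split; auto; lra.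
  - exists (m, fb q, fc q, k); unfold bad, rel, fa, fb, fc, fd in *; simpl in *; repeat split; auto; lra.
  - exists (fa q, m, k, fd q); unfold bad, rel, fa, fb, fc, fd in *; simpl in *; repeat split; auto; lra.
  - exists (m, fb q, k, fd q); unfold bad, rel, fa, fb, fc, fd in *; simpl in *; repeat split; auto; lra. }
pose (next q := epsilon (inhabits (0, 0, 0, 0)) (fun q' => bad q' /\ rel q q')).
assert (Hnext : forall q, bad q -> bad (next q) /\ rel q (next q)).
{ intros q Hq; exact (epsilon_spec (inhabits (0, 0, 0, 0)) (fun q' => bad q' /\ rel q q') (Hstep q Hq)). }
pose (s := fix s n := match n with O => (a0, b0, c0, d0) | S n => next (s n) end).
assert (Hbad : forall n, bad (s n)).
{ induction n as [|n IH]; [|now apply Hnext].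
  unfold bad, fa, fb, fc, fd; simpl; repeat split; auto; lra. }
assert (Hrel : forall n, rel (s n) (s (S n))) by (intros n; now apply Hnext).
destruct (nested_intervals (fun n => fa (s n)) (fun n => fb (s n))) as [x Hx].
{ intros n; apply Hrel. } { intros n; apply Hrel. } { intros n; apply Hbad. }
destruct (nested_intervals (fun n => fc (s n)) (fun n => fd (s n))) as [y Hy].
{ intros n; apply Hrel. } { intros n; apply Hrel. } { intros n; apply Hbad. }
destruct (Hloc (x, y)) as [delta [Hd HP]].
{ specialize (Hx O); specialize (Hy O); unfold fa, fb, fc, fd in *; simpl in *; split; simpl; lra. }
assert (Hsz : forall n, fb (s n) - fa (s n) = (b0 - a0) * (/ 2) ^ n /\
                        fd (s n) - fc (s n) = (d0 - c0) * (/ 2) ^ n).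
{ induction n as [|n [IH1 IH2]].
  - unfold fa, fb, fc, fd; simpl; lra.
  - destruct (Hrel n) as (_ & _ & _ & _ & E1 & E2); rewrite E1, E2, IH1, IH2; simpl; lra. }
(* The extra 1 keeps the denominator positive when the rectangle is degenerate. *)
assert (Hlim : exists n, (/ 2) ^ n < delta / ((b0 - a0) + (d0 - c0) + 1)).
{ assert (Hh : Rabs (/ 2) < 1) by (rewrite Rabs_pos_eq; lra).
  destruct (pow_lt_1_zero (/ 2) Hh (delta / ((b0 - a0) + (d0 - c0) + 1))) as [n Hn].
  - apply Rdiv_lt_0_compat; lra.
  - exists n; specialize (Hn n (le_n n)). rewrite Rabs_pos_eq in Hn; auto.
    apply pow_le; lra. }
destruct Hlim as [n Hn].
destruct (Hsz n) as [E1 E2].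
assert (Hp : 0 < (/ 2) ^ n) by (apply pow_lt; lra).
assert (Hn' : (/ 2) ^ n * ((b0 - a0) + (d0 - c0) + 1) < delta).
{ apply Rlt_div_r; [lra|auto]. }
destruct (Hbad n) as (G1 & G2 & G3 & G4 & G5 & G6 & G7).
apply G7, HP; auto.
- split; simpl; auto.
- rewrite E1; nra.
- rewrite E2; nra.
- rewrite E1, E2; ring.
Qed.

(** The affine part integrates to 0. The remainder is at most eps (width + height), integrated over
    the perimeter 2 (width + height). *)
Lemma oint_small f a b c d p l eps : a <= b -> c <= d -> in_rect a b c d p -> 0 <= eps ->
  (forall z, in_rect a b c d z -> Ccont f z) ->
  (forall z, in_rect a b c d z -> Cmod (f z - f p - l * (z - p)) <= eps * Cmod (z - p)) ->
  Cmod (oint f a b c d) <= 2 * eps * ((b - a) + (d - c)) * ((b - a) + (d - c)).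
Proof.
intros Hab Hcd Hp He Hc Hd.
set (u := (f p - l * p)%C).
assert (Hr : forall z, in_rect a b c d z -> Ccont (fun z => f z + (- u + - l * z))%C z).
{ intros z Hz; apply Ccont_plus; auto.
  apply Ccont_plus; [apply Ccont_const|].
  apply Ccont_mult; [apply Ccont_const|apply Ccont_id]. }
rewrite (oint_ext f (fun z => (f z + (- u + - l * z)) + (u + l * z))%C); auto.
2: { intros z _; ring. }
rewrite (oint_plus (fun z => f z + (- u + - l * z))%C); auto.
- rewrite oint_affine, Cplus_0_r.
  replace (2 * eps * (b - a + (d - c)) * (b - a + (d - c)))
   with (2 * (b - a + (d - c)) * (eps * (b - a + (d - c)))) by ring.
  apply Cmod_oint_le; auto.
  + intros z [Hz _]; auto.
  + intros z [Hz _].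
    replace (f z + (- u + - l * z))%C with (f z - f p - l * (z - p))%C by (unfold u; ring).
    eapply Rle_trans; [now apply Hd|].
    apply Rmult_le_compat_l; auto.
    eapply Rle_trans; [apply Cmod_le_Rabs_plus|].
    destruct Hz as [Hz1 Hz2]; destruct Hp as [Hp1 Hp2].
    change (Re (z - p)) with (Re z - Re p); change (Im (z - p)) with (Im z - Im p).
    apply Rplus_le_compat; apply Rabs_le; lra.
- intros z [Hz _]; auto.
- intros z _; apply Ccont_plus; [apply Ccont_const|].
  apply Ccont_mult; [apply Ccont_const|apply Ccont_id].
Qed.

Lemma Cdiff_eps f z l eps : Cdiff f z l -> 0 < eps ->
  Cnear z (fun w => Cmod (f w - f z - l * (w - z)) <= eps * Cmod (w - z)).
Proof.
intros [p [Hp [Hp1 Hp2]]] He.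
generalize (Cnear_and _ _ _ (Hp eps He) Hp2); apply Cnear_mono; intros w [H1 H2].
rewrite H2, <- Hp1.
replace (f z + p w * (w - z) - f z - p z * (w - z))%C with ((p w - p z) * (w - z))%C by ring.
rewrite Cmod_mult; apply Rmult_le_compat_r; [apply Cmod_ge_0|lra].
Qed.

(* Goursat: the bound |oint| <= eps * area is inherited from the four quarters, and holds for all
   small enough rectangles of the given shape around a point of differentiability. *)
Theorem Cauchy_rectangle f a b c d : a < b -> c < d ->
  (forall z, in_rect a b c d z -> exists l, Cdiff f z l) ->
  oint f a b c d = 0.
Proof.
intros Hab Hcd Hf.
assert (Hc : forall z, in_rect a b c d z -> Ccont f z).
{ intros z Hz; destruct (Hf z Hz) as [l Hl]; exact (Cdiff_cont _ _ _ Hl). }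
assert (H : forall eps, 0 < eps -> Cmod (oint f a b c d) <= eps * ((b - a) * (d - c))).
{ intros eps He.
  apply (bisection_2d (fun a b c d => Cmod (oint f a b c d) <= eps * ((b - a) * (d - c)))); try lra.
  - intros a' b' c' d' H1 H2 H3 H4 H5 H6 Q1 Q2 Q3 Q4.
    set (m := (a' + b') / 2) in *; set (k := (c' + d') / 2) in *.
    assert (Hm : m = (a' + b') / 2) by auto; assert (Hk : k = (c' + d') / 2) by auto.
    rewrite (oint_split_h f a' m b' c' d'); try lra.
    2: { intros z [[Z1 Z2] _]; apply Hc; split; lra. }
    rewrite (oint_split_v f a' m c' k d'); try lra.
    2: { intros z [[Z1 Z2] _]; apply Hc; split; lra. }
    rewrite (oint_split_v f m b' c' k d'); try lra.
    2: { intros z [[Z1 Z2] _]; apply Hc; split; lra. }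
    eapply Rle_trans; [apply Cmod_triangle|].
    eapply Rle_trans; [apply Rplus_le_compat; apply Cmod_triangle|].
    nra.
  - intros p Hp; destruct (Hf p Hp) as [l Hl].
    set (X := b - a); set (Y := d - c).
    assert (HX : 0 < X) by (unfold X; lra); assert (HY : 0 < Y) by (unfold Y; lra).
    (* Chosen so that 2 e (x + y)^2 = eps x y whenever x : y = X : Y. *)
    set (e := eps * (X * Y) / (2 * (X + Y) * (X + Y))).
    assert (He' : 0 < e).
    { unfold e; apply Rdiv_lt_0_compat; repeat apply Rmult_lt_0_compat; lra. }
    destruct (Cdiff_eps f p l e Hl He') as [dl [Hdl Hn]].
    exists (dl / 2); split; [lra|].
    intros a' b' c' d' H1 H2 H3 H4 H5 H6 H7 H8.
    destruct H5 as [P1 P2].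
    eapply Rle_trans; [apply (oint_small f a' b' c' d' p l e); try lra|].
    + split; lra.
    + intros z [Z1 Z2]; apply Hc; split; lra.
    + intros z [Z1 Z2]; apply Hn.
      eapply Rle_lt_trans; [apply Cmod_le_Rabs_plus|].
      change (Re (z - p)) with (Re z - Re p); change (Im (z - p)) with (Im z - Im p).
      assert (Rabs (Re z - Re p) < dl / 2) by (apply Rabs_def1; lra).
      assert (Rabs (Im z - Im p) < dl / 2) by (apply Rabs_def1; lra).
      lra.
    + fold X Y in H8.
      set (x := b' - a') in *; set (y := d' - c') in *.
      assert (Hy : y = x * Y / X) by (rewrite H8; field; lra).
      right; rewrite Hy; unfold e; field; lra. }
apply Cmod_eq_0; apply Rle_antisym; [|apply Cmod_ge_0].
apply Rnot_lt_le; intros H0.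
(* With this eps the bound says that the modulus is at most half of itself. *)
specialize (H (Cmod (oint f a b c d) / (2 * ((b - a) * (d - c))))).
assert (HA : 0 < (b - a) * (d - c)) by (apply Rmult_lt_0_compat; lra).
assert (Cmod (oint f a b c d) / (2 * ((b - a) * (d - c))) * ((b - a) * (d - c)) = Cmod (oint f a b c d) / 2)
 by (field; lra).
rewrite H1 in H.
assert (0 < Cmod (oint f a b c d) / (2 * ((b - a) * (d - c)))) by (apply Rdiv_lt_0_compat; lra).
specialize (H H2); lra.
Qed.

(** * Residues at simple poles *)

Lemma sqr_plus_sqr_pos x s : 0 < s -> 0 < x * x + s * s.
Proof.
intros H; apply Rplus_le_lt_0_compat; [apply Rle_0_sqr|now apply Rmult_lt_0_compat].
Qed.

(** The antiderivative is 2 atan((t - q) / s), whose inner argument runs from -1 to 1: total PI.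
    Each pair of opposite sides of a square centred at a pole leads to this integral. *)
Lemma is_RInt_lorentz (g : R -> C) (v : C) q s : 0 < s ->
  (forall t, g t = (RtoC (2 * s / ((t - q) * (t - q) + s * s)) * v)%C) ->
  is_RInt (V := C_R_CompleteNormedModule) g (q - s) (q + s) (RtoC PI * v)%C.
Proof.
intros Hs Hg.
assert (Hpos : forall t, 0 < (t - q) * (t - q) + s * s) by (intros; now apply sqr_plus_sqr_pos).
apply (is_RInt_ext (fun t => scal (V := C_R_NormedModule) (2 * s / ((t - q) * (t - q) + s * s)) v)).
{ intros t _; rewrite Hg; apply scal_R_Cmult. }
replace (RtoC PI * v)%C with (minus (G := C_R_CompleteNormedModule)
  (scal (2 * atan ((q + s - q) / s)) v) (scal (2 * atan ((q - s - q) / s)) v)).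
2: { rewrite !scal_R_Cmult.
  change (RtoC (2 * atan ((q + s - q) / s)) * v + - (RtoC (2 * atan ((q - s - q) / s)) * v)
    = RtoC PI * v)%C.
  replace ((q + s - q) / s) with 1 by (field; lra).
  replace ((q - s - q) / s) with (- (1)) by (field; lra).
  rewrite atan_opp, atan_1.
  replace (2 * - (PI / 4)) with (- (PI / 2)) by lra.
  replace (2 * (PI / 4)) with (PI / 2) by lra.
  replace (RtoC PI) with (RtoC (PI / 2 + PI / 2)) by (f_equal; lra).
  rewrite RtoC_opp, RtoC_plus; ring. }
apply (is_RInt_derive (V := C_R_CompleteNormedModule)
  (fun t => scal (2 * atan ((t - q) / s)) v)).
- intros t _.
  apply (is_derive_scal_l (V := C_R_NormedModule) (fun t => 2 * atan ((t - q) / s))).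
  auto_derive; [auto|]. specialize (Hpos t); field; nra.
- intros t _.
  apply (continuous_scal_l (V := C_R_NormedModule) (fun t => 2 * s / ((t - q) * (t - q) + s * s))).
  apply (ex_derive_continuous (V := R_NormedModule)).
  specialize (Hpos t); auto_derive; lra.
Qed.

Lemma Ccont_pole (r p z : C) : z <> p -> Ccont (fun z => r * / (z + - p))%C z.
Proof.
intros H; apply Ccont_mult; [apply Ccont_const|].
apply (Ccont_inv (fun z => z + - p)%C).
- apply Ccont_plus; [apply Ccont_id|apply Ccont_const].
- now apply Cminus_eq_contra.
Qed.

Lemma Cpair_neq_0 x y : x * x + y * y <> 0 -> ((x, y) : C) <> 0.
Proof. intros H H0; injection H0; intros -> ->; apply H; ring. Qed.

(** Opposite sides combine: 1 / (w - i s) - 1 / (w + i s) = 2 i s / (w^2 + s^2). The horizontal pair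
    gives PI i r and the vertical pair, weighted by [Ci], another PI i r. *)
Lemma oint_square_pole (r p : C) s : 0 < s ->
  oint (fun z => r * / (z + - p))%C (Re p - s) (Re p + s) (Im p - s) (Im p + s) =
  (2 * RtoC PI * Ci * r)%C.
Proof.
intros Hs; set (f := (fun z => r * / (z + - p))%C).
assert (HH : (hint f (Im p - s) (Re p - s) (Re p + s) - hint f (Im p + s) (Re p - s) (Re p + s) =
  RtoC PI * (Ci * r))%C).
{ apply (eq_trans (y := RInt (V := C_R_CompleteNormedModule)
    (fun t => minus (G := C_R_CompleteNormedModule) (f (t, (Im p - s)%R)) (f (t, (Im p + s)%R))) (Re p - s) (Re p + s))).
  - symmetry; apply (RInt_minus (V := C_R_CompleteNormedModule)); apply ex_hint; try lra;
    intros t Ht; apply Ccont_pole; intros H;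
    pose proof (f_equal Im H) as H'; simpl in H'; lra.
  - apply (is_RInt_unique (V := C_R_CompleteNormedModule)), is_RInt_lorentz; auto.
    intros t; change (f (t, (Im p - s)%R) + - f (t, (Im p + s)%R) =
      RtoC (2 * s / ((t - Re p) * (t - Re p) + s * s)) * (Ci * r))%C.
    assert (Hp : (t - Re p) * (t - Re p) + s * s <> 0) by (apply Rgt_not_eq; now apply sqr_plus_sqr_pos).
    unfold f.
    replace ((t, (Im p - s)%R) + - p)%C with (RtoC (t - Re p) - Ci * RtoC s)%C
      by (destruct p; unfold Cminus, RtoC, Ci, Cplus, Copp, Cmult, Re, Im; simpl; f_equal; ring).
    replace ((t, (Im p + s)%R) + - p)%C with (RtoC (t - Re p) + Ci * RtoC s)%C
      by (destruct p; unfold Cminus, RtoC, Ci, Cplus, Copp, Cmult, Re, Im; simpl; f_equal; ring).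
    rewrite RtoC_div by auto.
    rewrite RtoC_plus, !RtoC_mult.
    set (w := RtoC (t - Re p)); set (S := RtoC s).
    assert (Hne : forall e, e = 1 \/ e = -1 -> (w + RtoC e * (Ci * S))%C <> 0).
    { intros e He; unfold w, S.
      replace (RtoC (t - Re p) + RtoC e * (Ci * RtoC s))%C with (((t - Re p)%R, (e * s)%R) : C)
        by (unfold RtoC, Ci, Cplus, Cmult; simpl; f_equal; ring).
      apply Cpair_neq_0.
      replace ((t - Re p) * (t - Re p) + e * s * (e * s))
        with ((t - Re p) * (t - Re p) + s * s) by (destruct He as [-> | ->]; ring); auto. }
    assert (N1 : (w + Ci * S)%C <> 0).
    { intros E; apply (Hne 1); auto; rewrite <- E; ring. }
    assert (N2 : (w - Ci * S)%C <> 0).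
    { intros E; apply (Hne (-1)); auto; rewrite <- E; ring. }
    assert (N3 : (w * w + S * S = (w + Ci * S) * (w - Ci * S))%C).
    { replace ((w + Ci * S) * (w - Ci * S))%C with (w * w - Ci * Ci * (S * S))%C by ring.
      replace (Ci * Ci)%C with (RtoC (-1)) by (unfold RtoC, Ci, Cmult; simpl; f_equal; ring). ring. }
    rewrite N3; field; auto. }
assert (VV : (vint f (Re p + s) (Im p - s) (Im p + s) - vint f (Re p - s) (Im p - s) (Im p + s) =
  RtoC PI * r)%C).
{ apply (eq_trans (y := RInt (V := C_R_CompleteNormedModule)
    (fun t => minus (G := C_R_CompleteNormedModule) (f ((Re p + s)%R, t)) (f ((Re p - s)%R, t))) (Im p - s) (Im p + s))).
  - symmetry; apply (RInt_minus (V := C_R_CompleteNormedModule)); apply ex_vint; try lra;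
    intros t Ht; apply Ccont_pole; intros H;
    pose proof (f_equal Re H) as H'; simpl in H'; lra.
  - apply (is_RInt_unique (V := C_R_CompleteNormedModule)), is_RInt_lorentz; auto.
    intros t; change (f ((Re p + s)%R, t) + - f ((Re p - s)%R, t) =
      RtoC (2 * s / ((t - Im p) * (t - Im p) + s * s)) * r)%C.
    assert (Hp : (t - Im p) * (t - Im p) + s * s <> 0) by (apply Rgt_not_eq; now apply sqr_plus_sqr_pos).
    unfold f.
    replace (((Re p + s)%R, t) + - p)%C with (RtoC s + Ci * RtoC (t - Im p))%C
      by (destruct p; unfold Cminus, RtoC, Ci, Cplus, Copp, Cmult, Re, Im; simpl; f_equal; ring).
    replace (((Re p - s)%R, t) + - p)%C with (- (RtoC s - Ci * RtoC (t - Im p)))%C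
      by (destruct p; unfold Cminus, RtoC, Ci, Cplus, Copp, Cmult, Re, Im; simpl; f_equal; ring).
    rewrite RtoC_div by auto.
    rewrite RtoC_plus, !RtoC_mult.
    set (w := RtoC (t - Im p)); set (S := RtoC s).
    assert (Hne : forall e, e = 1 \/ e = -1 -> (S + RtoC e * (Ci * w))%C <> 0).
    { intros e He; unfold w, S.
      replace (RtoC s + RtoC e * (Ci * RtoC (t - Im p)))%C with ((s, (e * (t - Im p))%R) : C)
        by (unfold RtoC, Ci, Cplus, Cmult; simpl; f_equal; ring).
      apply Cpair_neq_0.
      replace (s * s + e * (t - Im p) * (e * (t - Im p)))
        with ((t - Im p) * (t - Im p) + s * s) by (destruct He as [-> | ->]; ring); auto. }
    assert (N1 : (S + Ci * w)%C <> 0).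
    { intros E; apply (Hne 1); auto; rewrite <- E; ring. }
    assert (N2 : (S - Ci * w)%C <> 0).
    { intros E; apply (Hne (-1)); auto; rewrite <- E; ring. }
    assert (N3 : (w * w + S * S = (S + Ci * w) * (S - Ci * w))%C).
    { replace ((S + Ci * w) * (S - Ci * w))%C with (S * S - Ci * Ci * (w * w))%C by ring.
      replace (Ci * Ci)%C with (RtoC (-1)) by (unfold RtoC, Ci, Cmult; simpl; f_equal; ring). ring. }
    rewrite N3; field; auto. }
unfold oint; rewrite HH, VV; ring.
Qed.

Lemma C_eq_of_close (z w : C) k : (forall eps, 0 < eps -> Cmod (z - w) <= k * eps) -> z = w.
Proof.
intros H; apply Ceq_minus, Cmod_eq_0, Rle_antisym; [|apply Cmod_ge_0].
apply Rnot_lt_le; intros H0.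
destruct (Rle_dec k 0) as [Hk|Hk].
- specialize (H 1 Rlt_0_1); lra.
- specialize (H (Cmod (z - w) / (2 * k))).
  replace (k * (Cmod (z - w) / (2 * k))) with (Cmod (z - w) / 2) in H by (field; lra).
  assert (0 < Cmod (z - w) / (2 * k)) by (apply Rdiv_lt_0_compat; lra).
  specialize (H H1); lra.
Qed.

(** No Laurent expansion is used: after shrinking to a small square, [f] is compared with g(p) / (z
    - p), and continuity of [g] at [p] makes the difference of the integrals small. *)
Theorem residue_rectangle (f g : C -> C) (p : C) a b c d :
  a < Re p < b -> c < Im p < d ->
  (forall z, in_rect a b c d z -> z <> p -> exists l, Cdiff f z l) ->
  Ccont g p ->
  Cnear p (fun z => z <> p -> f z = g z * / (z - p))%C ->
  oint f a b c d = (2 * RtoC PI * Ci * g p)%C.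
Proof.
intros Hx Hy Hf Hg Hfg.
assert (Hc : forall z, in_rect a b c d z -> z <> p -> Ccont f z).
{ intros z Hz Hzp; destruct (Hf z Hz Hzp) as [l Hl]; exact (Cdiff_cont _ _ _ Hl). }
(* 8 because a square of half-side s has perimeter 8 s, while the difference is at most eps / s on
   it. *)
apply (C_eq_of_close _ _ 8); intros eps He.
destruct (Cnear_and _ _ _ (Hg eps He) Hfg) as [dl [Hdl Hn]].
(* Halving puts the square strictly inside the rectangle; dl / 4 keeps its corners within distance
   dl of [p]. *)
set (s := Rmin (dl / 4) (Rmin (Rmin (Re p - a) (b - Re p)) (Rmin (Im p - c) (d - Im p))) / 2).
assert (Hs : 0 < s) by (unfold s; apply Rdiv_lt_0_compat; [repeat apply Rmin_pos; lra|lra]).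
assert (Hss : 2 * s <= dl / 4 /\ 2 * s <= Re p - a /\ 2 * s <= b - Re p /\
   2 * s <= Im p - c /\ 2 * s <= d - Im p).
{ unfold s, Rmin; repeat destruct Rle_dec; lra. }
destruct Hss as (S1 & S2 & S3 & S4 & S5).
assert (Hnp : forall z, ~ (Re z = Re p /\ Im z = Im p) -> z <> p).
{ intros z H ->; now apply H. }
set (x1 := Re p - s); set (x2 := Re p + s); set (y1 := Im p - s); set (y2 := Im p + s).
assert (E : oint f a b c d = oint f x1 x2 y1 y2).
(* Cut off the left and right strips, then the bottom and top pieces; [f] is holomorphic on all
   four. *)
{ rewrite (oint_split_h f a x1 b c d); try (unfold x1; lra).
  2: { intros z [Z1 Z2]; apply Hc; [exact Z1|]; apply Hnp; destruct Z1 as [Z3 Z4]; intros [? ?]; lra. }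
  rewrite (oint_split_h f x1 x2 b c d); try (unfold x1, x2; lra).
  2: { intros z [[Z1 Z2] Z3]; apply Hc; [split; unfold x1 in *; lra|apply Hnp; unfold x1 in *; intros [? ?]; lra]. }
  rewrite (oint_split_v f x1 x2 c y1 d); try (unfold x1, x2, y1; lra).
  2: { intros z [[Z1 Z2] Z3]; apply Hc; [split; unfold x1, x2 in *; lra|apply Hnp; unfold x1, x2 in *; intros [? ?]; lra]. }
  rewrite (oint_split_v f x1 x2 y1 y2 d); try (unfold x1, x2, y1, y2; lra).
  2: { intros z [[Z1 Z2] Z3]; apply Hc; [split; unfold x1, x2, y1 in *; lra|apply Hnp; unfold x1, x2, y1 in *; intros [? ?]; lra]. }
  rewrite (Cauchy_rectangle f a x1 c d), (Cauchy_rectangle f x2 b c d),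
    (Cauchy_rectangle f x1 x2 c y1), (Cauchy_rectangle f x1 x2 y2 d); try (unfold x1, x2, y1, y2; lra).
  - ring.
  - intros z [Z1 Z2]; unfold x1, x2, y1, y2 in *; apply Hf; [split; lra|apply Hnp; intros [? ?]; lra].
  - intros z [Z1 Z2]; unfold x1, x2, y1, y2 in *; apply Hf; [split; lra|apply Hnp; intros [? ?]; lra].
  - intros z [Z1 Z2]; unfold x1, x2, y1, y2 in *; apply Hf; [split; lra|apply Hnp; intros [? ?]; lra].
  - intros z [Z1 Z2]; unfold x1, x2, y1, y2 in *; apply Hf; [split; lra|apply Hnp; intros [? ?]; lra]. }
assert (Hsq : forall z, on_boundary x1 x2 y1 y2 z -> in_rect a b c d z /\ z <> p /\
  Cmod (z - p) < dl /\ s <= Cmod (z - p)).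
{ intros z [[Z1 Z2] Z3]; unfold x1, x2, y1, y2 in *; split; [split; lra|].
  split; [apply Hnp; intros [? ?]; lra|split].
  - eapply Rle_lt_trans; [apply Cmod_le_Rabs_plus|].
    change (Re (z - p)) with (Re z - Re p); change (Im (z - p)) with (Im z - Im p).
    assert (Rabs (Re z - Re p) <= s) by (apply Rabs_le; lra).
    assert (Rabs (Im z - Im p) <= s) by (apply Rabs_le; lra). lra.
  - pose proof (Rabs_Re_le (z - p)) as R1; pose proof (Rabs_Im_le (z - p)) as R2.
    change (Re (z - p)) with (Re z - Re p) in R1; change (Im (z - p)) with (Im z - Im p) in R2.
    pose proof (Rle_abs (Re z - Re p)). pose proof (Rle_abs (- (Re z - Re p))).
    pose proof (Rle_abs (Im z - Im p)). pose proof (Rle_abs (- (Im z - Im p))).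
    rewrite Rabs_Ropp in *. lra. }
assert (Hcf : forall z, on_boundary x1 x2 y1 y2 z -> Ccont f z).
{ intros z Hz; destruct (Hsq z Hz) as (Q1 & Q2 & _); auto. }
rewrite E, <- (oint_square_pole (g p) p s) by auto; fold x1 x2 y1 y2.
assert (Hr : forall z, on_boundary x1 x2 y1 y2 z -> Ccont (fun z => - g p * / (z + - p))%C z).
{ intros z Hz; apply Ccont_pole; now apply Hsq. }
assert (Hr' : forall z, on_boundary x1 x2 y1 y2 z -> Ccont (fun z => g p * / (z + - p))%C z).
{ intros z Hz; apply Ccont_pole; now apply Hsq. }
rewrite (oint_ext f (fun z => (f z + - g p * / (z + - p)) + g p * / (z + - p))%C);
  try (unfold x1, x2, y1, y2; lra).
2: { intros z _; ring. }
rewrite (oint_plus (fun z => f z + - g p * / (z + - p))%C); try (unfold x1, x2, y1, y2; lra); auto.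
2: { intros z Hz; apply Ccont_plus; auto. }
match goal with |- Cmod (?u + ?v - ?v) <= _ => replace (u + v - v)%C with u by ring end.
eapply Rle_trans.
- apply (Cmod_oint_le _ _ _ _ _ (eps / s)); try (unfold x1, x2, y1, y2; lra).
  + intros z Hz; apply Ccont_plus; auto.
  + intros z Hz; destruct (Hsq z Hz) as (Q1 & Q2 & Q3 & Q4).
    destruct (Hn z Q3) as [G1 G2].
    rewrite (G2 Q2).
    replace (g z * / (z - p) + - g p * / (z + - p))%C with ((g z - g p) / (z - p))%C
      by (unfold Cdiv, Cminus; ring).
    rewrite Cmod_div by now apply Cminus_eq_contra.
    apply Rle_div_l; [lra|].
    apply Rle_trans with (eps / s * s); [replace (eps / s * s) with eps by (field; lra); lra|].
    apply Rmult_le_compat_l; [apply Rlt_le, Rdiv_lt_0_compat; lra|auto].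
- unfold x1, x2, y1, y2; right; field; lra.
Qed.

(** * Residues of the sinc kernel *)

Lemma Csin_eq_0 z : Csin z = 0 -> exists k : Z, z = RtoC (IZR k * PI).
Proof.
destruct z as [a b]; intros H.
pose proof (Cmod_sqr_Csin a b) as E; rewrite H, Cmod_0 in E.
pose proof (Rle_0_sqr (sin a)) as P1; pose proof (Rle_0_sqr (sinh b)) as P2; unfold Rsqr in *.
assert (S1 : sin a = 0) by (apply Rsqr_eq_0; unfold Rsqr; lra).
assert (S2 : sinh b = 0) by (apply Rsqr_eq_0; unfold Rsqr; lra).
destruct (sin_eq_0_0 a S1) as [k Hk]; exists k.
assert (Hb : b = 0).
{ unfold sinh in S2; assert (E2 : exp b = exp (- b)) by lra; apply exp_inv in E2; lra. }
now rewrite Hb, Hk.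
Qed.

Lemma sin_cos_IZR_PI k : sin (IZR k * PI) = 0 /\ cos (IZR k * PI) * cos (IZR k * PI) = 1.
Proof.
assert (S : sin (IZR k * PI) = 0) by (apply sin_eq_0_1; now exists k).
split; auto; pose proof (sin2_cos2 (IZR k * PI)) as H; rewrite S in H; unfold Rsqr in H; lra.
Qed.

Definition sinc_kernel (F : C -> C) (h x : R) (z : C) : C :=
  (F z * / ((z + - RtoC x) * Csin (RtoC (PI / h) * z)))%C.

Lemma Cdiff_sin_scaled h z :
  Cdiff (fun z => Csin (RtoC (PI / h) * z))%C z (RtoC (PI / h) * Ccos (RtoC (PI / h) * z))%C.
Proof.
replace (RtoC (PI / h) * Ccos (RtoC (PI / h) * z))%C
  with (Ccos (RtoC (PI / h) * z) * (RtoC (PI / h) * 1))%C by ring.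
apply (Cdiff_comp Csin (fun z => RtoC (PI / h) * z)%C).
- apply Cdiff_scal, Cdiff_id.
- apply Cdiff_Csin.
Qed.

Lemma Csin_scaled_eq_0 h z : 0 < h -> Csin (RtoC (PI / h) * z) = 0 ->
  exists k : Z, z = RtoC (IZR k * h).
Proof.
intros Hh H; destruct (Csin_eq_0 _ H) as [k Hk]; exists k.
pose proof PI_RGT_0 as HPI.
replace z with (RtoC (h / PI) * (RtoC (PI / h) * z))%C.
- rewrite Hk, <- RtoC_mult; f_equal; field; lra.
- rewrite Cmult_assoc, <- RtoC_mult.
  replace (h / PI * (PI / h)) with 1 by (field; lra); ring.
Qed.

Lemma Cdiff_sinc_kernel F h x z l : 0 < h -> Cdiff F z l -> z <> RtoC x ->
  (forall k, z <> RtoC (IZR k * h)) -> exists m, Cdiff (sinc_kernel F h x) z m.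
Proof.
intros Hh HF Hx Hk; eexists; unfold sinc_kernel.
apply Cdiff_mult; [apply HF|].
apply (Cdiff_inv (fun z => (z + - RtoC x) * Csin (RtoC (PI / h) * z))%C).
- apply Cdiff_mult; [|apply Cdiff_sin_scaled].
  apply Cdiff_plus; [apply Cdiff_id|apply Cdiff_const].
- apply Cmult_neq_0; [now apply Cminus_eq_contra|].
  intros H; destruct (Csin_scaled_eq_0 h z Hh H) as [k H']; now apply (Hk k).
Qed.

(** The sign (-1)^k is written [cos (IZR k * PI)], as it arises from the derivative of the sine,
    which avoids a parity argument. *)
Definition sinc_residue (F : C -> C) (h x : R) (k : Z) : C :=
  (F (RtoC (IZR k * h)) * / (RtoC (IZR k * h - x) * RtoC (PI / h * cos (IZR k * PI))))%C.

Lemma IZR_between (j k : Z) : (IZR k - 1 < IZR j < IZR k + 1) -> j = k.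
Proof.
intros [H1 H2].
assert (k - 1 < j)%Z by (apply lt_IZR; rewrite minus_IZR; lra).
assert (j < k + 1)%Z by (apply lt_IZR; rewrite plus_IZR; lra).
lia.
Qed.

(** Near the node p, the Caratheodory slope [phi] of the scaled sine gives sin(pi z / h) = phi(z) (z
    - p), so F(z) / ((z - x) phi(z)) is the continuous numerator for [residue_rectangle]. The bounds
    on [a] and [b] exclude the neighbouring nodes. *)
Lemma oint_kernel_node F dd h x k a b y : 0 < h -> 0 < y < dd ->
  (forall z, strip dd z -> exists l, Cdiff F z l) ->
  (IZR k - 1) * h < a -> a < IZR k * h < b -> b < (IZR k + 1) * h ->
  ~ (a <= x <= b) ->
  oint (sinc_kernel F h x) a b (- y) y = (2 * RtoC PI * Ci * sinc_residue F h x k)%C.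
Proof.
intros Hh Hy HF Ha Hab Hb Hx.
pose proof PI_RGT_0 as HPI.
set (p := RtoC (IZR k * h)).
destruct (Cdiff_sin_scaled h p) as [phi [Hp1 [Hp2 Hp3]]].
assert (Ep : (RtoC (PI / h) * p)%C = RtoC (IZR k * PI)).
{ unfold p; rewrite <- RtoC_mult; f_equal; field; lra. }
assert (Esin : Csin (RtoC (PI / h) * p) = 0).
{ now rewrite Ep, Csin_RtoC, (proj1 (sin_cos_IZR_PI k)). }
assert (Hphi : phi p = RtoC (PI / h * cos (IZR k * PI))).
{ now rewrite Hp2, Ep, Ccos_RtoC, RtoC_mult. }
assert (Hphi0 : phi p <> 0).
{ rewrite Hphi; intros H; apply RtoC_inj in H.
  pose proof (proj2 (sin_cos_IZR_PI k)) as Hc.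
  apply Rmult_integral in H; destruct H as [H|H].
  - assert (0 < PI / h) by (apply Rdiv_lt_0_compat; lra); lra.
  - rewrite H in Hc; lra. }
assert (Hxp : (p + - RtoC x)%C <> 0).
{ unfold p; intros H; apply Hx.
  replace (RtoC (IZR k * h) + - RtoC x)%C with (RtoC (IZR k * h - x)) in H by (rewrite RtoC_minus; ring).
  apply RtoC_inj in H; lra. }
assert (Hstrip : forall z, in_rect a b (- y) y z -> strip dd z).
{ intros z [_ Hz]; unfold strip; apply Rabs_def1; lra. }
set (g := (fun z => F z * / ((z + - RtoC x) * phi z))%C).
assert (Hden : Ccont (fun z => (z + - RtoC x) * phi z)%C p).
{ apply Ccont_mult; auto. apply Ccont_plus; [apply Ccont_id|apply Ccont_const]. }
replace (sinc_residue F h x k) with (g p).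
2: { unfold g, sinc_residue; rewrite Hphi; unfold p; now rewrite <- RtoC_opp, <- RtoC_plus. }
apply residue_rectangle.
- simpl; lra.
- simpl; lra.
- intros z Hz Hzp.
  destruct (HF z (Hstrip z Hz)) as [l Hl].
  apply (Cdiff_sinc_kernel F h x z l); auto.
  + intros ->; destruct Hz as [Hz _]; simpl in Hz; now apply Hx.
  + intros j ->; apply Hzp; unfold p; f_equal; f_equal; f_equal.
    destruct Hz as [Hz _]; simpl in Hz; apply IZR_between; split;
    apply (Rmult_lt_reg_r h); lra.
- destruct (HF p) as [l Hl].
  { unfold strip, p; simpl; rewrite Rabs_R0; lra. }
  apply Ccont_mult; [exact (Cdiff_cont _ _ _ Hl)|].
  apply (Ccont_inv (fun z => (z + - RtoC x) * phi z)%C); auto.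
  now apply Cmult_neq_0.
- pose proof (Ccont_neq_0 _ _ Hden (Cmult_neq_0 _ _ Hxp Hphi0)) as Hnz.
  generalize (Cnear_and _ _ _ Hp3 Hnz); apply Cnear_mono; intros z [E1 E2] Hz.
  unfold sinc_kernel, g; rewrite E1, Esin, Cplus_0_l.
  assert (z - p <> 0)%C by now apply Cminus_eq_contra.
  assert (phi z <> 0) by (intros E0; apply E2; rewrite E0; ring).
  assert (z + - RtoC x <> 0)%C by (intros E0; apply E2; rewrite E0; ring).
  field; repeat split; auto.
Qed.

Lemma oint_kernel_point F dd h x k a b y : 0 < h -> 0 < y < dd ->
  (forall z, strip dd z -> exists l, Cdiff F z l) ->
  IZR k * h < a -> a < x < b -> b < (IZR k + 1) * h ->
  oint (sinc_kernel F h x) a b (- y) y =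
  (2 * RtoC PI * Ci * (F (RtoC x) * / RtoC (sin (PI / h * x))))%C.
Proof.
intros Hh Hy HF Ha Hab Hb.
assert (Hno : forall j z, in_rect a b (- y) y z -> z <> RtoC (IZR j * h)).
{ intros j z [Hz _] ->; simpl in Hz.
  assert (k < j)%Z by (apply lt_IZR; apply (Rmult_lt_reg_r h); lra).
  assert (j < k + 1)%Z by (apply lt_IZR; rewrite plus_IZR; apply (Rmult_lt_reg_r h); lra).
  lia. }
assert (Hrx : in_rect a b (- y) y (RtoC x)) by (split; simpl; lra).
set (g := (fun z => F z * / Csin (RtoC (PI / h) * z))%C).
assert (Hs : Csin (RtoC (PI / h) * RtoC x) <> 0).
{ intros H; destruct (Csin_scaled_eq_0 h _ Hh H) as [j Hj]; now apply (Hno j (RtoC x)). }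
assert (Hsc : Ccont (fun z => Csin (RtoC (PI / h) * z)%C) (RtoC x)).
{ exact (Cdiff_cont _ _ _ (Cdiff_sin_scaled h (RtoC x))). }
replace (F (RtoC x) * / RtoC (sin (PI / h * x)))%C with (g (RtoC x))
  by (unfold g; now rewrite <- Csin_RtoC, RtoC_mult).
apply residue_rectangle.
- simpl; lra.
- simpl; lra.
- intros z Hz Hzx; destruct (HF z) as [l Hl].
  { destruct Hz as [_ Hz]; unfold strip; apply Rabs_def1; lra. }
  apply (Cdiff_sinc_kernel F h x z l); auto.
- destruct (HF (RtoC x)) as [l Hl].
  { unfold strip; simpl; rewrite Rabs_R0; lra. }
  apply Ccont_mult; [exact (Cdiff_cont _ _ _ Hl)|].
  apply (Ccont_inv (fun z => Csin (RtoC (PI / h) * z)%C)); auto.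
- generalize (Ccont_neq_0 _ _ Hsc Hs); apply Cnear_mono; intros z Hz Hzx.
  unfold sinc_kernel, g; field; split; auto; now apply Cminus_eq_contra.
Qed.

(** [sum_n u n] has n + 1 terms, so blocks ending at n and m have n + m + 2 terms together, the last
    of index n + m + 1. *)
Lemma sum_n_cat (u : nat -> C) n m :
  sum_n u (S (n + m)) = (sum_n u n + sum_n (fun j => u (S n + j)%nat) m)%C.
Proof.
induction m as [|m IH].
- rewrite Nat.add_0_r, sum_Sn, sum_O, Nat.add_0_r; reflexivity.
- rewrite Nat.add_succ_r, sum_Sn, IH, sum_Sn.
  replace (S n + S m)%nat with (S (S (n + m))) by lia.
  change (sum_n u n + sum_n (fun j => u (S n + j)%nat) m + u (S (S (n + m))) =
    sum_n u n + (sum_n (fun j => u (S n + j)%nat) m + u (S (S (n + m)))))%C.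
  ring.
Qed.

Lemma sum_n_Cmult_l (c : C) (u : nat -> C) n :
  sum_n (fun j => c * u j)%C n = (c * sum_n u n)%C.
Proof.
induction n as [|n IH].
- now rewrite !sum_O.
- rewrite !sum_Sn, IH.
  change (c * sum_n u n + c * u (S n) = c * (sum_n u n + u (S n)))%C; ring.
Qed.

(** Induction on the number of nodes: the last one is cut off at the midpoint before it. *)
Lemma oint_kernel_nodes F dd h x m J a b y : 0 < h -> 0 < y < dd ->
  (forall z, strip dd z -> exists l, Cdiff F z l) ->
  (IZR m - 1) * h < a -> a < IZR m * h ->
  IZR (m + Z.of_nat J) * h < b -> b < (IZR (m + Z.of_nat J) + 1) * h ->
  ~ (a <= x <= b) ->
  oint (sinc_kernel F h x) a b (- y) y =
  (2 * RtoC PI * Ci * sum_n (fun j => sinc_residue F h x (m + Z.of_nat j)) J)%C.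
Proof.
intros Hh Hy HF Ha1 Ha2; revert b; induction J as [|J IH]; intros b Hb1 Hb2 Hx.
- rewrite sum_O, Z.add_0_r in *.
  now apply (oint_kernel_node F dd).
- set (k := (m + Z.of_nat (S J))%Z) in *.
  assert (Ek : (m + Z.of_nat J = k - 1)%Z) by (unfold k; lia).
  rewrite Ek, minus_IZR in IH.
  set (c := (IZR k - / 2) * h).
  assert (Hac : a < c).
  { eapply Rlt_trans; [apply Ha2|].
    apply Rmult_lt_compat_r; auto.
    assert (IZR m <= IZR k - 1) by (rewrite <- minus_IZR; apply IZR_le; unfold k; lia). lra. }
  assert (Hcb : c < b).
  { eapply Rlt_trans; [|apply Hb1]; apply Rmult_lt_compat_r; lra. }
  rewrite (oint_split_h _ a c b); try lra.
  + assert (Ec : (IZR k - 1) * h < c /\ c < IZR k * h) by (unfold c; nra).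
    rewrite IH; [|lra|lra|intros [? ?]; apply Hx; lra].
    rewrite (oint_kernel_node F dd h x k); auto; [|lra|lra|intros [? ?]; apply Hx; lra].
    rewrite sum_Sn.
    change (plus (sum_n (fun j => sinc_residue F h x (m + Z.of_nat j)) J)
       (sinc_residue F h x (m + Z.of_nat (S J))))
     with (sum_n (fun j => sinc_residue F h x (m + Z.of_nat j)) J + sinc_residue F h x k)%C.
    ring.
  + intros z [[Z1 Z2] Z3].
    destruct (HF z) as [l Hl]; [unfold strip; apply Rabs_def1; lra|].
    destruct (Cdiff_sinc_kernel F h x z l) as [l' Hl']; auto.
    * intros ->; simpl in *; tauto.
    * intros j ->; simpl in *.
      destruct Z3 as [Z3|[Z3|Z3]]; [| |lra].
      -- assert (m - 1 < j)%Z by (apply lt_IZR; rewrite minus_IZR; apply (Rmult_lt_reg_r h); lra).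
         assert (j < m)%Z by (apply lt_IZR; apply (Rmult_lt_reg_r h); lra). lia.
      -- assert (k < j)%Z by (apply lt_IZR; apply (Rmult_lt_reg_r h); lra).
         assert (j < k + 1)%Z by (apply lt_IZR; rewrite plus_IZR; apply (Rmult_lt_reg_r h); lra). lia.
    * exact (Cdiff_cont _ _ _ Hl').
Qed.

Lemma floor_node h x : 0 < h -> (forall k, x <> IZR k * h) ->
  exists k, IZR k * h < x < (IZR k + 1) * h.
Proof.
(* [up] is the integer strictly above, so subtracting 1 gives the floor; equality on the left would
   make [x] a node. *)
intros Hh Hx; exists (up (x / h) - 1)%Z.
destruct (archimed (x / h)) as [H1 H2].
pose proof (Hx (up (x / h) - 1)%Z) as Hn.
rewrite minus_IZR in *.
assert (E : x / h * h = x) by (field; lra).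
set (u := IZR (up (x / h))) in *; set (w := x / h) in *.
rewrite <- E; rewrite <- E in Hn; split.
- destruct (Rle_lt_or_eq_dec (u - 1) w) as [H|H]; [lra|apply Rmult_lt_compat_r; lra|].
  exfalso; apply Hn; rewrite H; ring.
- apply Rmult_lt_compat_r; lra.
Qed.

(** Three pieces: the nodes -L, ..., k0 on the left of [x], the pole at [x], the nodes k0 + 1, ...,
    L. The cuts [c1], [c2] lie midway between [x] and its neighbouring nodes. *)
Lemma oint_kernel F dd h x k0 L y : 0 < h -> 0 < y < dd ->
  (forall z, strip dd z -> exists l, Cdiff F z l) ->
  IZR k0 * h < x < (IZR k0 + 1) * h ->
  (Z.abs k0 + 1 < Z.of_nat L)%Z ->
  oint (sinc_kernel F h x) (- ((INR L + / 2) * h)) ((INR L + / 2) * h) (- y) y =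
  (2 * RtoC PI * Ci * (F (RtoC x) * / RtoC (sin (PI / h * x)) + sumZ L L (sinc_residue F h x)))%C.
Proof.
intros Hh Hy HF Hx HL.
set (X := (INR L + / 2) * h).
set (c1 := (IZR k0 * h + x) / 2); set (c2 := (x + (IZR k0 + 1) * h) / 2).
assert (B1 : IZR k0 * h < c1 < x) by (unfold c1; lra).
assert (B2 : x < c2 < (IZR k0 + 1) * h) by (unfold c2; lra).
assert (Hk1 : IZR k0 <= INR L - 2).
{ rewrite INR_IZR_INZ, <- minus_IZR; apply IZR_le; lia. }
assert (Hk2 : - INR L + 2 <= IZR k0).
{ rewrite INR_IZR_INZ, <- opp_IZR, <- plus_IZR; apply IZR_le; lia. }
assert (Q1 : - X < IZR k0 * h) by (unfold X; nra).
assert (Q2 : (IZR k0 + 1) * h < X) by (unfold X; nra).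
(* A vertical side through a node would make an odd integer even. *)
assert (HXn : forall j, X <> IZR j * h /\ - X <> IZR j * h).
{ intros j; unfold X; rewrite INR_IZR_INZ; split; intros E.
  - assert (E1 : IZR (2 * Z.of_nat L + 1) = IZR (2 * j)).
    { rewrite plus_IZR, !mult_IZR; apply (Rmult_eq_reg_r h); lra. }
    apply eq_IZR in E1; lia.
  - assert (E1 : IZR (2 * Z.of_nat L + 1) = IZR (- 2 * j)).
    { rewrite plus_IZR, !mult_IZR; apply (Rmult_eq_reg_r h); lra. }
    apply eq_IZR in E1; lia. }
assert (Hcont : forall z, strip dd z -> z <> RtoC x -> (forall j, z <> RtoC (IZR j * h)) ->
  Ccont (sinc_kernel F h x) z).
{ intros z Hz Hzx Hzj; destruct (HF z Hz) as [l Hl].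
  destruct (Cdiff_sinc_kernel F h x z l) as [l' Hl']; auto.
  exact (Cdiff_cont _ _ _ Hl'). }
assert (Hnode : forall j t, IZR k0 * h < t < (IZR k0 + 1) * h -> t <> IZR j * h).
{ intros j t Ht ->.
  assert (k0 < j)%Z by (apply lt_IZR; apply (Rmult_lt_reg_r h); lra).
  assert (j < k0 + 1)%Z by (apply lt_IZR; rewrite plus_IZR; apply (Rmult_lt_reg_r h); lra). lia. }
rewrite (oint_split_h _ (- X) c1 X); try lra.
2: { intros z [[Z1 Z2] Z3]; apply Hcont; [unfold strip; apply Rabs_def1; lra| |].
  - intros ->; simpl in *; lra.
  - intros j ->; simpl in *; destruct (HXn j); lra. }
rewrite (oint_split_h _ c1 c2 X); try lra.
2: { intros z [[Z1 Z2] Z3]; apply Hcont; [unfold strip; apply Rabs_def1; lra| |].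
  - intros ->; simpl in *; lra.
  - intros j ->; simpl in *; destruct (HXn j); pose proof (Hnode j c1 ltac:(lra)); lra. }
rewrite (oint_kernel_point F dd h x k0 c1 c2 y); auto; try lra.
(* A block with last offset J holds J + 1 nodes: J1 + 1 and J2 + 1 add up to 2 L + 1. *)
set (J1 := Z.to_nat (k0 + Z.of_nat L)); set (J2 := Z.to_nat (Z.of_nat L - k0 - 1)).
assert (E1 : (- Z.of_nat L + Z.of_nat J1 = k0)%Z) by (unfold J1; lia).
assert (E2 : (k0 + 1 + Z.of_nat J2 = Z.of_nat L)%Z) by (unfold J2; lia).
rewrite (oint_kernel_nodes F dd h x (- Z.of_nat L) J1 (- X) c1 y); auto;
  try (rewrite ?E1, ?opp_IZR, <- ?INR_IZR_INZ; try unfold X; nra).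
rewrite (oint_kernel_nodes F dd h x (k0 + 1) J2 c2 X y); auto;
  try (rewrite ?E2, ?plus_IZR, <- ?INR_IZR_INZ; try unfold X; nra).
unfold sumZ; replace (L + L)%nat with (S (J1 + J2)) by lia.
rewrite sum_n_cat.
rewrite (sum_n_ext (fun j => sinc_residue F h x (Z.of_nat j - Z.of_nat L))
  (fun j => sinc_residue F h x (- Z.of_nat L + Z.of_nat j))) by (intros j; f_equal; lia).
rewrite (sum_n_ext (fun j => sinc_residue F h x (Z.of_nat (S J1 + j) - Z.of_nat L))
  (fun j => sinc_residue F h x (k0 + 1 + Z.of_nat j))) by (intros j; f_equal; lia).
ring.
Qed.

(** * The discretization error *)

Definition sinc_term (F : C -> C) (h x : R) (k : Z) : C :=
  (F (RtoC (IZR k * h)) * RtoC (sinc k h x))%C.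

Lemma sin_minus_IZR_PI a k : sin (a - IZR k * PI) = sin a * cos (IZR k * PI).
Proof. rewrite sin_minus, (proj1 (sin_cos_IZR_PI k)); ring. Qed.

(** The minus sign stems from kh - x in the residue against x / h - k in the sinc function; cos(k
    pi) moves from denominator to numerator because its square is 1. *)
Lemma sin_mult_sinc_residue F h x k : 0 < h -> x <> IZR k * h ->
  (RtoC (sin (PI / h * x)) * sinc_residue F h x k = - sinc_term F h x k)%C.
Proof.
intros Hh Hx; pose proof PI_RGT_0 as HPI.
unfold sinc_residue, sinc_term, sinc.
destruct (Req_EM_T x (IZR k * h)) as [H|_]; [contradiction|].
replace (PI * (x / h - IZR k)) with (PI / h * x - IZR k * PI) by (field; lra).
rewrite sin_minus_IZR_PI.
destruct (sin_cos_IZR_PI k) as [_ Hc].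
set (cc := cos (IZR k * PI)) in *.
assert (Hc0 : cc <> 0) by (intros H0; rewrite H0 in Hc; lra).
assert (Hd : IZR k * h - x <> 0) by lra.
assert (Hd2 : PI / h * x - IZR k * PI <> 0).
{ replace (PI / h * x - IZR k * PI) with (- (PI / h * (IZR k * h - x))) by (field; lra).
  apply Ropp_neq_0_compat, Rmult_integral_contrapositive_currified; auto.
  apply Rgt_not_eq, Rdiv_lt_0_compat; lra. }
assert (Hp0 : PI / h * cc <> 0).
{ apply Rmult_integral_contrapositive_currified; auto.
  apply Rgt_not_eq, Rdiv_lt_0_compat; lra. }
rewrite <- RtoC_mult, <- RtoC_inv by now apply Rmult_integral_contrapositive_currified.
replace (RtoC (sin (PI / h * x)) * (F (RtoC (IZR k * h)) * RtoC (/ ((IZR k * h - x) * (PI / h * cc)))))%C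
  with (F (RtoC (IZR k * h)) * RtoC (sin (PI / h * x) * / ((IZR k * h - x) * (PI / h * cc))))%C
  by (rewrite (RtoC_mult (sin (PI / h * x))); ring).
replace (- (F (RtoC (IZR k * h)) * RtoC (sin (PI / h * x) * cc / (PI / h * x - IZR k * PI))))%C
  with (F (RtoC (IZR k * h)) * RtoC (- (sin (PI / h * x) * cc / (PI / h * x - IZR k * PI))))%C
  by (rewrite RtoC_opp; ring).
f_equal; f_equal.
replace (/ ((IZR k * h - x) * (PI / h * cc))) with (cc / ((IZR k * h - x) * (PI / h * (cc * cc))))
  by (field; repeat split; auto; lra).
replace (PI / h * x - IZR k * PI) with (- (PI / h * (IZR k * h - x))) by (field; lra).
rewrite Hc; field; repeat split; auto; lra.
Qed.

Lemma sinc_error_oint F dd h x k0 L y : 0 < h -> 0 < y < dd ->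
  (forall z, strip dd z -> exists l, Cdiff F z l) ->
  IZR k0 * h < x < (IZR k0 + 1) * h -> (forall k, x <> IZR k * h) ->
  (Z.abs k0 + 1 < Z.of_nat L)%Z ->
  (2 * RtoC PI * Ci * (F (RtoC x) - sumZ L L (sinc_term F h x)) =
   RtoC (sin (PI / h * x)) *
   oint (sinc_kernel F h x) (- ((INR L + / 2) * h)) ((INR L + / 2) * h) (- y) y)%C.
Proof.
intros Hh Hy HF Hx Hn HL.
rewrite (oint_kernel F dd h x k0 L y) by auto.
assert (Hs : sin (PI / h * x) <> 0).
{ pose proof PI_RGT_0; intros H0; destruct (sin_eq_0_0 _ H0) as [k Hk].
  apply (Hn k); apply (Rmult_eq_reg_l (PI / h)).
  - rewrite Hk; field; lra.
  - apply Rgt_not_eq, Rdiv_lt_0_compat; lra. }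
assert (HsC : RtoC (sin (PI / h * x)) <> 0) by (intros E; now apply RtoC_inj in E).
assert (E : sumZ L L (sinc_term F h x) =
  (- (RtoC (sin (PI / h * x)) * sumZ L L (sinc_residue F h x)))%C).
{ unfold sumZ.
  rewrite (sum_n_ext (fun j => sinc_term F h x (Z.of_nat j - Z.of_nat L))
    (fun j => (- RtoC (sin (PI / h * x))) * sinc_residue F h x (Z.of_nat j - Z.of_nat L))%C).
  - rewrite sum_n_Cmult_l; ring.
  - intros j; replace (- RtoC (sin (PI / h * x)) * sinc_residue F h x (Z.of_nat j - Z.of_nat L))%C
     with (- (RtoC (sin (PI / h * x)) * sinc_residue F h x (Z.of_nat j - Z.of_nat L)))%C by ring.
    rewrite sin_mult_sinc_residue by auto.
    match goal with |- ?u = ?v => change (@eq C u v) end; ring. }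
rewrite E; field; auto.
Qed.

Lemma sinh_pos_lt y : 0 < y -> 0 < sinh y.
Proof. intros H; rewrite <- sinh_0; now apply sinh_lt. Qed.

Lemma Cmod_Csin_ge_sinh z : 0 <= Im z -> sinh (Im z) <= Cmod (Csin z).
Proof.
intros H; destruct z as [a b]; simpl in *.
apply Rsqr_incr_0_var; [|apply Cmod_ge_0].
unfold Rsqr; rewrite Cmod_sqr_Csin; pose proof (Rle_0_sqr (sin a)); unfold Rsqr in *; lra.
Qed.

Lemma Cmod_Csin_opp z : Cmod (Csin (- z)) = Cmod (Csin z).
Proof.
replace (Csin (- z)) with (- Csin z)%C; [apply Cmod_opp|].
unfold Csin; replace (Ci * - z)%C with (- (Ci * z))%C by ring.
replace (- - (Ci * z))%C with (Ci * z)%C by ring; field; apply Ci_nz.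
Qed.

Lemma Cmod_Csin_ge_sinh_abs z : sinh (Rabs (Im z)) <= Cmod (Csin z).
Proof.
destruct (Rle_dec 0 (Im z)) as [H|H].
- rewrite Rabs_pos_eq by auto; now apply Cmod_Csin_ge_sinh.
- rewrite Rabs_left by lra; rewrite <- Cmod_Csin_opp.
  apply (Cmod_Csin_ge_sinh (- z)); simpl; unfold Im in H; lra.
Qed.

Lemma Cmod_Csin_ge_sin z : Rabs (sin (Re z)) <= Cmod (Csin z).
Proof.
destruct z as [a b]; simpl.
apply Rsqr_incr_0_var; [|apply Cmod_ge_0].
rewrite <- Rsqr_abs.
unfold Rsqr; rewrite Cmod_sqr_Csin; pose proof (Rle_0_sqr (sinh b)); unfold Rsqr in *; lra.
Qed.

Lemma is_RInt_exp_scal k c a b : k <> 0 ->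
  is_RInt (fun t => c * exp (k * t)) a b (c / k * (exp (k * b) - exp (k * a))).
Proof.
intros Hk.
replace (c / k * (exp (k * b) - exp (k * a)))
  with (minus (c / k * exp (k * b)) (c / k * exp (k * a)))
  by (unfold minus, plus, opp; simpl; ring).
apply (is_RInt_derive (V := R_CompleteNormedModule) (fun t => c / k * exp (k * t))).
- intros t _; auto_derive; [auto|field; auto].
- intros t _; apply (ex_derive_continuous (V := R_NormedModule)); auto_derive; auto.
Qed.

(** The domain is a parameter because the bound is used with two constants: [A] on the strip for the
    contour, [K] on the real axis for the tails. *)
Definition decay_bound (F : C -> C) (D : C -> Prop) (A alpha beta : R) : Prop :=
  forall z, D z ->
    (Re z <= 0 -> Cmod (F z) <= A * exp (alpha * Re z)) /\
    (0 <= Re z -> Cmod (F z) <= A * exp (- beta * Re z)).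

(** Splitting at 0 and extending each exponential to infinity gives a bound uniform in [X]. *)
Lemma Cmod_hint_decay F y X A alpha beta :
  0 < alpha -> 0 < beta -> 0 <= A -> 0 <= X ->
  (forall t, - X <= t <= X -> Ccont F (t, y)) ->
  (forall t, t <= 0 -> Cmod (F (t, y)) <= A * exp (alpha * t)) ->
  (forall t, 0 <= t -> Cmod (F (t, y)) <= A * exp (- beta * t)) ->
  Cmod (hint F y (- X) X) <= A * (/ alpha + / beta).
Proof.
intros Ha Hb HA HX Hc H1 H2.
rewrite (hint_Chasles F y (- X) 0 X) by (auto; lra).
eapply Rle_trans; [apply Cmod_triangle|].
rewrite Rmult_plus_distr_l; apply Rplus_le_compat.
- eapply Rle_trans.
  + apply (Cmod_hint_le_RInt F y (- X) 0 (fun t => A * exp (alpha * t))); try lra.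
    * intros; apply Hc; lra.
    * intros; apply H1; lra.
    * eexists; apply is_RInt_exp_scal; lra.
  + rewrite (is_RInt_unique _ _ _ _ (is_RInt_exp_scal alpha A (- X) 0 ltac:(lra))).
    rewrite Rmult_0_r, exp_0.
    unfold Rdiv; rewrite Rmult_assoc; apply Rmult_le_compat_l; auto.
    assert (0 < / alpha) by now apply Rinv_0_lt_compat.
    pose proof (exp_pos (alpha * - X)); nra.
- eapply Rle_trans.
  + apply (Cmod_hint_le_RInt F y 0 X (fun t => A * exp (- beta * t))); try lra.
    * intros; apply Hc; lra.
    * intros; apply H2; lra.
    * eexists; apply is_RInt_exp_scal; lra.
  + rewrite (is_RInt_unique _ _ _ _ (is_RInt_exp_scal (- beta) A 0 X ltac:(lra))).
    rewrite Rmult_0_r, exp_0.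
    replace (A / - beta * (exp (- beta * X) - 1)) with (A * (/ beta * (1 - exp (- beta * X))))
      by (field; lra).
    apply Rmult_le_compat_l; auto.
    assert (0 < / beta) by now apply Rinv_0_lt_compat.
    pose proof (exp_pos (- beta * X)); nra.
Qed.

Lemma Cmod_div_le (u v : C) m n : 0 < n -> Cmod u <= m -> n <= Cmod v ->
  Cmod (u * / v) <= m * / n.
Proof.
intros Hn Hu Hv.
assert (Hv0 : v <> 0) by (apply Cmod_gt_0; lra).
rewrite Cmod_mult, Cmod_inv by auto.
apply Rmult_le_compat; auto; try apply Cmod_ge_0.
- apply Rlt_le, Rinv_0_lt_compat; lra.
- apply Rinv_le_contravar; auto.
Qed.

Lemma sin_half_odd_abs L : Rabs (sin ((INR L + / 2) * PI)) = 1.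
Proof.
replace ((INR L + / 2) * PI) with (PI / 2 - - (IZR (Z.of_nat L) * PI)) by (rewrite <- INR_IZR_INZ; field).
rewrite sin_shift.
replace (cos (- (IZR (Z.of_nat L) * PI))) with (cos (IZR (Z.of_nat L) * PI)) by now rewrite cos_neg.
destruct (sin_cos_IZR_PI (Z.of_nat L)) as [_ Hc].
unfold Rabs; destruct Rcase_abs; nra.
Qed.

(** The condition on [x] gives |z - x| >= 1 on the vertical sides. Only the terms of these sides
    depend on [L], and they vanish as [L] grows. *)
Lemma Cmod_oint_kernel_le F dd h x L y A alpha beta :
  0 < h -> 0 < y < dd -> 0 < alpha -> 0 < beta -> 0 <= A ->
  (forall z, strip dd z -> exists l, Cdiff F z l) ->
  decay_bound F (strip dd) A alpha beta ->
  Rabs x + 1 <= (INR L + / 2) * h ->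
  Cmod (oint (sinc_kernel F h x) (- ((INR L + / 2) * h)) ((INR L + / 2) * h) (- y) y) <=
  2 * (A * / (y * sinh (PI / h * y)) * (/ alpha + / beta)) +
  2 * y * A * (exp (- alpha * ((INR L + / 2) * h)) + exp (- beta * ((INR L + / 2) * h))).
Proof.
intros Hh Hy Ha Hb HA HF Hd HL.
set (X := (INR L + / 2) * h) in *.
pose proof (Rabs_pos x) as Px.
pose proof PI_RGT_0 as HPI.
pose proof (Rle_abs x) as Px1; pose proof (Rle_abs (- x)) as Px2; rewrite Rabs_Ropp in Px2.
assert (Hsh : 0 < sinh (PI / h * y)).
{ apply sinh_pos_lt, Rmult_lt_0_compat; [apply Rdiv_lt_0_compat|]; lra. }
assert (Hden0 : 0 < y * sinh (PI / h * y)) by (apply Rmult_lt_0_compat; lra).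
assert (Hden : forall z, Rabs (Im z) = y ->
  y * sinh (PI / h * y) <= Cmod ((z + - RtoC x) * Csin (RtoC (PI / h) * z))).
{ intros z Hz; rewrite Cmod_mult; apply Rmult_le_compat; try lra.
  - rewrite <- Hz; pose proof (Rabs_Im_le (z + - RtoC x)) as H.
    replace (Im (z + - RtoC x)) with (Im z) in H by (destruct z; simpl; ring). auto.
  - pose proof (Cmod_Csin_ge_sinh_abs (RtoC (PI / h) * z)) as H.
    replace (Im (RtoC (PI / h) * z)) with (PI / h * Im z) in H by (destruct z; simpl; ring).
    rewrite Rabs_mult, Hz, Rabs_pos_eq in H; auto.
    apply Rlt_le, Rdiv_lt_0_compat; lra. }
assert (HdenV : forall z, Rabs (Re z) = X ->
  1 <= Cmod ((z + - RtoC x) * Csin (RtoC (PI / h) * z))).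
{ intros z Hz; rewrite Cmod_mult, <- (Rmult_1_l 1); apply Rmult_le_compat; try lra.
  - pose proof (Rabs_Re_le (z + - RtoC x)) as H.
    replace (Re (z + - RtoC x)) with (Re z - x) in H by (destruct z; simpl; ring).
    pose proof (Rabs_triang_inv (Re z) x); lra.
  - pose proof (Cmod_Csin_ge_sin (RtoC (PI / h) * z)) as H.
    replace (Re (RtoC (PI / h) * z)) with (PI / h * Re z) in H by (destruct z; simpl; ring).
    assert (E : Rabs (sin (PI / h * Re z)) = 1); [|lra].
    rewrite <- (sin_half_odd_abs L).
    replace ((INR L + / 2) * PI) with (PI / h * X) by (unfold X; field; lra).
    unfold Rabs in Hz; destruct (Rcase_abs (Re z)) as [Hn|Hn].
    + replace (Re z) with (- X) by lra.
      replace (PI / h * - X) with (- (PI / h * X)) by ring.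
      now rewrite sin_neg, Rabs_Ropp.
    + now rewrite Hz. }
assert (Hcont : forall z, strip dd z -> Rabs (Im z) = y \/ Rabs (Re z) = X -> Ccont (sinc_kernel F h x) z).
{ intros z Hz HH; destruct (HF z Hz) as [l Hl].
  apply Ccont_mult; [exact (Cdiff_cont _ _ _ Hl)|].
  apply (Ccont_inv (fun z => (z + - RtoC x) * Csin (RtoC (PI / h) * z))%C).
  - apply Ccont_mult; [apply Ccont_plus; [apply Ccont_id|apply Ccont_const]|].
    exact (Cdiff_cont _ _ _ (Cdiff_sin_scaled h z)).
  - apply Cmod_gt_0; destruct HH as [HH|HH]; [specialize (Hden z HH)|specialize (HdenV z HH)].
    + assert (0 < y * sinh (PI / h * y)) by (apply Rmult_lt_0_compat; lra). lra.
    + lra. }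
assert (HA' : 0 <= A * / (y * sinh (PI / h * y))).
{ apply Rmult_le_pos; auto; apply Rlt_le, Rinv_0_lt_compat, Rmult_lt_0_compat; lra. }
(* The kernel inherits the decay of [F], with [A] divided by the lower bound of the denominator. *)
assert (HH : forall v, Rabs v = y -> Cmod (hint (sinc_kernel F h x) v (- X) X) <=
   A * / (y * sinh (PI / h * y)) * (/ alpha + / beta)).
{ intros v Hv.
  assert (Hst : forall t, strip dd (t, v)) by (intros t; unfold strip; simpl; lra).
  apply Cmod_hint_decay; auto; try lra.
  - intros t Ht; destruct (Hd (t, v) (Hst t)) as [D _]; simpl in D.
    specialize (D Ht); unfold sinc_kernel.
    eapply Rle_trans; [apply (Cmod_div_le _ _ _ _ Hden0 D (Hden (t, v) Hv))|].
    right; ring.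
  - intros t Ht; destruct (Hd (t, v) (Hst t)) as [_ D]; simpl in D.
    specialize (D Ht); unfold sinc_kernel.
    eapply Rle_trans; [apply (Cmod_div_le _ _ _ _ Hden0 D (Hden (t, v) Hv))|].
    right; ring. }
assert (HX : 0 < X) by lra.
assert (Hst : forall u t, - y <= t <= y -> strip dd (u, t)).
{ intros u t Ht; unfold strip; simpl; apply Rabs_def1; lra. }
assert (V1 : Cmod (vint (sinc_kernel F h x) (- X) (- y) y) <= 2 * y * A * exp (- alpha * X)).
{ replace (2 * y * A * exp (- alpha * X)) with ((y - - y) * (A * exp (- alpha * X) * / 1)) by field.
  apply Cmod_vint_le_const; try lra.
  - intros t Ht; apply Hcont; auto; right; simpl; rewrite Rabs_Ropp; apply Rabs_pos_eq; lra.
  - intros t Ht; destruct (Hd (- X, t) (Hst _ _ Ht)) as [D _]; simpl in D.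
    apply Cmod_div_le; [lra| |].
    + replace (- alpha * X) with (alpha * - X) by ring; apply D; lra.
    + apply HdenV; simpl; rewrite Rabs_Ropp; apply Rabs_pos_eq; lra. }
assert (V2 : Cmod (vint (sinc_kernel F h x) X (- y) y) <= 2 * y * A * exp (- beta * X)).
{ replace (2 * y * A * exp (- beta * X)) with ((y - - y) * (A * exp (- beta * X) * / 1)) by field.
  apply Cmod_vint_le_const; try lra.
  - intros t Ht; apply Hcont; auto; right; simpl; apply Rabs_pos_eq; lra.
  - intros t Ht; destruct (Hd (X, t) (Hst _ _ Ht)) as [_ D]; simpl in D.
    apply Cmod_div_le; [lra| |].
    + apply D; lra.
    + apply HdenV; simpl; apply Rabs_pos_eq; lra. }
eapply Rle_trans; [apply Cmod_oint_le_triangle|].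
assert (H1 := HH (- y)); assert (H2 := HH y).
rewrite Rabs_Ropp, Rabs_pos_eq in H1 by lra; rewrite Rabs_pos_eq in H2 by lra.
specialize (H1 eq_refl); specialize (H2 eq_refl); lra.
Qed.

(** * The truncation error and the limit *)

Lemma sinc_node h k : sinc k h (IZR k * h) = 1.
Proof. unfold sinc; now destruct Req_EM_T. Qed.

Lemma sinc_other_node h k j : 0 < h -> j <> k -> sinc k h (IZR j * h) = 0.
Proof.
intros Hh Hjk; unfold sinc; destruct Req_EM_T as [H|H].
- exfalso; apply Hjk, eq_IZR, (Rmult_eq_reg_r h); lra.
- replace (PI * (IZR j * h / h - IZR k)) with (IZR (j - k) * PI)
    by (rewrite minus_IZR; field; lra).
  rewrite (proj1 (sin_cos_IZR_PI (j - k))); unfold Rdiv; ring.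
Qed.

Lemma Rabs_sin_le x : Rabs (sin x) <= Rabs x.
Proof.
assert (H : forall x, 0 <= x -> Rabs (sin x) <= x).
{ intros u Hu; destruct (Req_dec u 0) as [->|Hn]; [rewrite sin_0, Rabs_R0; lra|].
  destruct (Rle_dec u 1) as [H1|H1].
  - rewrite Rabs_pos_eq.
    + apply Rlt_le, sin_lt_x; lra.
    + apply sin_ge_0; [lra|]. pose proof PI2_1; lra.
  - pose proof (SIN_bound u); apply Rle_trans with 1; [apply Rabs_le; lra|lra]. }
destruct (Rle_dec 0 x) as [Hx|Hx].
- rewrite (Rabs_pos_eq x) by auto; auto.
- rewrite <- (Rabs_Ropp (sin x)), <- sin_neg, <- (Rabs_Ropp x), (Rabs_pos_eq (- x)) by lra.
  apply H; lra.
Qed.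

Lemma Rabs_sinc_le_1 k h x : 0 < h -> Rabs (sinc k h x) <= 1.
Proof.
intros Hh; unfold sinc; destruct Req_EM_T as [H|H]; [rewrite Rabs_R1; lra|].
set (u := PI * (x / h - IZR k)).
assert (Hu : u <> 0).
{ unfold u; pose proof PI_RGT_0; apply Rmult_integral_contrapositive_currified; [lra|].
  intros E; apply H.
  replace x with (x / h * h) by (field; lra).
  replace (x / h) with (IZR k) by lra; auto. }
assert (0 < Rabs u) by now apply Rabs_pos_lt.
rewrite Rabs_div by auto; apply Rle_div_l; [auto|].
rewrite Rmult_1_l; apply Rabs_sin_le.
Qed.

Lemma sum_n_eq_0 (u : nat -> C) n : (forall j, (j <= n)%nat -> u j = 0) -> sum_n u n = RtoC 0.
Proof.
intros H; induction n as [|n IH].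
- rewrite sum_O; auto.
- rewrite sum_Sn, IH, H by auto; change (0 + 0 = 0)%C; ring.
Qed.

Lemma sum_n_single (u : nat -> C) n k : (k <= n)%nat ->
  (forall j, (j <= n)%nat -> j <> k -> u j = 0) -> sum_n u n = u k.
Proof.
intros Hk H; induction n as [|n IH].
- replace k with O by lia; now rewrite sum_O.
- rewrite sum_Sn; destruct (Nat.eq_dec k (S n)) as [->|Hn].
  + rewrite sum_n_eq_0 by (intros; apply H; lia).
    change (0 + u (S n) = u (S n))%C; ring.
  + rewrite IH by (try lia; intros; apply H; lia).
    rewrite (H (S n)) by lia. change (u k + 0 = u k)%C; ring.
Qed.

(** At a node the denominator of the kernel has a double zero and the residue computation does not
    apply; there the sum reproduces [F] exactly. *)
Lemma sumZ_node F h k L : 0 < h -> (Z.abs k <= Z.of_nat L)%Z ->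
  sumZ L L (sinc_term F h (IZR k * h)) = F (RtoC (IZR k * h)).
Proof.
intros Hh Hk; unfold sumZ.
rewrite (sum_n_single _ _ (Z.to_nat (k + Z.of_nat L))); [|lia|].
- replace (Z.of_nat (Z.to_nat (k + Z.of_nat L)) - Z.of_nat L)%Z with k by lia.
  unfold sinc_term; rewrite sinc_node; ring.
- intros j Hj Hjk; unfold sinc_term.
  rewrite sinc_other_node by (auto; lia); ring.
Qed.

(** Crude decay, enough to name an [L] beyond which the vertical sides are negligible. *)
Lemma exp_neg_le_inv u : 0 < u -> exp (- u) <= / u.
Proof.
intros Hu; rewrite exp_Ropp; apply Rinv_le_contravar; auto.
pose proof (exp_ineq1 u ltac:(lra)); lra.
Qed.

Lemma exists_nat_mult_ge h b : 0 < h -> exists n, b <= INR n * h.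
Proof.
intros Hh; destruct (INR_archimed h b Hh) as [n Hn]; exists n; lra.
Qed.

Lemma discretization_error_eventually F dd h x y A alpha beta eps :
  0 < h -> 0 < y < dd -> 0 < alpha -> 0 < beta -> 0 <= A -> 0 < eps ->
  (forall z, strip dd z -> exists l, Cdiff F z l) ->
  decay_bound F (strip dd) A alpha beta ->
  exists L0, forall L, (L0 <= L)%nat ->
    Cmod (F (RtoC x) - sumZ L L (sinc_term F h x)) <=
    A * (/ alpha + / beta) * / (PI * (y * sinh (PI / h * y))) + eps.
Proof.
intros Hh Hy Ha Hb HA He HF Hd.
pose proof PI_RGT_0 as HPI.
assert (Hia : 0 < / alpha) by now apply Rinv_0_lt_compat.
assert (Hib : 0 < / beta) by now apply Rinv_0_lt_compat.
assert (Hsh : 0 < sinh (PI / h * y)).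
{ apply sinh_pos_lt, Rmult_lt_0_compat; [apply Rdiv_lt_0_compat|]; lra. }
assert (Hq : 0 <= A * (/ alpha + / beta) * / (PI * (y * sinh (PI / h * y)))).
{ apply Rmult_le_pos; [apply Rmult_le_pos; lra|].
  apply Rlt_le, Rinv_0_lt_compat, Rmult_lt_0_compat, Rmult_lt_0_compat; lra. }
destruct (classic (exists k, x = IZR k * h)) as [[k ->]|Hno].
- exists (Z.to_nat (Z.abs k)); intros L HL.
  rewrite sumZ_node by (auto; lia).
  rewrite Cmod_minus_diag; lra.
- assert (Hno' : forall k, x <> IZR k * h) by (intros k E; apply Hno; now exists k).
  destruct (floor_node h x Hh Hno') as [k0 Hk0].
  (* [n1] secures the distance from [x] to the vertical sides; past [n2] these sides contribute at
     most [eps] after division by 2 PI. *)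
  destruct (exists_nat_mult_ge h (Rabs x + 1) Hh) as [n1 Hn1].
  destruct (exists_nat_mult_ge h (y * A * (/ alpha + / beta) / (PI * eps)) Hh) as [n2 Hn2].
  exists (n1 + n2 + Z.to_nat (Z.abs k0 + 2))%nat; intros L HL.
  assert (HLh : INR n1 * h <= INR L * h /\ INR n2 * h <= INR L * h).
  { split; apply Rmult_le_compat_r; try lra; apply le_INR; lia. }
  set (X := (INR L + / 2) * h).
  assert (HX : INR L * h < X) by (unfold X; lra).
  pose proof (Rabs_pos x).
  pose proof (sinc_error_oint F dd h x k0 L y Hh Hy HF Hk0 Hno' ltac:(lia)) as E.
  pose proof (Cmod_oint_kernel_le F dd h x L y A alpha beta Hh Hy Ha Hb HA HF Hd
    ltac:(fold X; lra)) as B.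
  fold X in E, B.
  apply (f_equal Cmod) in E; rewrite !Cmod_mult, Cmod_Ci, !Cmod_R in E.
  rewrite (Rabs_pos_eq 2), (Rabs_pos_eq PI) in E by lra.
  set (err := Cmod (F (RtoC x) - sumZ L L (sinc_term F h x))) in *.
  set (O := Cmod (oint (sinc_kernel F h x) (- X) X (- y) y)) in *.
  assert (HO : 0 <= O) by apply Cmod_ge_0.
  assert (Hs1 : Rabs (sin (PI / h * x)) <= 1).
  { pose proof (SIN_bound (PI / h * x)); apply Rabs_le; lra. }
  assert (E2 : 2 * PI * err <= O).
  { replace (2 * PI * err) with (2 * PI * 1 * err) by ring; rewrite E.
    rewrite <- (Rmult_1_l O) at 2; apply Rmult_le_compat_r; auto. }
  assert (HXe : y * A * (/ alpha + / beta) <= X * (PI * eps)).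
  { apply Rle_div_l; [apply Rmult_lt_0_compat|]; lra. }
  assert (HX0 : 0 < X) by lra.
  assert (T1 : exp (- alpha * X) <= / alpha * / X).
  { rewrite <- Rinv_mult. replace (- alpha * X) with (- (alpha * X)) by ring.
    apply exp_neg_le_inv, Rmult_lt_0_compat; auto. }
  assert (T2 : exp (- beta * X) <= / beta * / X).
  { rewrite <- Rinv_mult. replace (- beta * X) with (- (beta * X)) by ring.
    apply exp_neg_le_inv, Rmult_lt_0_compat; auto. }
  assert (HyA : 0 <= y * A) by (apply Rmult_le_pos; lra).
  assert (T3 : y * A * (exp (- alpha * X) + exp (- beta * X)) <= PI * eps).
  { apply Rle_trans with (y * A * (/ alpha + / beta) * / X).
    - rewrite (Rmult_assoc (y * A)); apply Rmult_le_compat_l; auto; lra.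
    - apply (Rle_div_l (y * A * (/ alpha + / beta)) (PI * eps) X); auto; lra. }
  apply (Rmult_le_reg_l (2 * PI)); [lra|].
  eapply Rle_trans; [apply E2|]; eapply Rle_trans; [apply B|].
  rewrite (Rmult_plus_distr_l (2 * PI)).
  apply Rplus_le_compat; [|lra].
  right; field; repeat split; lra.
Qed.

Lemma Cmod_sum_n_telescope (u : nat -> C) (c : nat -> R) n :
  (forall j, (j <= n)%nat -> Cmod (u j) <= c (S j) - c j) ->
  Cmod (sum_n u n) <= c (S n) - c O.
Proof.
induction n as [|n IH]; intros H.
- rewrite sum_O; apply H; lia.
- rewrite sum_Sn.
  change (Cmod (sum_n u n + u (S n)) <= c (S (S n)) - c O).
  eapply Rle_trans; [apply Cmod_triangle|].
  specialize (IH ltac:(intros; apply H; lia)).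
  specialize (H (S n) ltac:(lia)); lra.
Qed.

Lemma Cmod_sinc_term_le F h x k B : 0 < h -> Cmod (F (RtoC (IZR k * h))) <= B ->
  Cmod (sinc_term F h x k) <= B.
Proof.
intros Hh HB; unfold sinc_term; rewrite Cmod_mult, Cmod_R.
pose proof (Rabs_sinc_le_1 k h x Hh); pose proof (Rabs_pos (sinc k h x)).
pose proof (Cmod_ge_0 (F (RtoC (IZR k * h)))); nra.
Qed.

(* Makes the geometric tails telescope. *)
Lemma exp_le_diff s u : 0 < u -> exp s <= (exp (s + u) - exp s) * / u.
Proof.
intros Hu; rewrite exp_plus.
pose proof (exp_ineq1 u ltac:(lra)); pose proof (exp_pos s).
apply Rle_div_r; [auto|]; nra.
Qed.

(** Each tail telescopes under an exponential primitive, as in an integral comparison. The first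
    omitted index on the left is -(M + 1), so the telescope ends at -M, which gives exp(-alpha M h)
    / (alpha h) in place of a quotient by 1 - exp(-alpha h). *)
Lemma truncation_error F h x K alpha beta M N L :
  0 < h -> 0 < alpha -> 0 < beta -> 0 <= K ->
  decay_bound F (fun z => Im z = 0) K alpha beta ->
  (M < L)%nat -> (N < L)%nat ->
  Cmod (sumZ L L (sinc_term F h x) - sumZ M N (sinc_term F h x)) <=
  K * (exp (- alpha * (INR M * h)) * / (alpha * h) + exp (- beta * (INR N * h)) * / (beta * h)).
Proof.
intros Hh Ha Hb HK Hd HM HN.
assert (Hah : 0 < alpha * h) by now apply Rmult_lt_0_compat.
assert (Hbh : 0 < beta * h) by now apply Rmult_lt_0_compat.
assert (Hiah : 0 < / (alpha * h)) by now apply Rinv_0_lt_compat.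
assert (Hibh : 0 < / (beta * h)) by now apply Rinv_0_lt_compat.
set (u := sinc_term F h x).
(* The last offsets in the outer blocks, which have L - M and L - N terms. *)
set (n1 := (L - M - 1)%nat); set (n3 := (L - N - 1)%nat).
assert (E : sumZ L L u = (sum_n (fun j => u (Z.of_nat j - Z.of_nat L)%Z) n1 +
  (sumZ M N u + sum_n (fun j => u (Z.of_nat N + 1 + Z.of_nat j)%Z) n3))%C).
{ unfold sumZ; replace (L + L)%nat with (S (n1 + S (M + N + n3))) by (unfold n1, n3; lia).
  rewrite sum_n_cat, (sum_n_cat _ (M + N) n3).
  f_equal; f_equal.
  - apply sum_n_ext; intros j; f_equal; unfold n1; lia.
  - apply sum_n_ext; intros j; f_equal; unfold n1; lia. }
rewrite E.
match goal with |- Cmod (?a + (?b + ?c) - ?b) <= _ => replace (a + (b + c) - b)%C with (a + c)%C by ring end.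
eapply Rle_trans; [apply Cmod_triangle|].
rewrite Rmult_plus_distr_l; apply Rplus_le_compat.
- eapply Rle_trans.
  + apply (Cmod_sum_n_telescope _
      (fun j => K * (exp (alpha * (IZR (Z.of_nat j - Z.of_nat L) * h)) * / (alpha * h)))).
    intros j Hj; apply Cmod_sinc_term_le; auto.
    destruct (Hd (RtoC (IZR (Z.of_nat j - Z.of_nat L) * h)) eq_refl) as [D _]; simpl in D.
    assert (Hneg : IZR (Z.of_nat j - Z.of_nat L) <= 0) by (apply IZR_le; unfold n1 in Hj; lia).
    eapply Rle_trans; [apply D; nra|].
    rewrite <- Rmult_minus_distr_l; apply Rmult_le_compat_l; auto.
    rewrite <- Rmult_minus_distr_r.
    replace (alpha * (IZR (Z.of_nat (S j) - Z.of_nat L) * h))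
      with (alpha * (IZR (Z.of_nat j - Z.of_nat L) * h) + alpha * h).
    * now apply exp_le_diff.
    * replace (Z.of_nat (S j) - Z.of_nat L)%Z with (Z.of_nat j - Z.of_nat L + 1)%Z by lia.
      rewrite plus_IZR; ring.
  + cbv beta.
    replace (Z.of_nat (S n1) - Z.of_nat L)%Z with (- Z.of_nat M)%Z by (unfold n1; lia).
    rewrite opp_IZR, <- INR_IZR_INZ.
    replace (alpha * (- INR M * h)) with (- alpha * (INR M * h)) by ring.
    match goal with |- _ - ?a <= _ => assert (0 <= a); [|lra] end.
    apply Rmult_le_pos; auto; apply Rmult_le_pos; [apply Rlt_le, exp_pos|lra].
- eapply Rle_trans.
  (* On the right the exponentials decrease, so the increasing telescope carries a minus sign; it
     starts at N, one index before the first omitted term. *)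
  + apply (Cmod_sum_n_telescope _
      (fun j => - (K * (exp (- beta * (IZR (Z.of_nat N + Z.of_nat j) * h)) * / (beta * h))))).
    intros j Hj; apply Cmod_sinc_term_le; auto.
    destruct (Hd (RtoC (IZR (Z.of_nat N + 1 + Z.of_nat j) * h)) eq_refl) as [_ D]; simpl in D.
    assert (Hpos : 0 <= IZR (Z.of_nat N + 1 + Z.of_nat j)) by (apply IZR_le; lia).
    eapply Rle_trans; [apply D; nra|].
    replace (Z.of_nat N + Z.of_nat (S j))%Z with (Z.of_nat N + 1 + Z.of_nat j)%Z by lia.
    match goal with |- _ <= - (K * ?p) - - (K * ?q) =>
      replace (- (K * p) - - (K * q)) with (K * (q - p)) by ring end.
    apply Rmult_le_compat_l; auto.
    rewrite <- Rmult_minus_distr_r.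
    replace (- beta * (IZR (Z.of_nat N + Z.of_nat j) * h))
      with (- beta * (IZR (Z.of_nat N + 1 + Z.of_nat j) * h) + beta * h).
    * now apply exp_le_diff.
    * rewrite !plus_IZR; ring.
  + cbv beta.
    rewrite Z.add_0_r, <- INR_IZR_INZ.
    match goal with |- - ?a - _ <= _ => assert (0 <= a); [|lra] end.
    apply Rmult_le_pos; auto; apply Rmult_le_pos; [apply Rlt_le, exp_pos|lra].
Qed.

Lemma le_of_left_limit (phi : R -> R) c d : 0 < d -> continuous phi d ->
  (forall y, 0 < y < d -> phi y <= c) -> phi d <= c.
Proof.
intros Hd Hphi H; apply Rnot_lt_le; intros Hlt.
assert (He : 0 < phi d - c) by lra.
destruct (proj1 (filterlim_locally phi (phi d)) Hphi (mkposreal _ He)) as [del Hdel].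
set (y := d - Rmin (del / 2) (d / 2)).
assert (Hm : 0 < Rmin (del / 2) (d / 2)) by (apply Rmin_pos; destruct del; simpl; lra).
assert (Hm1 : Rmin (del / 2) (d / 2) <= del / 2) by apply Rmin_l.
assert (Hm2 : Rmin (del / 2) (d / 2) <= d / 2) by apply Rmin_r.
assert (Hb : Rabs (phi y - phi d) < phi d - c).
{ apply (Hdel y); change (Rabs (y - d) < del); unfold y.
  replace (d - Rmin (del / 2) (d / 2) - d) with (- Rmin (del / 2) (d / 2)) by ring.
  rewrite Rabs_Ropp, Rabs_pos_eq by lra; destruct del; simpl in *; lra. }
apply Rabs_def2 in Hb.
specialize (H y ltac:(unfold y; lra)); lra.
Qed.

Theorem sinc_approximation_error F d h x A K alpha beta M N :
  0 < d -> 0 < h -> 0 < alpha -> 0 < beta -> 0 <= A -> 0 <= K ->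
  (forall z, strip d z -> exists l, Cdiff F z l) ->
  decay_bound F (strip d) A alpha beta ->
  decay_bound F (fun z => Im z = 0) K alpha beta ->
  Cmod (F (RtoC x) - sumZ M N (sinc_term F h x)) <=
  A * (/ alpha + / beta) * / (PI * (d * sinh (PI / h * d))) +
  K * (exp (- alpha * (INR M * h)) * / (alpha * h) + exp (- beta * (INR N * h)) * / (beta * h)).
Proof.
intros Hd0 Hh Ha Hb HA HK HF HdA HdK.
pose proof PI_RGT_0 as HPI.
assert (Hpos : forall y, 0 < y -> 0 < PI * (y * sinh (PI / h * y))).
{ intros y Hy; apply Rmult_lt_0_compat, Rmult_lt_0_compat; auto.
  apply sinh_pos_lt, Rmult_lt_0_compat; auto; apply Rdiv_lt_0_compat; lra. }
set (err := Cmod (F (RtoC x) - sumZ M N (sinc_term F h x))).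
set (T := K * _).
assert (H1 : forall y, 0 < y < d -> err - T <= A * (/ alpha + / beta) * / (PI * (y * sinh (PI / h * y)))).
{ intros y Hy; apply Rnot_lt_le; intros Hlt.
  match type of Hlt with ?q < _ => set (Q := q) in * end.
  (* Half of the supposed gap serves as [eps]. *)
  destruct (discretization_error_eventually F d h x y A alpha beta ((err - T - Q) / 2))
    as [L0 HL0]; auto; [lra|].
  fold Q in HL0.
  set (L := (L0 + S M + S N)%nat).
  specialize (HL0 L ltac:(unfold L; lia)).
  pose proof (truncation_error F h x K alpha beta M N L Hh Ha Hb HK HdK
    ltac:(unfold L; lia) ltac:(unfold L; lia)) as HT; fold T in HT.
  pose proof (Cmod_triangle (F (RtoC x) - sumZ L L (sinc_term F h x))
    (sumZ L L (sinc_term F h x) - sumZ M N (sinc_term F h x))) as Tr.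
  match type of Tr with Cmod ?w <= _ =>
    replace w with (F (RtoC x) - sumZ M N (sinc_term F h x))%C in Tr by ring end.
  fold err in Tr; lra. }
(* Cleared of the denominator, the left side is differentiable in y, so its bound at [d] follows
   from those below. *)
assert (H2 : (err - T) * (PI * (d * sinh (PI / h * d))) <= A * (/ alpha + / beta)).
{ apply (le_of_left_limit (fun y => (err - T) * (PI * (y * sinh (PI / h * y))))); auto.
  - apply (ex_derive_continuous (V := R_NormedModule)).
    unfold sinh; auto_derive; auto.
  - intros y Hy; apply Rle_div_r; [now apply Hpos|now apply H1]. }
apply Rle_div_r in H2; [|now apply Hpos].
unfold Rdiv in H2; lra.
Qed.

(** * The two conformal maps *)

Lemma Re_Cexp_pos z : Rabs (Im z) < PI / 2 -> 0 < Re (Cexp z).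
Proof.
intros H; apply Rabs_def2 in H; unfold Cexp; simpl.
apply Rmult_lt_0_compat; [apply exp_pos|apply cos_gt_0; lra].
Qed.

(** The imaginary part of w^2 is 2 Re w Im w: if it vanishes, [w] is a positive real. *)
Lemma slit_1_plus_sqr w : 0 < Re w -> slit (1 + w * w).
Proof.
destruct w as [u v]; unfold slit, Re, Im; simpl; intros Hu.
destruct (Req_dec v 0) as [->|Hv]; [left; nra|right].
intros H; assert (H' : u * v = 0) by lra.
apply Rmult_integral in H'; lra.
Qed.

Lemma Re_Carcsinh_arg_pos w : 0 < Re w -> 0 < Re (w + Csqrt (1 + w * w)).
Proof.
intros H; pose proof (Re_Csqrt_pos _ (slit_1_plus_sqr w H)).
change (0 < Re w + Re (Csqrt (1 + w * w))); lra.
Qed.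

Lemma Cdiff_Carcsinh w : 0 < Re w -> exists l, Cdiff Carcsinh w l.
Proof.
intros H; pose proof (slit_1_plus_sqr w H) as Hs.
destruct (Cdiff_Csqrt _ Hs) as [l Hl].
eexists; unfold Carcsinh.
apply (Cdiff_comp Clog (fun w => w + Csqrt (1 + w * w))%C).
- apply Cdiff_plus; [apply Cdiff_id|].
  apply (Cdiff_comp Csqrt (fun w => 1 + w * w)%C); [|apply Hl].
  apply Cdiff_plus; [apply Cdiff_const|].
  apply Cdiff_mult; apply Cdiff_id.
- apply Cdiff_Clog; left; now apply Re_Carcsinh_arg_pos.
Qed.

Lemma Cdiff_psi i z : Rabs (Im z) < PI / 2 -> exists l, Cdiff (psi i) z l.
Proof.
intros H; destruct i.
- eexists; apply Cdiff_Cexp.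
- destruct (Cdiff_Carcsinh _ (Re_Cexp_pos z H)) as [l Hl].
  eexists; apply (Cdiff_comp Carcsinh Cexp); [apply Cdiff_Cexp|apply Hl].
Qed.

(** With s = sqrt(1 + w^2) one has (w + s)(s - w) = 1, so exp Z = w + s and exp(-Z) = s - w, that
    is, sinh Z = w. The two equations are its real and imaginary parts, and the first forces Re Z >
    0. *)
Lemma Carcsinh_spec w : 0 < Re w ->
  0 < Re (Carcsinh w) /\ - (PI / 2) < Im (Carcsinh w) < PI / 2 /\
  Re w = sinh (Re (Carcsinh w)) * cos (Im (Carcsinh w)) /\
  Im w = cosh (Re (Carcsinh w)) * sin (Im (Carcsinh w)).
Proof.
intros H.
set (s := Csqrt (1 + w * w)).
assert (Hs : (s * s = 1 + w * w)%C) by (apply Csqrt_sqr, slit_neq_0, slit_1_plus_sqr, H).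
pose proof (Re_Carcsinh_arg_pos w H) as Hp; fold s in Hp.
assert (Hb : - (PI / 2) < Im (Carcsinh w) < PI / 2) by now apply Carg_right_bound.
assert (Hn : (w + s)%C <> 0) by (apply slit_neq_0; now left).
assert (E1 : Cexp (Carcsinh w) = (w + s)%C) by now apply Cexp_Clog.
assert (E2 : Cexp (- Carcsinh w) = (s - w)%C).
{ rewrite Cexp_opp, E1.
  assert (E3 : ((w + s) * (s - w) = 1)%C).
  { replace ((w + s) * (s - w))%C with (s * s - w * w)%C by ring; rewrite Hs; ring. }
  replace (s - w)%C with ((w + s) * (s - w) * / (w + s))%C by (field; auto).
  rewrite E3; ring. }
assert (E3 : (RtoC 2 * w = Cexp (Carcsinh w) - Cexp (- Carcsinh w))%C) by (rewrite E1, E2; ring).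
set (Z := Carcsinh w) in *; clearbody Z; destruct Z as [a b]; clear E1 E2.
pose proof (f_equal Re E3) as R; pose proof (f_equal Im E3) as I.
destruct w as [u v]; unfold Cexp, Re, Im in *; simpl in *.
rewrite cos_neg in R; rewrite sin_neg in I.
assert (Eu : u = sinh a * cos b) by (unfold sinh; lra).
assert (Ev : v = cosh a * sin b) by (unfold cosh; lra).
repeat split; auto; try lra.
assert (Hc : 0 < cos b) by (apply cos_gt_0; lra).
apply Rnot_le_lt; intros Ha.
assert (Hsa : sinh a <= 0).
{ destruct (Req_dec a 0) as [->|]; [rewrite sinh_0; lra|].
  rewrite <- sinh_0; apply Rlt_le, sinh_lt; lra. }
nra.
Qed.

Lemma mult_cos_le_sin x : 0 <= x <= PI -> x * cos x <= sin x.
Proof.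
intros Hx.
destruct (MVT_gen (fun t => sin t - t * cos t) 0 x (fun t => t * sin t)) as [c [Hc E]].
- intros t _; auto_derive; [auto|ring].
- intros t _; apply continuity_pt_filterlim.
  apply (ex_derive_continuous (V := R_NormedModule) (fun t => sin t - t * cos t)).
  auto_derive; auto.
- rewrite Rmin_left, Rmax_right in Hc by lra.
  rewrite sin_0 in E.
  assert (0 <= sin c) by (apply sin_ge_0; lra).
  assert (0 <= c * sin c * (x - 0)) by (apply Rmult_le_pos; [apply Rmult_le_pos|]; lra).
  lra.
Qed.

Lemma le_sinh x : 0 <= x -> x <= sinh x.
Proof.
intros Hx.
destruct (MVT_gen (fun t => sinh t - t) 0 x (fun t => cosh t - 1)) as [c [Hc E]].
- intros t _; unfold sinh, cosh; auto_derive; [auto|field].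
- intros t _; apply continuity_pt_filterlim.
  apply (ex_derive_continuous (V := R_NormedModule) (fun t => sinh t - t)).
  unfold sinh; auto_derive; auto.
- rewrite sinh_0 in E.
  assert (1 <= cosh c).
  { unfold cosh; pose proof (exp_plus c (- c)) as H.
    rewrite Rplus_opp_r, exp_0 in H; pose proof (exp_pos c); pose proof (exp_pos (- c)).
    pose proof (Rle_0_sqr (exp c - exp (- c))); unfold Rsqr in *; nra. }
  nra.
Qed.

(** If sin^2 b <= 1/2 then cos^2 b >= 1/2, and squaring b cos b <= sin b gives the claim for b >=
    0. *)
Lemma sqr_le_2_sqr_sin b : - (PI / 2) < b < PI / 2 -> sin b * sin b <= / 2 ->
  b * b <= 2 * (sin b * sin b).
Proof.
assert (H : forall b, 0 <= b < PI / 2 -> sin b * sin b <= / 2 -> b * b <= 2 * (sin b * sin b)).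
{ clear b; intros b Hb Hs.
  pose proof (mult_cos_le_sin b ltac:(lra)) as H1.
  pose proof (sin2_cos2 b) as H2; unfold Rsqr in H2.
  assert (Hc : 0 < cos b) by (apply cos_gt_0; lra).
  assert (H3 : b * cos b * (b * cos b) <= sin b * sin b).
  { apply Rmult_le_compat; auto; apply Rmult_le_pos; lra. }
  assert (H4 : / 2 <= cos b * cos b) by lra.
  assert (H5 : b * b * / 2 <= b * b * (cos b * cos b)).
  { apply Rmult_le_compat_l; [apply Rle_0_sqr|auto]. }
  lra. }
intros Hb Hs; destruct (Rle_dec 0 b) as [H0|H0]; [apply H; auto; lra|].
specialize (H (- b) ltac:(lra)); rewrite sin_neg in H.
replace (- sin b * - sin b) with (sin b * sin b) in H by ring.
replace (- b * - b) with (b * b) in H by ring; auto.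
Qed.

(** * Decay of E_2 and E_3 along the strip *)

Lemma Cmod_Cpowr (z : C) a : z <> 0 -> Cmod (Cpowr z a) = Rpower (Cmod z) a.
Proof.
intros H; unfold Cpowr; destruct (Ceq_dec z 0) as [|_]; [contradiction|].
rewrite Cmod_Cexp; unfold Rpower; f_equal; simpl; ring.
Qed.

Lemma Rpower_exp_l u a : Rpower (exp u) a = exp (a * u).
Proof. unfold Rpower; now rewrite ln_exp. Qed.

Lemma Rpower_pos x a : 0 < Rpower x a.
Proof. apply exp_pos. Qed.

Lemma cosh_sqr a : cosh a * cosh a = 1 + sinh a * sinh a.
Proof.
unfold cosh, sinh; pose proof (exp_plus a (- a)) as H.
rewrite Rplus_opp_r, exp_0 in H; nra.
Qed.

(** The squares differ by sin^2 v (1 - m^2)^2, with v = Im z and m = exp(Re z). This is the origin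
    of cos d in C_2. *)
Lemma Cmod_1_plus_sqr_Cexp z : 0 <= cos (Im z) ->
  (1 + exp (2 * Re z)) * cos (Im z) <= Cmod (1 + Cexp z * Cexp z).
Proof.
intros Hc; apply Rsqr_incr_0_var; [|apply Cmod_ge_0].
unfold Rsqr; rewrite Cmod_sqr.
destruct z as [u v]; unfold Cexp, Re, Im in *; simpl in *.
replace (exp (2 * u)) with (exp u * exp u) by (rewrite <- exp_plus; f_equal; ring).
pose proof (sin2_cos2 v) as H; unfold Rsqr in H.
set (s := sin v) in *; set (c := cos v) in *; set (m := exp u).
assert (Hs : s * s = 1 - c * c) by lra.
replace ((1 + m * m) * c * ((1 + m * m) * c)) with ((1 + m * m) * (1 + m * m) * (c * c)) by ring.
match goal with |- _ <= ?r =>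
  replace r with (1 + 2 * (m * m) * (c * c - s * s) + m * m * (m * m) * ((c * c + s * s) * (c * c + s * s))) by ring end.
replace (c * c + s * s) with 1 by lra.
rewrite Hs.
assert (Hs0 : 0 <= 1 - c * c) by (rewrite <- Hs; apply Rle_0_sqr).
assert (0 <= (1 - c * c) * ((1 - m * m) * (1 - m * m))) by (apply Rmult_le_pos; [auto|apply Rle_0_sqr]).
lra.
Qed.

(** The factor 1 + exp(2 Re z) is bounded below by 1 on the left and by exp(2 Re z) on the right;
    the latter turns the exponent alpha into alpha - (alpha + beta) = -beta. *)
Lemma E_two_decay z alpha beta c : 0 < alpha -> 0 < beta -> 0 < c <= cos (Im z) ->
  (Re z <= 0 -> Cmod (E two (psi two z) alpha beta) <=
     / Rpower c ((alpha + beta) / 2) * exp (alpha * Re z)) /\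
  (0 <= Re z -> Cmod (E two (psi two z) alpha beta) <=
     / Rpower c ((alpha + beta) / 2) * exp (- beta * Re z)).
Proof.
intros Ha Hb Hc; simpl.
pose proof (Cmod_1_plus_sqr_Cexp z ltac:(lra)) as H.
pose proof (exp_pos (2 * Re z)) as He.
assert (Hp : 0 < Cmod (1 + Cexp z * Cexp z)) by nra.
assert (Hn : (1 + Cexp z * Cexp z)%C <> 0) by now apply Cmod_gt_0.
set (s := (alpha + beta) / 2).
assert (Hs : 0 < s) by (unfold s; lra).
rewrite Cmod_div.
2: { apply Cmod_gt_0; rewrite Cmod_Cpowr by auto; apply Rpower_pos. }
rewrite !Cmod_Cpowr by (auto; apply Cexp_neq_0).
rewrite Cmod_Cexp, Rpower_exp_l.
assert (Hlow : forall q, 0 < q -> q * c <= Cmod (1 + Cexp z * Cexp z) ->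
  / Rpower (Cmod (1 + Cexp z * Cexp z)) s <= / Rpower c s * / Rpower q s).
{ intros q Hq Hqc; rewrite <- Rinv_mult.
  rewrite Rpower_mult_distr by lra.
  apply Rinv_le_contravar; [apply Rpower_pos|].
  apply Rle_Rpower_l; [lra|]; split; [apply Rmult_lt_0_compat; lra|lra]. }
pose proof (exp_pos (alpha * Re z)).
split; intros Hu.
- assert (H1 := Hlow 1 Rlt_0_1 ltac:(nra)).
  unfold Rpower at 3 in H1; rewrite ln_1, Rmult_0_r, exp_0, Rinv_1, Rmult_1_r in H1.
  unfold Rdiv; rewrite Rmult_comm; apply Rmult_le_compat_r; [lra|auto].
- assert (H1 := Hlow (exp (2 * Re z)) He ltac:(nra)).
  rewrite Rpower_exp_l, <- exp_Ropp in H1.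
  replace (- beta * Re z) with (- (s * (2 * Re z)) + alpha * Re z) by (unfold s; field).
  rewrite exp_plus, <- Rmult_assoc.
  unfold Rdiv; rewrite Rmult_comm; apply Rmult_le_compat_r; [lra|auto].
Qed.

(** The fourth clause is |sinh(a + i b)|^2 = |exp z|^2; the size estimates for psi_3 rest on it. *)
Lemma psi_three_spec z : Rabs (Im z) < PI / 2 -> exists a b,
  psi three z = (a, b) /\ 0 < a /\ - (PI / 2) < b < PI / 2 /\
  sinh a * sinh a + sin b * sin b = exp (Re z) * exp (Re z) /\
  (Im z = 0 -> b = 0).
Proof.
intros H; pose proof (Re_Cexp_pos z H) as Hw.
destruct (Carcsinh_spec _ Hw) as (S1 & S2 & S3 & S4).
simpl; set (Z := Carcsinh (Cexp z)) in *.
exists (Re Z), (Im Z); split; [now destruct Z|]; split; [auto|]; split; [auto|]; split.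
- rewrite <- Cmod_Cexp, Cmod_sqr, S3, S4.
  pose proof (sin2_cos2 (Im Z)) as E; unfold Rsqr in E.
  pose proof (cosh_sqr (Re Z)) as E2.
  replace (cosh (Re Z) * sin (Im Z) * (cosh (Re Z) * sin (Im Z)))
    with (cosh (Re Z) * cosh (Re Z) * (sin (Im Z) * sin (Im Z))) by ring.
  rewrite E2.
  replace (sinh (Re Z) * cos (Im Z) * (sinh (Re Z) * cos (Im Z)))
    with (sinh (Re Z) * sinh (Re Z) * (cos (Im Z) * cos (Im Z))) by ring.
  replace (cos (Im Z) * cos (Im Z)) with (1 - sin (Im Z) * sin (Im Z)) by lra. ring.
- intros Hi.
  assert (I0 : Im (Cexp z) = 0) by (unfold Cexp; simpl; rewrite Hi, sin_0; ring).
  rewrite I0 in S4.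
  assert (Hc : 1 <= cosh (Re Z)).
  { pose proof (cosh_sqr (Re Z)); pose proof (Rle_0_sqr (sinh (Re Z))); unfold Rsqr in *.
    assert (0 < cosh (Re Z)) by (unfold cosh; pose proof (exp_pos (Re Z)); pose proof (exp_pos (- Re Z)); lra).
    nra. }
  symmetry in S4; apply Rmult_integral in S4; destruct S4 as [S4|S4]; [lra|].
  destruct (Rtotal_order (Im Z) 0) as [Hl|[Hl|Hl]]; auto; exfalso.
  + pose proof (sin_gt_0 (- Im Z) ltac:(lra) ltac:(lra)); rewrite sin_neg in *; lra.
  + pose proof (sin_gt_0 (Im Z) ltac:(lra) ltac:(lra)); lra.
Qed.

Lemma psi_three_ratio z : Rabs (Im z) < PI / 2 ->
  psi three z <> 0 /\ (1 + psi three z)%C <> 0 /\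
  Cmod (psi three z / (1 + psi three z)) <= 1 /\
  Cmod (psi three z / (1 + psi three z)) <= sqrt 2 * exp (Re z) /\
  (Im z = 0 -> Cmod (psi three z / (1 + psi three z)) <= exp (Re z)) /\
  0 < Re (psi three z) /\ Re z <= Re (psi three z).
Proof.
intros H; destruct (psi_three_spec z H) as (a & b & E & Ha & Hb & HW & Hr).
rewrite E.
assert (N1 : ((a, b) : C) <> 0) by (intros E0; injection E0; intros; lra).
assert (N2 : (1 + (a, b))%C <> 0).
{ intros E0; apply (f_equal Re) in E0; simpl in E0; lra. }
assert (M1 : Cmod (a, b) * Cmod (a, b) = a * a + b * b) by now rewrite Cmod_sqr.
assert (M2 : Cmod (1 + (a, b)) * Cmod (1 + (a, b)) = (1 + a) * (1 + a) + b * b).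
{ rewrite Cmod_sqr; simpl; ring. }
assert (P1 : 0 < Cmod (a, b)) by now apply Cmod_gt_0.
assert (P2 : 0 < Cmod (1 + (a, b))) by now apply Cmod_gt_0.
rewrite Cmod_div by auto.
set (m1 := Cmod (a, b)) in *; set (m2 := Cmod (1 + (a, b))) in *.
pose proof (exp_pos (Re z)) as Hw; set (w := exp (Re z)) in *.
pose proof (le_sinh a ltac:(lra)) as Hsh.
assert (Hm2 : 1 <= m2) by nra.
split; auto; split; auto; split; [|split; [|split; [|split]]].
- apply Rle_div_l; auto; nra.
- apply Rle_div_l; auto.
  apply Rsqr_incr_0_var; [|repeat apply Rmult_le_pos; try lra; apply sqrt_pos].
  unfold Rsqr.
  replace (sqrt 2 * w * m2 * (sqrt 2 * w * m2)) with (sqrt 2 * sqrt 2 * (w * w) * (m2 * m2)) by ring.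
  rewrite sqrt_sqrt, M1, M2, <- HW by lra.
  (* Write Z = a + i b. If sin^2 b <= 1/2 then |Z|^2 <= 2 |exp z|^2 and |1 + Z| >= 1; otherwise 2
     |exp z|^2 >= 1 and |Z| <= |1 + Z|. *)
  destruct (Rle_dec (sin b * sin b) (/ 2)) as [Hs|Hs].
  + pose proof (sqr_le_2_sqr_sin b Hb Hs).
    assert (G1 : a * a + b * b <= 2 * (sinh a * sinh a + sin b * sin b)) by nra.
    pose proof (Rle_0_sqr b); unfold Rsqr in *. nra.
  + assert (G1 : 1 <= 2 * (sinh a * sinh a + sin b * sin b)) by nra.
    pose proof (Rle_0_sqr b); unfold Rsqr in *. nra.
- intros Hi; specialize (Hr Hi); subst b.
  rewrite sin_0 in HW.
  assert (Haw : a <= w) by nra.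
  assert (Hm1 : m1 = a) by nra.
  apply Rle_div_l; auto; nra.
- exact Ha.
(* Contradicts exp(2 Re z) = sinh^2 a + sin^2 b <= cosh^2 a <= exp(2 a). *)
- apply Rnot_lt_le; intros Hlt; simpl in Hlt.
  assert (Hew : exp a < w) by now apply exp_increasing.
  pose proof (sin2_cos2 b) as H2; unfold Rsqr in H2.
  pose proof (Rle_0_sqr (cos b)) as H3; unfold Rsqr in H3.
  pose proof (cosh_sqr a) as H4.
  assert (H5 : cosh a <= exp a).
  { unfold cosh; assert (exp (- a) <= exp a) by (apply Rlt_le, exp_increasing; lra). lra. }
  assert (H6 : 0 < cosh a) by (unfold cosh; pose proof (exp_pos a); pose proof (exp_pos (- a)); lra).
  nra.
Qed.

(** [c] will be sqrt 2 on the strip and 1 on the real axis. On the left the exponential factor is at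
    most 1; on the right the ratio is at most 1, and Re psi_3(z) >= Re z transfers the decay. *)
Lemma E_three_decay z alpha beta c : 0 < alpha -> 0 < beta -> Rabs (Im z) < PI / 2 ->
  1 <= c -> Cmod (psi three z / (1 + psi three z)) <= c * exp (Re z) ->
  (Re z <= 0 -> Cmod (E three (psi three z) alpha beta) <= Rpower c alpha * exp (alpha * Re z)) /\
  (0 <= Re z -> Cmod (E three (psi three z) alpha beta) <= exp (- beta * Re z)).
Proof.
intros Ha Hb Hz Hc Hq.
destruct (psi_three_ratio z Hz) as (N1 & N2 & R1 & _ & _ & P1 & P2).
unfold E; set (Z := psi three z) in *.
assert (Hn : (Z / (1 + Z))%C <> 0).
{ apply Cmod_gt_0; rewrite Cmod_div by auto.
  apply Rdiv_lt_0_compat; now apply Cmod_gt_0. }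
assert (Hn0 : 0 < Cmod (Z / (1 + Z))) by now apply Cmod_gt_0.
rewrite Cmod_mult, Cmod_Cpowr, Cmod_Cexp by auto.
replace (Re (- (RtoC beta * Z))) with (- beta * Re Z) by (destruct Z; simpl; ring).
set (q := Cmod (Z / (1 + Z))) in *.
pose proof (exp_pos (Re z)).
pose proof (exp_pos (- beta * Re Z)).
split; intros Hu.
- rewrite <- (Rmult_1_r (Rpower c alpha * exp (alpha * Re z))).
  apply Rmult_le_compat; try apply Rlt_le, Rpower_pos; try lra.
  + rewrite <- Rpower_exp_l, Rpower_mult_distr by lra.
    apply Rle_Rpower_l; lra.
  + rewrite <- exp_0; apply Rlt_le, exp_increasing; nra.
- rewrite <- (Rmult_1_l (exp (- beta * Re z))).
  apply Rmult_le_compat; try apply Rlt_le, Rpower_pos; try lra.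
  + replace 1 with (Rpower 1 alpha) by (unfold Rpower; rewrite ln_1, Rmult_0_r; apply exp_0).
    apply Rle_Rpower_l; lra.
  + destruct (Req_dec (Re z) (Re Z)) as [->|Hne]; [lra|].
    apply Rlt_le, exp_increasing; nra.
Qed.

(** * The inverse of psi on the positive half-line *)

Lemma Clog_RtoC q : 0 < q -> Clog (RtoC q) = RtoC (ln q).
Proof.
intros Hq; unfold Clog, Carg; rewrite Cmod_R, Rabs_pos_eq by lra.
simpl; destruct (Rle_dec 0 0) as [_|n]; [|lra].
replace (q / q) with 1 by (field; lra); now rewrite acos_1.
Qed.

Lemma Cexp_RtoC x : Cexp (RtoC x) = RtoC (exp x).
Proof. unfold Cexp; simpl; rewrite cos_0, sin_0; unfold RtoC; f_equal; ring. Qed.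

Lemma Csqrt_RtoC_sqr q : 0 < q -> Csqrt (RtoC (q * q)) = RtoC q.
Proof.
intros Hq.
assert (Hqq : 0 < q * q) by now apply Rmult_lt_0_compat.
rewrite Csqrt_neq_0_def by (intros E; apply RtoC_inj in E; lra).
rewrite Clog_RtoC, <- RtoC_mult, Cexp_RtoC by auto; f_equal.
rewrite ln_mult by auto.
replace (1 / 2 * (ln q + ln q)) with (ln q) by field; now apply exp_ln.
Qed.

Lemma psi_onto i t : 0 < t -> exists x, psi i (RtoC x) = RtoC t.
Proof.
intros Ht; destruct i; simpl.
- exists (ln t); now rewrite Cexp_RtoC, exp_ln.
- exists (ln (sinh t)); rewrite Cexp_RtoC, exp_ln by now apply sinh_pos_lt.
  unfold Carcsinh.
  rewrite <- RtoC_mult, <- RtoC_plus, <- cosh_sqr, Csqrt_RtoC_sqr.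
  + rewrite <- RtoC_plus.
    replace (sinh t + cosh t) with (exp t) by (unfold sinh, cosh; field).
    rewrite Clog_RtoC by apply exp_pos; now rewrite ln_exp.
  + unfold cosh; pose proof (exp_pos t); pose proof (exp_pos (- t)); lra.
Qed.

Lemma psi_psi_inv i t : 0 < t -> psi i (RtoC (psi_inv i t)) = RtoC t.
Proof.
intros Ht; exact (epsilon_spec (inhabits 0) (fun x => psi i (RtoC x) = RtoC t) (psi_onto i t Ht)).
Qed.

(** * The error bound *)

(** The loss on the strip relative to the real axis; with it both C_i take the form 2 K / r (2
    [E_const] / (r (1 - exp(-2 r))) + 1). *)
Definition E_const (i : case_index) (d alpha beta : R) : R :=
  match i with
  | two => / Rpower (cos d) ((alpha + beta) / 2)
  | three => Rpower 2 ((alpha + beta) / 2) * / Rpower (cos (d / 2)) (alpha + beta)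
  end.

Lemma Rpower_1_l a : Rpower 1 a = 1.
Proof. unfold Rpower; rewrite ln_1, Rmult_0_r; apply exp_0. Qed.

Lemma E_const_pos i d alpha beta : 0 < E_const i d alpha beta.
Proof.
destruct i; simpl; [|apply Rmult_lt_0_compat; [apply Rpower_pos|]];
  apply Rinv_0_lt_compat, Rpower_pos.
Qed.

Lemma cos_ge_of_Rabs_lt y d : 0 < d < PI / 2 -> Rabs y < d -> 0 < cos d <= cos y.
Proof.
intros Hd Hy; split; [apply cos_gt_0; lra|].
replace (cos y) with (cos (Rabs y))
  by (unfold Rabs; destruct Rcase_abs; [now rewrite cos_neg|reflexivity]).
pose proof (Rabs_pos y); apply cos_decr_1; lra.
Qed.

Lemma E_decay i d alpha beta : 0 < d < PI / 2 -> 0 < alpha -> 0 < beta ->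
  decay_bound (fun z => E i (psi i z) alpha beta) (strip d) (E_const i d alpha beta) alpha beta.
Proof.
intros Hd Ha Hb z Hz; unfold strip in Hz; destruct i.
- apply E_two_decay; auto; now apply cos_ge_of_Rabs_lt.
- assert (Hz' : Rabs (Im z) < PI / 2) by lra.
  assert (Hs2 : 1 <= sqrt 2).
  { rewrite <- sqrt_1 at 1; apply sqrt_le_1; lra. }
  destruct (E_three_decay z alpha beta (sqrt 2) Ha Hb Hz' Hs2) as [D1 D2].
  { now apply psi_three_ratio. }
  (* The factor (sqrt 2)^alpha = 2^(alpha / 2) just obtained is enlarged to the one in C_3, using
     cos(d / 2) <= 1. *)
  assert (Hc : 0 < cos (d / 2) <= 1) by (split; [apply cos_gt_0; lra|apply COS_bound]).
  assert (Hi : 1 <= / Rpower (cos (d / 2)) (alpha + beta)).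
  { rewrite <- Rinv_1; apply Rinv_le_contravar; [apply Rpower_pos|].
    rewrite <- (Rpower_1_l (alpha + beta)); apply Rle_Rpower_l; lra. }
  assert (H1 : Rpower (sqrt 2) alpha <= Rpower 2 ((alpha + beta) / 2)).
  { rewrite <- Rpower_sqrt, Rpower_mult by lra; apply Rle_Rpower; lra. }
  assert (H2 : 1 <= Rpower 2 ((alpha + beta) / 2)).
  { rewrite <- (Rpower_O 2) by lra; apply Rle_Rpower; lra. }
  unfold E_const.
  set (P := Rpower 2 ((alpha + beta) / 2)) in *; set (Q := / Rpower (cos (d / 2)) (alpha + beta)) in *.
  pose proof (exp_pos (alpha * Re z)); pose proof (exp_pos (- beta * Re z)).
  assert (HPQ : P <= P * Q) by nra.
  split; intros Hu.
  + eapply Rle_trans; [now apply D1|]; apply Rmult_le_compat_r; lra.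
  + eapply Rle_trans; [now apply D2|]; nra.
Qed.

(** On the axis the cosine is 1 and a <= sinh a controls psi_3, so no constant is lost. *)
Lemma E_decay_real i alpha beta : 0 < alpha -> 0 < beta ->
  decay_bound (fun z => E i (psi i z) alpha beta) (fun z => Im z = 0) 1 alpha beta.
Proof.
intros Ha Hb z Hz; pose proof PI_RGT_0 as HPI; destruct i.
- destruct (E_two_decay z alpha beta 1) as [D1 D2]; auto.
  { rewrite Hz, cos_0; lra. }
  rewrite Rpower_1_l, Rinv_1 in D1, D2; now split.
- assert (Hz' : Rabs (Im z) < PI / 2) by (rewrite Hz, Rabs_R0; lra).
  destruct (E_three_decay z alpha beta 1) as [D1 D2]; auto; try lra.
  { rewrite Rmult_1_l; now apply psi_three_ratio. }
  rewrite Rpower_1_l in D1; split; auto.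
  intros Hu; rewrite Rmult_1_l; auto.
Qed.

Lemma decay_bound_le F G D K A alpha beta : 0 <= K ->
  (forall z, D z -> Cmod (F z) <= K * Cmod (G z)) ->
  decay_bound G D A alpha beta -> decay_bound F D (K * A) alpha beta.
Proof.
intros HK HFG HG z Hz; destruct (HG z Hz) as [G1 G2].
split; intros Hu; (eapply Rle_trans; [now apply HFG|]);
  rewrite Rmult_assoc; apply Rmult_le_compat_l; auto.
Qed.

Lemma error_const_eq i K d alpha beta : 0 < d -> 0 < alpha -> 0 < beta ->
  let r := sqrt (PI * d * Rmin alpha beta) in
  error_const i K d alpha beta =
  2 * K / r * (2 * E_const i d alpha beta / (r * (1 - exp (- (2 * r)))) + 1).
Proof.
intros Hd Ha Hb r.
pose proof PI_RGT_0 as HPI.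
assert (Hr : 0 < r).
{ apply sqrt_lt_R0, Rmult_lt_0_compat; [apply Rmult_lt_0_compat; lra|now apply Rmin_pos]. }
assert (He : exp (- (2 * r)) < 1) by (rewrite <- exp_0; apply exp_increasing; lra).
destruct i; unfold error_const, E_const; fold r.
- pose proof (Rpower_pos (cos d) ((alpha + beta) / 2)); field; repeat split; lra.
- pose proof (Rpower_pos (cos (d / 2)) (alpha + beta)).
  rewrite Rpower_plus, Rpower_1 by lra; field; repeat split; lra.
Qed.

(** Separates the decay exp(-q) from a quotient that stays bounded for large q. *)
Lemma inv_sinh_eq q : 0 < q -> / sinh q = 2 * exp (- q) * / (1 - exp (- (2 * q))).
Proof.
intros Hq; unfold sinh.
assert (H1 : exp (- q) < exp q) by (apply exp_increasing; lra).
assert (H2 : exp (- (2 * q)) < 1) by (rewrite <- exp_0; apply exp_increasing; lra).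
assert (E1 : exp (- (2 * q)) = exp (- q) * exp (- q)) by (rewrite <- exp_plus; f_equal; ring).
assert (E2 : exp q * exp (- q) = 1) by (rewrite <- exp_plus, Rplus_opp_r; apply exp_0).
apply (Rmult_eq_reg_r (((exp q - exp (- q)) / 2) * (1 - exp (- (2 * q))))).
- transitivity (1 - exp (- (2 * q))); [field; lra|].
  transitivity (exp (- q) * (exp q - exp (- q))); [|field; lra].
  rewrite E1; lra.
- apply Rgt_not_eq, Rmult_lt_0_compat; lra.
Qed.

(** With r = sqrt(pi d mu), s = sqrt n and q = r s, the choice of h gives pi d / h = mu n h = q, so
    both errors decay like exp(-q). Since mu h = r / s, each tail carries the factor s / r; the
    discretization term lacks the factor s, and s >= 1 supplies it. *)
Lemma error_terms_le K B d alpha beta mu n h M N :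
  0 < K -> 0 < B -> 0 < d -> 0 < alpha -> 0 < beta -> mu = Rmin alpha beta ->
  (0 < n)%nat -> h = sqrt (PI * d / (mu * INR n)) ->
  mu * INR n <= alpha * INR M -> mu * INR n <= beta * INR N ->
  let r := sqrt (PI * d * mu) in
  K * B * (/ alpha + / beta) * / (PI * (d * sinh (PI / h * d))) +
  K * (exp (- alpha * (INR M * h)) * / (alpha * h) + exp (- beta * (INR N * h)) * / (beta * h))
  <= 2 * K / r * (2 * B / (r * (1 - exp (- (2 * r)))) + 1) * sqrt (INR n)
     * exp (- sqrt (PI * d * mu * INR n)).
Proof.
intros HK HB Hd Ha Hb Hmu Hn Hh HM HN r.
pose proof PI_RGT_0 as HPI.
assert (Hmu0 : 0 < mu) by (rewrite Hmu; now apply Rmin_pos).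
assert (Hma : mu <= alpha) by (rewrite Hmu; apply Rmin_l).
assert (Hmb : mu <= beta) by (rewrite Hmu; apply Rmin_r).
assert (Hn1 : 1 <= INR n) by (change 1 with (INR 1); apply le_INR; lia).
assert (Hpdm : 0 < PI * d * mu) by (apply Rmult_lt_0_compat; [apply Rmult_lt_0_compat|]; lra).
assert (Hr : 0 < r) by now apply sqrt_lt_R0.
assert (Hrr : r * r = PI * d * mu) by (apply sqrt_sqrt; lra).
set (s := sqrt (INR n)).
assert (Hs1 : 1 <= s) by (unfold s; rewrite <- sqrt_1 at 1; apply sqrt_le_1; lra).
assert (Hss : s * s = INR n) by (apply sqrt_sqrt; lra).
assert (Eq : sqrt (PI * d * mu * INR n) = r * s) by (apply sqrt_mult; lra).
assert (Ehh : h = r / (mu * s)).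
{ rewrite Hh; apply Rsqr_inj.
  - apply sqrt_pos.
  - apply Rlt_le, Rdiv_lt_0_compat; [auto|apply Rmult_lt_0_compat; lra].
  - rewrite Rsqr_sqrt.
    + unfold Rsqr.
      replace (r / (mu * s) * (r / (mu * s))) with (r * r / (mu * mu * (s * s))) by (field; lra).
      rewrite Hrr, Hss; field; lra.
    + apply Rlt_le, Rdiv_lt_0_compat; [|apply Rmult_lt_0_compat; lra].
      apply Rmult_lt_0_compat; lra. }
assert (Hh0 : 0 < h).
{ rewrite Ehh; apply Rdiv_lt_0_compat; [auto|apply Rmult_lt_0_compat; lra]. }
assert (Emh : mu * h = r / s) by (rewrite Ehh; field; lra).
rewrite Eq; set (q := r * s).
assert (Hq : 0 < q) by (apply Rmult_lt_0_compat; lra).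
assert (Eqh : PI / h * d = q).
{ replace (PI / h * d) with (PI * d * mu / (mu * h)) by (field; lra).
  rewrite <- Hrr, Emh; unfold q; field; lra. }
assert (Eqn : mu * INR n * h = q).
{ replace (mu * INR n * h) with (mu * h * INR n) by ring.
  rewrite Emh, <- Hss; unfold q; field; lra. }
rewrite Eqh.
assert (Hinv : forall a, mu <= a -> / a <= / mu) by (intros; apply Rinv_le_contravar; lra).
assert (He1 : exp (- (2 * r)) < 1) by (rewrite <- exp_0; apply exp_increasing; lra).
(* n >= 1 gives q >= r, hence a denominator independent of n. *)
assert (He2 : exp (- (2 * q)) <= exp (- (2 * r))).
{ assert (Hrq : r <= q) by (unfold q; nra).
  destruct (Req_dec r q) as [E0|]; [right; f_equal; lra|apply Rlt_le, exp_increasing; lra]. }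
pose proof (exp_pos (- q)) as Hexp.
assert (T : forall a m, mu <= a -> mu * INR n <= a * INR m ->
  exp (- a * (INR m * h)) * / (a * h) <= exp (- q) * (s / r)).
{ intros a m Hma' Ham; apply Rmult_le_compat.
  - apply Rlt_le, exp_pos.
  - apply Rlt_le, Rinv_0_lt_compat, Rmult_lt_0_compat; lra.
  - assert (Hle : q <= a * (INR m * h)).
    { rewrite <- Eqn, <- Rmult_assoc; apply Rmult_le_compat_r; lra. }
    destruct (Req_dec q (a * (INR m * h))) as [E0|].
    + right; f_equal; lra.
    + apply Rlt_le, exp_increasing; lra.
  - replace (s / r) with (/ (mu * h)) by (rewrite Emh; field; lra).
    apply Rinv_le_contravar; [apply Rmult_lt_0_compat; lra|].
    apply Rmult_le_compat_r; lra. }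
assert (T1 := T alpha M Hma HM); assert (T2 := T beta N Hmb HN).
assert (D : K * B * (/ alpha + / beta) * / (PI * (d * sinh q)) <=
  2 * K / r * (2 * B / (r * (1 - exp (- (2 * r))))) * s * exp (- q)).
{ rewrite !Rinv_mult, inv_sinh_eq by auto.
  (* 1 / alpha + 1 / beta <= 2 / mu, and 1 - exp(-2 q) is replaced by the smaller 1 - exp(-2 r). *)
  apply Rle_trans with (K * B * (2 * / mu) * (/ PI * (/ d * (2 * exp (- q) * / (1 - exp (- (2 * r))))))).
  - apply Rmult_le_compat.
    + assert (0 < / alpha) by now apply Rinv_0_lt_compat.
      assert (0 < / beta) by now apply Rinv_0_lt_compat.
      repeat apply Rmult_le_pos; lra.
    + repeat apply Rmult_le_pos; try lra; apply Rlt_le, Rinv_0_lt_compat; lra.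
    + apply Rmult_le_compat_l; [apply Rmult_le_pos; lra|].
      pose proof (Hinv alpha Hma); pose proof (Hinv beta Hmb); lra.
    + repeat apply Rmult_le_compat_l; try (apply Rlt_le, Rinv_0_lt_compat; lra); try lra.
      apply Rinv_le_contravar; lra.
  - replace (K * B * (2 * / mu) * (/ PI * (/ d * (2 * exp (- q) * / (1 - exp (- (2 * r)))))))
      with (4 * K * B * exp (- q) * / (1 - exp (- (2 * r))) / (PI * d * mu)) by (field; lra).
    rewrite <- Hrr.
    replace (2 * K / r * (2 * B / (r * (1 - exp (- (2 * r))))) * s * exp (- q))
      with (s * (4 * K * B * exp (- q) * / (1 - exp (- (2 * r))) / (r * r))) by (field; lra).
    rewrite <- (Rmult_1_l (_ / (r * r))) at 1.
    apply Rmult_le_compat_r; auto.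
    assert (0 < / (1 - exp (- (2 * r)))) by (apply Rinv_0_lt_compat; lra).
    assert (0 < / (r * r)) by (apply Rinv_0_lt_compat, Rmult_lt_0_compat; lra).
    unfold Rdiv; repeat apply Rmult_le_pos; lra. }
set (Y := 2 * B / (r * (1 - exp (- (2 * r))))) in *.
replace (2 * K / r * (Y + 1) * s * exp (- q))
  with (2 * K / r * Y * s * exp (- q) + 2 * K / r * s * exp (- q)) by ring.
apply Rplus_le_compat; [exact D|].
replace (2 * K / r * s * exp (- q)) with (K * (exp (- q) * (s / r) + exp (- q) * (s / r))) by (field; lra).
apply Rmult_le_compat_l; lra.
Qed.

Theorem theorem2p4 (i : case_index) (d : R) (hd0 : 0 < d) (hd1 : d < PI / 2)
  (f : C -> C) (f_an : analytic_in (image (psi i) (strip d)) f)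
  (K alpha beta : R) (hK : 0 < K) (halpha : 0 < alpha) (hbeta : 0 < beta)
  (f_bound : forall z : C, image (psi i) (strip d) z ->
     Cmod (f z) <= K * Cmod (E i z alpha beta))
  (mu : R) (hmu : mu = Rmin alpha beta)
  (n : nat) (hn : (0 < n)%nat)
  (h : R) (hh : h = sqrt (PI * d / (mu * INR n)))
  (M N : nat)
  (hMN_alpha : mu = alpha ->
     M = n /\ Z.of_nat N = Zceil (alpha * INR n / beta))
  (hMN_beta : mu = beta ->
     N = n /\ Z.of_nat M = Zceil (beta * INR n / alpha)) :
  Rbar_le
    (Lub_Rbar (fun y : R => exists t : R,
       0 < t /\ y = Cmod (f (RtoC t) - sinc_approx i f h M N t)%C))
    (Finite (error_const i K d alpha beta
             * sqrt (INR n) * exp (- sqrt (PI * d * mu * INR n)))).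
Proof.
apply (proj2 (Lub_Rbar_correct _)); intros y [t [Ht ->]].
set (F := fun z => f (psi i z)).
set (x := psi_inv i t).
assert (Ex : f (RtoC t) = F (RtoC x)) by (unfold F, x; now rewrite psi_psi_inv).
change (sinc_approx i f h M N t) with (sumZ M N (sinc_term F h x)).
rewrite Ex.
assert (Himg : forall z, strip d z -> image (psi i) (strip d) (psi i z)) by (intros z Hz; now exists z).
assert (HF : forall z, strip d z -> exists l, Cdiff F z l).
{ intros z Hz; destruct (f_an _ (Himg z Hz)) as [l Hl].
  destruct (Cdiff_psi i z) as [l' Hl']; [unfold strip in Hz; lra|].
  eexists; apply (Cdiff_comp f (psi i)); [apply Hl'|exact (Cdiff_of_is_derive _ _ _ Hl)]. }
assert (HFE : forall z, strip d z -> Cmod (F z) <= K * Cmod (E i (psi i z) alpha beta)).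
{ intros z Hz; now apply f_bound, Himg. }
assert (Hn1 : 0 < INR n) by (apply lt_0_INR; lia).
pose proof PI_RGT_0 as HPI.
assert (Hmu0 : 0 < mu) by (rewrite hmu; now apply Rmin_pos).
assert (Hh0 : 0 < h).
{ rewrite hh; apply sqrt_lt_R0, Rdiv_lt_0_compat; apply Rmult_lt_0_compat; lra. }
(* Rounding up keeps both tail exponents, alpha M and beta N, at least mu n. *)
assert (Hceil : forall a b m, 0 < b -> Z.of_nat m = Zceil (a * INR n / b) -> a * INR n <= b * INR m).
{ intros a b m Hb Hm; destruct (Zceil_bound (a * INR n / b)) as [_ H].
  rewrite <- Hm, <- INR_IZR_INZ in H.
  rewrite Rmult_comm with (r1 := b); apply Rle_div_l; auto. }
assert (HMN : mu * INR n <= alpha * INR M /\ mu * INR n <= beta * INR N).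
{ destruct (Rle_dec alpha beta) as [Hab|Hab].
  - assert (Em : mu = alpha) by (rewrite hmu; now apply Rmin_left).
    destruct (hMN_alpha Em) as [-> HN]; rewrite Em; split; [lra|now apply Hceil].
  - assert (Em : mu = beta) by (rewrite hmu; apply Rmin_right; lra).
    destruct (hMN_beta Em) as [-> HM]; rewrite Em; split; [now apply Hceil|lra]. }
simpl; rewrite error_const_eq by auto; rewrite <- hmu.
eapply Rle_trans; [apply (sinc_approximation_error F d h x (K * E_const i d alpha beta) K alpha beta M N); auto|].
- apply Rmult_le_pos; [lra|apply Rlt_le, E_const_pos].
- lra.
- apply (decay_bound_le F (fun z => E i (psi i z) alpha beta)); auto; [lra|].
  apply E_decay; auto.
- rewrite <- (Rmult_1_r K) at 1.
  apply (decay_bound_le F (fun z => E i (psi i z) alpha beta)); [lra| |now apply E_decay_real].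
  intros z Hz; apply HFE; unfold strip; rewrite Hz, Rabs_R0; auto.
- apply error_terms_le; auto; try tauto; apply E_const_pos.
Qed.
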